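(* Let $X\in\mathfrak X(G/K)^K$. Then $X$ is horizontally flat if and only if $j_*(X)\in\mathfrak X(P)^K_{\rm flat}$.
   Context: $G\subset \mathrm{GL}(N,\mathbf C)$ is a connected complex reductive linear algebraic group, $\theta$ an involutive automorphism of $G$ (its differential on $\mathfrak g$ is also denoted $\theta$), $K=G^\theta$, and $\mathfrak g=\mathfrak k+\mathfrak p$ the decomposition into $\pm1$-eigenspaces of $\theta$. $\mathbf C[G/K]$ is identified with the right $K$-invariant regular functions on $G$. $\mathfrak X(G/K)^K$ is the space of $K$-invariant regular vector fields on $G/K$. Each such $X$ corresponds to a unique regular map $\Phi:G\to\mathfrak p$ with $\Phi(kgk')=\mathrm{Ad}(k')^{-1}\Phi(g)$ for $k,k'\in K$, via $Xf(g)=\frac{d}{dt}f(g(1+t\Phi(g)))|_{t=0}$ for $f\in\mathbf C[G/K]$. The horizontal lift $X^*$ of $X$ is the vector field on $G$ given by the same formula for $f\in\mathbf C[G]$, i.e. $X^*_g=g\Phi(g)\in T_gG$. $P=\{g\theta(g)^{-1}:g\in G\}\subset G$ is a closed subset isomorphic to $G/K$ via the Cartan embedding $j:G/K\to P$, $j(gK)=g\theta(g)^{-1}$; $K$ acts on $P$ by conjugation. With $j^*f=f\circ j$ for $f\in\mathbf C[P]$, $j_*(X)=(j^* )^{-1}\circ X\circ j^*$ is the push-forward vector field on $P$. $X$ is called horizontally flat if $X^*_y\in T_yP$ for all $y\in P$. For $y\in P$ let $\theta_y=(\mathrm{Ad}\,y)^{-1}\theta$, $\mathfrak p_y$ its $-1$-eigenspace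 in $\mathfrak g$ and $\pi_y=\frac12(1-\theta_y)$; then $T_yP=y\,\mathfrak p_y$. For a regular map $\Psi:P\to\mathfrak g$, $\tilde\Psi$ is the vector field on $P$ with $\tilde\Psi f(y)=\frac{d}{dt}f(y+ty\pi_y\Psi(y))|_{t=0}$. $\mathfrak X(P)^K_{\rm flat}$ is the set of vector fields $\tilde\Psi$ where $\Psi:P\to\mathfrak p$ is regular, $K$-equivariant ($\Psi(kyk^{-1})=\mathrm{Ad}(k)\Psi(y)$) and satisfies $\mathrm{Ad}(y)\Psi(y)=\Psi(y)$ for all $y\in P$. *)

(* Defs.v *)
From HB Require Import structures.
From mathcomp Require Import all_boot all_order all_algebra.
From mathcomp Require Import complex mpoly.
From mathcomp Require Import boolp classical_sets reals topology normedtype.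
From mathcomp Require Import derive.

Set Implicit Arguments.
Unset Strict Implicit.
Unset Printing Implicit Defensive.

Import GRing.Theory Num.Theory numFieldNormedType.Exports.

Local Open Scope classical_set_scope.
Local Open Scope ring_scope.
Local Open Scope complex_scope.

(* The complex numbers are R[i] for R : realType.  Functions and operators
   attached to a subset S of GL(N, C) are total functions on 'M[R[i]]_N that
   are only considered on S, i.e. up to {in S, _ =1 _}. *)

(** * Regular functions on closed subsets of GL(N, C) *)

(* C[GL_N] = C[x_ij, 1 / det]. *)
Definition regular_GL (R : realType) (N : nat) (F : 'M[R[i]]_N -> R[i]) : Prop :=
  exists (p : {mpoly R[i][N * N]}) (m : nat),
    forall x, x \in unitmx -> F x = p.@[mxvec x 0] / (\det x) ^+ m.

Definition zariski_closed (R : realType) (N : nat) (Z : set 'M[R[i]]_N) : Prop :=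
  exists I : set {mpoly R[i][N * N]},
    Z = [set x | x \in unitmx /\ forall p, I p -> p.@[mxvec x 0] = 0].

Definition zariski_connected (R : realType) (N : nat) (Z : set 'M[R[i]]_N) : Prop :=
  Z !=set0 /\
  forall A B : set 'M[R[i]]_N, zariski_closed A -> zariski_closed B ->
    A `|` B = Z -> A `&` B = set0 -> A = set0 \/ B = set0.

(* For S Zariski closed in GL_N this is C[S] = C[GL_N] / I(S). *)
Definition regular_on (R : realType) (N : nat) (S : set 'M[R[i]]_N)
    (f : 'M[R[i]]_N -> R[i]) : Prop :=
  exists2 F, regular_GL F & {in S, f =1 F}.

Definition regular_map (R : realType) (N : nat) (S : set 'M[R[i]]_N)
    (Phi : 'M[R[i]]_N -> 'M[R[i]]_N) : Prop :=
  forall i j, regular_on S (fun x => Phi x i j).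

(** * Derivatives and tangent spaces *)

(* The complex derivative d/dt F(x + t v) at t = 0. *)
Definition ddt0 (R : realType) (N : nat) (F : 'M[R[i]]_N -> R[i])
    (x v : 'M[R[i]]_N) : R[i] :=
  derive1 (V := R[i]^o) (fun t : R[i] => F (x + t *: v)) 0.

(* The Zariski tangent space of S at x, inside 'M_N = T_x GL_N. *)
Definition tangent (R : realType) (N : nat) (S : set 'M[R[i]]_N)
    (x : 'M[R[i]]_N) : set 'M[R[i]]_N :=
  [set v | forall F, regular_GL F -> (forall y, S y -> F y = 0) ->
           ddt0 F x v = 0].

Definition extension (R : realType) (N : nat) (S : set 'M[R[i]]_N)
    (f : 'M[R[i]]_N -> R[i]) : 'M[R[i]]_N -> R[i] :=
  xget (fun=> 0) [set F | regular_GL F /\ {in S, f =1 F}].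

(* d/dt f(x + t v) at t = 0 for f in C[S]: the curve leaves S, so f is read
   through an extension to GL_N; for v tangent to S at x the value does not
   depend on the extension. *)
Definition ddt0_on (R : realType) (N : nat) (S : set 'M[R[i]]_N)
    (f : 'M[R[i]]_N -> R[i]) (x v : 'M[R[i]]_N) : R[i] :=
  ddt0 (extension S f) x v.

(** * Reductive groups and involutions *)

Definition closed_subgroup (R : realType) (N : nat) (H : set 'M[R[i]]_N) : Prop :=
  [/\ zariski_closed H,
      H 1%:M,
      (forall x y, H x -> H y -> H (x *m y)) &
      (forall x, H x -> H (invmx x))].

Definition Ad (R : realType) (N : nat) (g xi : 'M[R[i]]_N) : 'M[R[i]]_N :=
  g *m xi *m invmx g.

Definition unipotent (R : realType) (N : nat) (u : 'M[R[i]]_N) : Prop :=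
  exists m : nat, (u - 1%:M) ^+ m = 0.

(* The unipotent radical is trivial. *)
Definition reductive (R : realType) (N : nat) (G : set 'M[R[i]]_N) : Prop :=
  closed_subgroup G /\
  forall U : set 'M[R[i]]_N,
    closed_subgroup U -> zariski_connected U -> U `<=` G ->
    (forall g u, G g -> U u -> U (Ad g u)) ->
    (forall u, U u -> unipotent u) ->
    U = [set 1%:M].

Definition involutive_automorphism (R : realType) (N : nat)
    (G : set 'M[R[i]]_N) (theta : 'M[R[i]]_N -> 'M[R[i]]_N) : Prop :=
  [/\ regular_map G theta,
      (forall x, G x -> G (theta x)),
      (forall x y, G x -> G y -> theta (x *m y) = theta x *m theta y) &
      (forall x, G x -> theta (theta x) = x)].

Definition fixgroup (R : realType) (N : nat) (G : set 'M[R[i]]_N)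
    (theta : 'M[R[i]]_N -> 'M[R[i]]_N) : set 'M[R[i]]_N :=
  [set k | G k /\ theta k = k].

Definition liealg (R : realType) (N : nat) (G : set 'M[R[i]]_N) :
    set 'M[R[i]]_N :=
  tangent G 1%:M.

(* The differential of theta at 1. *)
Definition dtheta (R : realType) (N : nat) (G : set 'M[R[i]]_N)
    (theta : 'M[R[i]]_N -> 'M[R[i]]_N) (xi : 'M[R[i]]_N) : 'M[R[i]]_N :=
  \matrix_(i, j) ddt0_on G (fun x => theta x i j) 1%:M xi.

Definition pspace (R : realType) (N : nat) (G : set 'M[R[i]]_N)
    (theta : 'M[R[i]]_N -> 'M[R[i]]_N) : set 'M[R[i]]_N :=
  [set xi | liealg G xi /\ dtheta G theta xi = - xi].

(** * Invariant vector fields on G/K *)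

(* C[G/K], as the right K-invariant elements of C[G]. *)
Definition regular_GK (R : realType) (N : nat) (G : set 'M[R[i]]_N)
    (theta : 'M[R[i]]_N -> 'M[R[i]]_N) (f : 'M[R[i]]_N -> R[i]) : Prop :=
  regular_on G f /\
  forall g k, G g -> fixgroup G theta k -> f (g *m k) = f g.

(* X(G/K)^K: the derivations of C[G/K] commuting with left translations
   by K.  The first field says that X is well defined on functions on G. *)
Record invariant_field (R : realType) (N : nat) (G : set 'M[R[i]]_N)
    (theta : 'M[R[i]]_N -> 'M[R[i]]_N)
    (X : ('M[R[i]]_N -> R[i]) -> 'M[R[i]]_N -> R[i]) : Prop := {
  field_ext : forall f h, regular_GK G theta f -> regular_GK G theta h ->
    {in G, f =1 h} -> {in G, X f =1 X h};
  field_regular : forall f, regular_GK G theta f -> regular_GK G theta (X f);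
  field_linear : forall (a : R[i]) f h,
    regular_GK G theta f -> regular_GK G theta h ->
    {in G, X (fun g => a * f g + h g) =1 (fun g => a * X f g + X h g)};
  field_leibniz : forall f h, regular_GK G theta f -> regular_GK G theta h ->
    {in G, X (fun g => f g * h g) =1 (fun g => f g * X h g + h g * X f g)};
  field_invariant : forall f k, regular_GK G theta f -> fixgroup G theta k ->
    {in G, X (fun g => f (k *m g)) =1 (fun g => X f (k *m g))}
}.

(* Phi is the regular map G -> p to which the K-invariant field X
   corresponds. *)
Definition field_map (R : realType) (N : nat) (G : set 'M[R[i]]_N)
    (theta : 'M[R[i]]_N -> 'M[R[i]]_N)
    (X : ('M[R[i]]_N -> R[i]) -> 'M[R[i]]_N -> R[i])
    (Phi : 'M[R[i]]_N -> 'M[R[i]]_N) : Prop :=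
  [/\ regular_map G Phi,
      (forall g, G g -> pspace G theta (Phi g)),
      (forall g k k', G g -> fixgroup G theta k -> fixgroup G theta k' ->
         Phi (k *m g *m k') = Ad (invmx k') (Phi g)) &
      (forall f, regular_GK G theta f ->
         {in G, X f =1 (fun g => ddt0_on G f g (g *m Phi g))})].

(** * The Cartan embedding *)

Definition cartan (R : realType) (N : nat)
    (theta : 'M[R[i]]_N -> 'M[R[i]]_N) (g : 'M[R[i]]_N) : 'M[R[i]]_N :=
  g *m invmx (theta g).

Definition cartanP (R : realType) (N : nat) (G : set 'M[R[i]]_N)
    (theta : 'M[R[i]]_N -> 'M[R[i]]_N) : set 'M[R[i]]_N :=
  cartan theta @` G.

(* The inverse of j^* : C[P] -> C[G/K], f |-> f \o j. *)
Definition cartan_pullback_inv (R : realType) (N : nat) (G : set 'M[R[i]]_N)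
    (theta : 'M[R[i]]_N -> 'M[R[i]]_N) (h : 'M[R[i]]_N -> R[i]) :
    'M[R[i]]_N -> R[i] :=
  xget (fun=> 0) [set f | regular_on (cartanP G theta) f /\
                          {in G, f \o cartan theta =1 h}].

(* j_* X. *)
Definition cartan_push (R : realType) (N : nat) (G : set 'M[R[i]]_N)
    (theta : 'M[R[i]]_N -> 'M[R[i]]_N)
    (X : ('M[R[i]]_N -> R[i]) -> 'M[R[i]]_N -> R[i]) :
    ('M[R[i]]_N -> R[i]) -> 'M[R[i]]_N -> R[i] :=
  fun f => cartan_pullback_inv G theta (X (f \o cartan theta)).

(** * Flatness *)

(* X^*_g = g Phi(g), for the regular map Phi corresponding to X. *)
Definition horizontal_lift (R : realType) (N : nat)
    (Phi : 'M[R[i]]_N -> 'M[R[i]]_N) (g : 'M[R[i]]_N) : 'M[R[i]]_N :=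
  g *m Phi g.

(* The map Phi exists and is unique for a K-invariant field X. *)
Definition horizontally_flat (R : realType) (N : nat) (G : set 'M[R[i]]_N)
    (theta : 'M[R[i]]_N -> 'M[R[i]]_N)
    (X : ('M[R[i]]_N -> R[i]) -> 'M[R[i]]_N -> R[i]) : Prop :=
  exists2 Phi, field_map G theta X Phi &
    forall y, cartanP G theta y -> tangent (cartanP G theta) y (horizontal_lift Phi y).

Definition theta_at (R : realType) (N : nat) (G : set 'M[R[i]]_N)
    (theta : 'M[R[i]]_N -> 'M[R[i]]_N) (y xi : 'M[R[i]]_N) : 'M[R[i]]_N :=
  Ad (invmx y) (dtheta G theta xi).

Definition pi_at (R : realType) (N : nat) (G : set 'M[R[i]]_N)
    (theta : 'M[R[i]]_N -> 'M[R[i]]_N) (y xi : 'M[R[i]]_N) : 'M[R[i]]_N :=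
  2^-1 *: (xi - theta_at G theta y xi).

(* The vector field on P written Psi with a tilde. *)
Definition tilde_field (R : realType) (N : nat) (G : set 'M[R[i]]_N)
    (theta : 'M[R[i]]_N -> 'M[R[i]]_N) (Psi : 'M[R[i]]_N -> 'M[R[i]]_N) :
    ('M[R[i]]_N -> R[i]) -> 'M[R[i]]_N -> R[i] :=
  fun f y => ddt0_on (cartanP G theta) f y (y *m pi_at G theta y (Psi y)).

(* X(P)^K_flat; operators are compared as maps on C[P]. *)
Definition flat_fields (R : realType) (N : nat) (G : set 'M[R[i]]_N)
    (theta : 'M[R[i]]_N -> 'M[R[i]]_N) :
    set (('M[R[i]]_N -> R[i]) -> 'M[R[i]]_N -> R[i]) :=
  [set Y : ('M[R[i]]_N -> R[i]) -> 'M[R[i]]_N -> R[i] |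
    exists Psi : 'M[R[i]]_N -> 'M[R[i]]_N,
    [/\ regular_map (cartanP G theta) Psi,
        (forall y, cartanP G theta y -> pspace G theta (Psi y)),
        (forall k y, fixgroup G theta k -> cartanP G theta y ->
           Psi (Ad k y) = Ad k (Psi y)),
        (forall y, cartanP G theta y -> Ad y (Psi y) = Psi y) &
        (forall f, regular_on (cartanP G theta) f ->
           {in cartanP G theta, Y f =1 tilde_field G theta Psi f})]].

(* Main.v *)
Require Import Defs.
From HB Require Import structures.
From mathcomp Require Import all_boot all_order all_algebra.
From mathcomp Require Import complex mpoly.
From mathcomp Require Import boolp classical_sets reals topology normedtype.
From mathcomp Require Import derive.
From mathcomp Require Import zify ring ring_quotient.

Set Implicit Arguments.
Unset Strict Implicit.
Unset Printing Implicit Defensive.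

Import GRing.Theory Num.Theory.
Local Open Scope ring_scope.

(* Write j(g) = g theta(g)^-1 and P = j(G).  If y is in P, a tangent vector
   y xi of G with xi in p is tangent to P iff y commutes with xi.  Under j the
   vector g Phi(g) goes to 2 g Phi(g) theta(g)^-1, so j_* X is the field of
   Psi(j g) = 2 Ad(theta g) Phi(g), and Psi satisfies the flatness conditions
   iff Ad(g) Phi(g) = Ad(theta g) Phi(g) for all g in G.

   - C[P] is all of C[G/K].  A right K-invariant f is constant on the fibres of
     j, hence a fraction over C[P] (generic fibres of a dominant map separate
     the values of a non-fraction in characteristic zero).  Its conductor is a
     nonzero G-stable ideal.  At a common zero z of the conductor the map
     s(w) = w z^-1 w sends P into the orbit of z, fixes z and has differential
     2 there; so s^* kills the conductor, which therefore lies in all powers of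
     the maximal ideal at z and vanishes by Krull's theorem.
   - With z = 1 the same argument shows that a function on P vanishing on all
     squares is zero.  Flatness gives Ad(g) Phi(g) = Ad(theta g) Phi(g) for g in
     P, both sides descend to P, j(y) = y^2 there, and so equality holds on G.
   - Conversely Psi(y^2) commutes with y^2, and u = [y, Psi(y^2)] satisfies
     y u + u y = 0.  At y = 1 + x this says 2 u = - (x u + u x), so u = 0 by
     Krull's theorem. *)

(** The push-forward is defined by inverting j^*, so nothing can be said about it before invariant
    functions on G are known to come from P; bijectivity of G/K onto P yields them only as
    fractions. The conductor is nonzero because the translates of f span a finite-dimensional space:
    a product of finitely many denominators serves all of them. What makes s useful is its
    eigenvalue: on m^n / m^(n+1) at z, s^* acts as 2^n, which is invertible. A function sent by s^*
    into the ideal of P therefore loses its leading term at z in each order. Krull's theorem then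
    gives zero because the ideal of P is prime, which comes from the irreducibility of the connected
    group G. The zero z is supplied by the Nullstellensatz and is not known to lie in P; it does
    satisfy theta(z) = z^-1, and this suffices to write w z^-1 w as the twisted translate of z by w
    z^-1. Horizontal flatness sees Phi only at points of P, whereas the conditions on Psi involve
    Phi at every g. Squares bridge the gap: Psi at y^2 = j(y) is given by Phi at y. *)

(** * Noetherian rings *)

Section Noetherian.
Variable R : comNzRingType.
Implicit Types (T I J : R -> Prop) (p q r : {poly R}).

Definition is_subring T :=
  [/\ T 1, (forall a b, T a -> T b -> T (a - b)) &
      (forall a b, T a -> T b -> T (a * b))].

Definition is_ideal T I :=
  [/\ I 0, (forall a b, I a -> I b -> I (a + b)) &
      (forall t a, T t -> I a -> I (t * a))].

(** As an intersection of ideals: applying a membership to a suitable [J] is induction on linear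
    combinations. *)
Definition generated T (X : R -> Prop) (a : R) :=
  forall J, is_ideal T J -> (forall b, X b -> J b) -> J a.

Definition noetherian T :=
  forall I, is_ideal T I -> (forall a, I a -> T a) ->
  exists s : seq R, (forall a, a \in s -> I a) /\
    (forall a, I a -> generated T (fun b => b \in s) a).

Definition adjoin T x := fun y => exists2 p : {poly R}, (forall i, T p`_i) & y = p.[x].

Lemma generated_ideal T X : is_ideal T (generated T X).
Proof.
split=> [J [J0 _ _] _ //|a b Ia Ib J HJ HX|t a Tt Ia J HJ HX].
- by case: (HJ) => _ JD _; apply: JD; [apply: Ia|apply: Ib].
- by case: (HJ) => _ _ JM; apply: JM => //; apply: Ia.
Qed.

Section Subring.
Variables (T : R -> Prop) (HT : is_subring T).

Lemma subring1 : T 1. Proof. by case: HT. Qed.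
Lemma subringB a b : T a -> T b -> T (a - b). Proof. by case: HT => _ H _; apply: H. Qed.
Lemma subringM a b : T a -> T b -> T (a * b). Proof. by case: HT => _ _ H; apply: H. Qed.
Lemma subring0 : T 0. Proof. by rewrite -(subrr 1); apply: subringB; apply: subring1. Qed.
Lemma subringN a : T a -> T (- a).
Proof. by move=> Ta; rewrite -sub0r; apply: subringB => //; apply: subring0. Qed.
Lemma subringD a b : T a -> T b -> T (a + b).
Proof. by move=> Ta Tb; rewrite -[b]opprK; apply: subringB => //; apply: subringN. Qed.
Lemma subring_sum (I : Type) (r : seq I) (P : pred I) F :
  (forall i, P i -> T (F i)) -> T (\sum_(i <- r | P i) F i).
Proof. by move=> H; elim/big_ind: _ => //; [apply: subring0|apply: subringD]. Qed.
Lemma subringX a n : T a -> T (a ^+ n).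
Proof.
by move=> Ta; elim: n => [|n IH]; rewrite ?expr0 ?exprS; [apply: subring1|apply: subringM].
Qed.

Lemma polyover_monom c n : T c -> forall i, T (c *: 'X^n : {poly R})`_i.
Proof.
move=> Tc i; rewrite coefZ coefXn; case: eqP => _; rewrite ?mulr1 ?mulr0 //.
exact: subring0.
Qed.

Lemma polyoverM p q : (forall i, T p`_i) -> (forall i, T q`_i) -> forall i, T (p * q)`_i.
Proof. by move=> Hp Hq i; rewrite coefM; apply: subring_sum => j _; apply: subringM. Qed.

Lemma polyoverB p q : (forall i, T p`_i) -> (forall i, T q`_i) -> forall i, T (p - q)`_i.
Proof. by move=> Hp Hq i; rewrite coefB; apply: subringB. Qed.

Lemma polyoverC c : T c -> forall i, T (c%:P)`_i.
Proof. by move=> Tc i; rewrite coefC; case: eqP => // _; apply: subring0. Qed.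

Lemma polyoverX i : T ('X : {poly R})`_i.
Proof. by rewrite coefX; case: eqP => _; [apply: subring1|apply: subring0]. Qed.

Lemma adjoin_subring x : is_subring (adjoin T x).
Proof.
split.
- by exists 1; [apply: polyoverC; apply: subring1 | rewrite hornerE].
- move=> _ _ [p Hp ->] [q Hq ->]; exists (p - q); first exact: polyoverB.
  by rewrite !hornerE.
- move=> _ _ [p Hp ->] [q Hq ->]; exists (p * q); first exact: polyoverM.
  by rewrite hornerM.
Qed.

Lemma adjoin_sub x a : T a -> adjoin T x a.
Proof. by move=> Ta; exists a%:P; [apply: polyoverC|rewrite hornerC]. Qed.

Lemma adjoin_gen x : adjoin T x x.
Proof. by exists 'X; [apply: polyoverX|rewrite hornerX]. Qed.

End Subring.

Lemma generated_incl T X Y : (forall a, X a -> Y a) ->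
  forall a, generated T X a -> generated T Y a.
Proof. by move=> XY a Xa J HJ HY; apply: Xa => // b /XY /HY. Qed.

(* The ideals of leading coefficients in degree d increase with d; finitely
   many generators of their union and of the first few of them suffice. *)
Lemma noetherian_adjoin T x : is_subring T -> noetherian T -> noetherian (adjoin T x).
Proof.
move=> HT nT I HI IT; have [I0 ID IM] := HI.
have HT' := adjoin_subring HT x.
(* [x] may be algebraic over [T], so Hilbert's argument is run on the preimage of [I] in T[X], where
   degrees make sense. *)
pose Ip (p : {poly R}) := (forall i, T p`_i) /\ I p.[x].
have IpD p q : Ip p -> Ip q -> Ip (p + q).
  move=> [Tp Iq] [Tq Iq']; split=> [i|]; first by rewrite coefD; apply: subringD.
  by rewrite hornerD; apply: ID.
have IpM c n p : T c -> Ip p -> Ip (c *: 'X^n * p).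
  move=> Tc [Tp Ip']; split; first by apply: polyoverM => //; apply: polyover_monom.
  by rewrite hornerM; apply: IM => //; exists (c *: 'X^n) => //; apply: polyover_monom.
have Ip0 : Ip 0 by split=> [i|]; rewrite ?coef0 ?horner0 //; apply: subring0.
pose L d c := exists2 p : {poly R}, Ip p & (size p <= d.+1)%N /\ p`_d = c.
have L_mono d e c : (d <= e)%N -> L d c -> L e c.
  move=> de [p Ip' [sp pd]]; exists (1 *: 'X^(e - d) * p); first exact: IpM (subring1 HT) _.
  rewrite scale1r mulrC; split; last by rewrite coefMXn ltnNge leq_subr /= subKn.
  apply/leq_sizeP => j hj; rewrite coefMXn; case: ifP => // /negbT; rewrite -leqNgt => h.
  move/leq_sizeP: sp; apply; lia.
have L_ideal d : is_ideal T (L d).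
  split.
  - by exists 0 => //; rewrite size_poly0 coef0.
  - move=> _ _ [p Hp [sp <-]] [q Hq [sq <-]]; exists (p + q); first exact: IpD.
    by rewrite coefD; split=> //; rewrite (leq_trans (size_polyD _ _)) // geq_max sp.
  - move=> t _ Tt [p Hp [sp <-]]; exists (t *: 'X^0 * p); first exact: IpM.
    rewrite expr0 -scalerAl mul1r coefZ; split=> //.
    exact: leq_trans (size_scale_leq _ _) sp.
have L_T d c : L d c -> T c by move=> [p [Tp _] [_ <-]].
pose LL c := exists d, L d c.
have [s [sLL LLs]] : exists s : seq R, (forall a, a \in s -> LL a) /\
    (forall a, LL a -> generated T (fun b => b \in s) a).
  apply: nT; last by move=> c [d]; apply: L_T.
  split.
  - by exists 0; case: (L_ideal 0).
  - move=> a b [d Ha] [e Hb]; exists (maxn d e); case: (L_ideal (maxn d e)) => _ LD _.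
    by apply: LD; [apply: L_mono Ha; rewrite leq_maxl|apply: L_mono Hb; rewrite leq_maxr].
  - by move=> t a Tt [d Ha]; exists d; case: (L_ideal d) => _ _; apply.
(* The finitely many generators of the union of the [L d] lie in one [L D], so the chain is constant
   from [D] on. *)
have [D HD] : exists D, forall a, a \in s -> L D a.
  elim: s sLL {LLs} => [|a s IH] sLL; first by exists 0.
  have [|D HD] := IH; first by move=> b bs; apply: sLL; rewrite inE bs orbT.
  have [d Hd] : LL a by apply: sLL; rewrite inE eqxx.
  exists (maxn D d) => b; rewrite inE => /orP[/eqP->|/HD H].
    by apply: L_mono Hd; rewrite leq_maxr.
  by apply: L_mono H; rewrite leq_maxl.
have LD d c : L d c -> L D c.
  by move=> Lc; apply: (LLs c) => //; exists d.
pose B d (b : seq {poly R}) := (forall p, p \in b -> Ip p /\ (size p <= d.+1)%N) /\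
  (forall c, L d c -> generated T (fun a => a \in [seq p`_d | p : {poly R} <- b]) c).
have exB d : exists b, B d b.
  have [t [tL Lt]] := nT _ (L_ideal d) (@L_T d).
  have [b [Hb tb]] : exists b : seq {poly R}, (forall p, p \in b -> Ip p /\ (size p <= d.+1)%N) /\
     [seq p`_d | p : {poly R} <- b] = t.
    elim: t tL {Lt} => [|a t IH] tL; first by exists [::].
    have [|b [Hb <-]] := IH; first by move=> c ct; apply: tL; rewrite inE ct orbT.
    have [p Hp [sp <-]] : L d a by apply: tL; rewrite inE eqxx.
    by exists (p :: b); split=> // q; rewrite inE => /orP[/eqP->|/Hb].
  by exists b; split=> //; rewrite tb.
have [f Hf] := choice exB.
pose bs := flatten [seq f d | d <- iota 0 D.+1].
have bsP d p : (d <= D)%N -> p \in f d -> p \in bs.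
  move=> dD pf; apply/flattenP; exists (f d) => //; apply/mapP; exists d => //.
  by rewrite mem_iota.
exists [seq p.[x] | p : {poly R} <- bs]; split.
  move=> _ /mapP[p /flattenP[_ /mapP[d _ ->] pf] ->].
  by case: (Hf d) => /(_ _ pf) [[_ Hp]].
move=> a /[dup] Ia /IT[p Tp ax]; rewrite ax in Ia *; move: {a ax} Ia => Ia.
set X := (X in generated _ X _).
have [G0 GD GM] := generated_ideal (adjoin T x) X.
have [n] := ubnP (size p).
elim: n p Tp Ia => // n IH p Tp Ia; rewrite ltnS => sp.
have [->|p0] := eqVneq p 0; first by rewrite horner0.
set d := (size p).-1.
have sp1 : size p = d.+1 by rewrite /d prednK // lt0n size_poly_eq0.
have Lpd : L d p`_d by exists p => //; rewrite sp1.
set e := minn d D.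
have ed : (e <= d)%N by rewrite geq_minl.
have eD : (e <= D)%N by rewrite geq_minr.
have Lpe : L e p`_d.
  by rewrite /e; case: (leqP d D) => // _; apply: LD Lpd.
(* The degree-[d] coefficients that can be cancelled form a [T]-ideal; hence it suffices to cancel
   the chosen generators of [L e], using their polynomials multiplied by X^(d - e). *)
pose J c := exists q : {poly R}, [/\ (forall i, T q`_i), q`_d = c, (size q <= d.+1)%N &
    generated (adjoin T x) X q.[x]].
suff [q [Tq qd sq Gq]] : J p`_d.
  have -> : p = (p - q) + q by rewrite subrK.
  rewrite hornerD; apply: GD => //; apply: IH.
  - by apply: polyoverB.
  - rewrite hornerD hornerN; apply: ID => //; rewrite -mulN1r; apply: IM.
      by apply: subringN => //; apply: subring1.
    apply: Gq => // a /mapP[r /flattenP[_ /mapP[d' _ ->] pf] ->].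
    by case: (Hf d') => /(_ _ pf) [[_ Hp]].
  - apply: (@leq_ltn_trans d); last by rewrite -sp1.
    apply/leq_sizeP => j; rewrite leq_eqVlt => /orP[/eqP<-|dj].
      by rewrite coefB qd subrr.
    by rewrite coefB !nth_default ?subrr ?sp1 // (leq_trans sq).
case: (Hf e) => Hb /(_ _ Lpe) /(_ J); apply.
  split.
  - by exists 0; rewrite coef0 size_poly0 horner0; split=> // i; rewrite coef0; apply: subring0.
  - move=> a b [q [Tq <- sq Gq]] [r [Tr <- sr Gr]]; exists (q + r); rewrite coefD hornerD.
    split; [by move=> i; rewrite coefD; apply: subringD | by [] | | exact: GD].
    by rewrite (leq_trans (size_polyD _ _)) // geq_max sq.
  - move=> t a Tt [q [Tq <- sq Gq]]; exists (t *: q); rewrite coefZ hornerZ.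
    split; [by move=> i; rewrite coefZ; apply: subringM | by [] | | ].
      exact: leq_trans (size_scale_leq _ _) sq.
    by apply: GM => //; apply: adjoin_sub.
move=> _ /mapP[q qf ->].
have [[Tq Iq] sq] := Hb _ qf.
exists ('X^(d - e) * q); split.
- apply: polyoverM => // i; rewrite -['X^_]scale1r; apply: polyover_monom => //.
  exact: subring1.
- by rewrite coefXnM ltnNge leq_subr /= subKn.
- apply/leq_sizeP => j hj; rewrite coefXnM; case: ifP => // /negbT; rewrite -leqNgt => h.
  move/leq_sizeP: sq; apply; lia.
- rewrite hornerM; apply: GM.
    exists 'X^(d - e) => // i; rewrite -['X^_]scale1r; apply: polyover_monom => //.
    exact: subring1.
  by move=> J' _; apply; apply/mapP; exists q => //; apply: bsP qf.
Qed.

Definition adjoins T (s : seq R) := foldl adjoin T s.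

Lemma adjoins_subring T s : is_subring T -> is_subring (adjoins T s).
Proof. by elim: s T => //= x s IH T HT; apply: IH; apply: adjoin_subring. Qed.

Lemma adjoins_sub T s a : is_subring T -> T a -> adjoins T s a.
Proof.
elim: s T => //= x s IH T HT Ta; apply: IH; first exact: adjoin_subring.
exact: adjoin_sub.
Qed.

Lemma adjoins_gen T s x : is_subring T -> x \in s -> adjoins T s x.
Proof.
elim: s T => //= y s IH T HT; rewrite inE => /orP[/eqP->|xs].
  by apply: adjoins_sub; [apply: adjoin_subring|apply: adjoin_gen].
by apply: IH => //; apply: adjoin_subring.
Qed.

Lemma noetherian_adjoins T s : is_subring T -> noetherian T -> noetherian (adjoins T s).
Proof.
elim: s T => //= x s IH T HT nT; apply: IH; first exact: adjoin_subring.
exact: noetherian_adjoin.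
Qed.

(** Without a maximal member, dependent choice builds a strictly increasing chain; its union is
    finitely generated, hence already reached at a finite stage. *)
Lemma noetherian_max (P : (R -> Prop) -> Prop) :
  noetherian (fun=> True) ->
  (forall I, P I -> is_ideal (fun=> True) I) -> (exists I, P I) ->
  exists2 I, P I & forall J, P J -> (forall a, I a -> J a) -> forall a, J a -> I a.
Proof.
move=> nR idP [I0 PI0]; apply: contrapT => Hno.
have step (I : {I : R -> Prop | P I}) :
    {J : {I : R -> Prop | P I} | (forall a, sval I a -> sval J a) /\
      exists2 a, sval J a & ~ sval I a}.
  apply: cid; apply: contrapT => H; apply: Hno; exists (sval I); first exact: svalP.
  move=> J PJ IJ a Ja; apply: contrapT => nIa; apply: H.
  by exists (exist _ J PJ); split=> //; exists a.
pose f := fix f n := if n is m.+1 then sval (step (f m)) else exist _ I0 PI0.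
have f_step n a : sval (f n) a -> sval (f n.+1) a.
  by move=> /= H; case: (svalP (step (f n))) => + _; apply.
have f_mono m n a : (m <= n)%N -> sval (f m) a -> sval (f n) a.
  move=> mn; rewrite -(subnK mn); elim: (n - m)%N => // k IH H.
  by rewrite addSn; apply: f_step; apply: IH.
pose U a := exists n, sval (f n) a.
have idf n := idP _ (svalP (f n)).
have [|//|s [sU Us]] := nR U.
  split.
  - by exists 0; case: (idf 0).
  - move=> a b [m Ha] [n Hb]; exists (maxn m n); case: (idf (maxn m n)) => _ ID _.
    by apply: ID; [apply: f_mono Ha; rewrite leq_maxl|apply: f_mono Hb; rewrite leq_maxr].
  - by move=> t a _ [n Ha]; exists n; case: (idf n) => _ _; apply.
have [n Hn] : exists n, forall a, a \in s -> sval (f n) a.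
  elim: s sU {Us} => [|a s IH] sU; first by exists 0.
  have [|D HD] := IH; first by move=> b bs; apply: sU; rewrite inE bs orbT.
  have [d Hd] : U a by apply: sU; rewrite inE eqxx.
  exists (maxn D d) => b; rewrite inE => /orP[/eqP->|/HD H].
    by apply: f_mono Hd; rewrite leq_maxr.
  by apply: f_mono H; rewrite leq_maxl.
case: (svalP (step (f n))) => _ [a Ha]; apply.
by apply: (Us a) => //; exists n.+1.
Qed.

End Noetherian.

(** * Quotients and Krull's intersection theorem *)

Definition entire (A : comNzRingType) := forall a b : A, a * b = 0 -> a = 0 \/ b = 0.

Definition is_prime (M : comNzRingType) (Q : M -> Prop) :=
  [/\ is_ideal (fun=> True) Q, ~ Q 1 & forall a b, Q (a * b) -> Q a \/ Q b].

Lemma ideal_quotient (M : comNzRingType) (Q : M -> Prop) :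
  is_ideal (fun=> True) Q -> ~ Q 1 ->
  exists (A : comNzRingType) (pi : {rmorphism M -> A}),
    (forall a, exists x, pi x = a) /\ (forall x, pi x = 0 <-> Q x).
Proof.
move=> [Q0 QD QM] Q1.
pose q : {pred M} := fun x => `[< Q x >].
have qE x : (x \in q) = `[< Q x >] by [].
have qid : idealr_closed q.
  split; first by rewrite qE; apply/asboolP.
  - by rewrite qE; apply/negP => /asboolP.
  - move=> a u v; rewrite !qE => /asboolP Qu /asboolP Qv; apply/asboolP; apply: QD => //; exact: QM.
pose Iq : idealr M := HB.pack_for (idealr M) (q : M -> bool) (isIdealr.Build M q qid).
exists {ideal_quot Iq}, (\pi_{ideal_quot Iq}%qT : {rmorphism M -> {ideal_quot Iq}}).
split=> [a|x].
  by exists (generic_quotient.repr a); apply: generic_quotient.reprK.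
have E := Quotient.idealrBE Iq x 0; rewrite subr0 in E.
have E0 := rmorph0 (\pi_{ideal_quot Iq}%qT : {rmorphism M -> {ideal_quot Iq}}).
rewrite /= in E0 *; split=> [px|Qx].
  by apply/asboolP; rewrite -qE [_ \in _]E px E0 eqxx.
by rewrite -E0; apply/eqP; rewrite -E; apply/asboolP.
Qed.

Lemma is_subringT (R : comNzRingType) : is_subring (fun _ : R => True).
Proof. by []. Qed.

Section Image.
Variables (M A : comNzRingType) (pi : {rmorphism M -> A}).

Lemma noetherian_image (T : M -> Prop) (T' : A -> Prop) :
  noetherian T -> is_subring T -> (forall x, T x -> T' (pi x)) ->
  (forall a, T' a -> exists2 x, T x & pi x = a) -> noetherian T'.
Proof.
move=> nT HT TT' piT I [I0 ID IM] IT.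
have [|x []//|s [sI Is]] := nT (fun x => T x /\ I (pi x)).
  split=> [|a b [Ta Ia] [Tb Ib]|t a Tt [Ta Ia]].
  - by rewrite rmorph0; split=> //; apply: subring0.
  - by rewrite rmorphD; split; [apply: subringD|apply: ID].
  - by rewrite rmorphM; split; [apply: subringM|apply: IM => //; apply: TT'].
exists (map pi s); split=> [_ /mapP[x xs ->]|a Ia].
  by case: (sI x xs).
have [x Tx ax] := piT a (IT a Ia); rewrite -{}ax in Ia *.
move=> J [J0 JD JM] sJ; apply: (Is x (conj Tx Ia) (fun x => J (pi x))).
  split=> [|b c Jb Jc|t b Tt Jb]; rewrite ?rmorph0 ?rmorphD ?rmorphM //.
    exact: JD.
  by apply: JM => //; apply: TT'.
by move=> b bs; apply: sJ; apply: map_f.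
Qed.

End Image.

Fixpoint ideal_pow (R : comNzRingType) (m : R -> Prop) (n : nat) : R -> Prop :=
  if n is k.+1 then
    generated (fun=> True) (fun a => exists x c, [/\ m x, ideal_pow m k c & a = x * c])
  else fun=> True.

Lemma ideal_pow_ideal (R : comNzRingType) (m : R -> Prop) n :
  is_ideal (fun=> True) (ideal_pow m n).
Proof. by case: n => [|n]; [|apply: generated_ideal]. Qed.

Lemma ideal_powS (R : comNzRingType) (m : R -> Prop) n x c :
  m x -> ideal_pow m n c -> ideal_pow m n.+1 (x * c).
Proof. by move=> mx Hc J _; apply; exists x, c. Qed.

(* Rees algebra: b X^n lies in A[mX] for all n, and the ideal generated by
   these elements is finitely generated, whence b is in b m. *)
Lemma krull_intersection (A : comNzRingType) (m : A -> Prop) b :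
  noetherian (fun _ : A => True) -> is_ideal (fun=> True) m ->
  (forall n, ideal_pow m n b) -> exists2 c, m c & b = b * c.
Proof.
move=> nA Hm Hb; have [m0 mD mM] := Hm.
have [s [sm ms]] := nA m Hm (fun _ _ => Logic.I).
pose T0 (p : {poly A}) := exists a, p = a%:P.
have HT0 : is_subring T0.
  split; first by exists 1.
  - by move=> _ _ [a ->] [c ->]; exists (a - c); rewrite polyCB.
  - by move=> _ _ [a ->] [c ->]; exists (a * c); rewrite polyCM.
have nT0 : noetherian T0.
  apply: (noetherian_image (pi := polyC) nA (@is_subringT A)).
    by move=> x _; exists x.
  by move=> _ [a ->]; exists a.
pose T := adjoins T0 [seq x *: 'X | x <- s].
have HT : is_subring T by apply: adjoins_subring.
have nT : noetherian T by apply: noetherian_adjoins.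
have TC a : T a%:P by apply: adjoins_sub => //; exists a.
have Tm x : m x -> T (x *: 'X).
  move=> /ms /(_ (fun x => T (x *: 'X))); apply.
    split=> [|a c Ta Tc|t a _ Ta]; rewrite ?scale0r ?scalerDl; first exact: subring0.
      exact: subringD.
    by rewrite -scalerA -mul_polyC; apply: subringM.
  by move=> a /(map_f (fun x => x *: 'X)); apply: adjoins_gen.
(* [T] is the Rees algebra: its generators x X with x in [m] contribute a factor in [m] to each
   coefficient of positive degree. *)
have coefT : forall p, T p -> forall i, (0 < i)%N -> m p`_i.
  pose W (q : {poly A}) := forall i, (0 < i)%N -> m q`_i.
  have HW : is_subring W.
    split=> [[]// i _|p q Wp Wq i i0|p q Wp Wq i i0].
    - by rewrite coef1.
    - by rewrite coefB -mulN1r; apply: mD; [apply: Wp|apply: mM => //; apply: Wq].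
    - rewrite coefM; elim/big_ind: _ => // j _.
      have [j0|j0] := posnP j; last by rewrite mulrC; apply: mM => //; apply: Wp.
      by apply: mM => //; apply: Wq; rewrite j0 subn0.
  have HTW : forall (r : seq {poly A}) (T1 : {poly A} -> Prop), (forall q, q \in r -> W q) ->
      (forall q, T1 q -> W q) -> forall q, adjoins T1 r q -> W q.
    elim=> [|y r IH] T1 rW T1W q //=; first exact: T1W.
    apply: IH => [z zr|z [u Tu ->]]; first by apply: rW; rewrite inE zr orbT.
    rewrite horner_coef; apply: (subring_sum HW) => i _; apply: (subringM HW).
      exact: T1W.
    by apply: (subringX HW); apply: rW; rewrite inE eqxx.
  apply: HTW => [_ /mapP[x xs ->] i i0|_ [a ->] i i0]; last first.
    by rewrite coefC; case: i i0.
  by rewrite coefZ mulrC; apply: mM => //; apply: sm.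
have powT n a : ideal_pow m n a -> T (a *: 'X^n).
  elim: n a => [|n IH] a; first by move=> _; rewrite expr0 alg_polyC.
  move=> /(_ (fun a : A => T (a *: ('X^(n.+1) : {poly A})))); apply.
    split=> [|c d Tc Td|t c _ Tc]; rewrite ?scale0r ?scalerDl; first exact: subring0.
      exact: subringD.
    by rewrite -scalerA -mul_polyC; apply: subringM.
  move=> _ [x [c [mx Hc ->]]]; have -> : x * c *: 'X^(n.+1) = (x *: 'X) * (c *: 'X^n).
    by rewrite exprS -scalerAl -scalerAr scalerA.
  by apply: subringM; [|apply: Tm|apply: IH].
pose X N (p : {poly A}) := exists2 k, (k <= N)%N & p = b *: 'X^k.
pose I p := exists N, generated T (X N) p.
have IX N K p : (N <= K)%N -> generated T (X N) p -> generated T (X K) p.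
  move=> NK; apply: generated_incl => _ [k kN ->]; exists k => //; exact: leq_trans NK.
have [||r [rI Ir]] := nT I.
- split.
  + by exists 0%N; case: (generated_ideal T (X 0%N)).
  + move=> p q [N Hp] [K Hq]; exists (maxn N K); case: (generated_ideal T (X (maxn N K))).
    by move=> _ GD _; apply: GD; [apply: IX Hp; rewrite leq_maxl|apply: IX Hq; rewrite leq_maxr].
  + by move=> t p Tt [N Hp]; exists N; case: (generated_ideal T (X N)) => _ _; apply.
- move=> p [N]; apply.
    by split=> *; [apply: subring0|apply: subringD|apply: subringM].
  by move=> _ [k _ ->]; apply: powT.
have [N HN] : exists N, forall p, p \in r -> generated T (X N) p.
  elim: r rI {Ir} => [|p r IH] rI; first by exists 0%N.
  have [|N HN] := IH; first by move=> q qr; apply: rI; rewrite inE qr orbT.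
  have [K HK] : I p by apply: rI; rewrite inE eqxx.
  exists (maxn N K) => q; rewrite inE => /orP[/eqP->|/HN H].
    by apply: IX HK; rewrite leq_maxr.
  by apply: IX H; rewrite leq_maxl.
have : generated T (X N) (b *: 'X^(N.+1)).
  apply: Ir => //; last exact: generated_ideal.
  by exists N.+1 => J _; apply; exists N.+1.
(* Members of the ideal generated by the b X^k with k <= N have coefficients b c, with c in [m]
   beyond degree [N]. Read at degree N + 1 of b X^(N+1), this is b = b c. *)
pose J (p : {poly A}) := forall k, exists c, p`_k = b * c /\ ((N < k)%N -> m c).
move=> Hgen; have [|_ [k kN ->] i|c [E /(_ (ltnSn N)) mc]] := Hgen J _ _ N.+1; last first.
- by exists c => //; rewrite -E coefZ coefXn eqxx mulr1.
- rewrite coefZ coefXn; case: eqP => [->|_].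
    by exists 1; rewrite mulr1 ltnNge kN.
  by exists 0; rewrite !mulr0.
split.
- by move=> k; exists 0; rewrite coef0 mulr0.
- move=> p q Jp Jq k; have [c [Ec mc]] := Jp k; have [d [Ed md]] := Jq k.
  exists (c + d); rewrite coefD Ec Ed mulrDr; split=> // Nk; apply: mD; [exact: mc|exact: md].
move=> t p Tt Jp k; have [g Hg] := choice Jp.
exists (\sum_(i < k.+1) t`_i * g (k - i)%N); split.
  by rewrite coefM mulr_sumr; apply: eq_bigr => i _; case: (Hg (k - i)%N) => -> _; rewrite mulrCA.
move=> Nk; elim/big_ind: _ => // i _.
have [i0|i0] := posnP i; last by rewrite mulrC; apply: mM => //; apply: coefT.
by apply: mM => //; case: (Hg (k - i)%N) => _; apply; rewrite i0 subn0.
Qed.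

(** Krull's theorem in the domain [M / Q] gives b (1 - c) = 0 with c in [m]; and 1 - c is not in
    [Q], because [Q] lies in the proper ideal [m]. *)
Lemma krull_prime (M : comNzRingType) (Q m : M -> Prop) b :
  noetherian (fun _ : M => True) -> is_prime Q -> is_ideal (fun=> True) m ->
  (forall x, Q x -> m x) -> ~ m 1 ->
  (forall n, exists2 c, ideal_pow m n c & Q (b - c)) -> Q b.
Proof.
move=> nM [HQ Q1 QM] Hm Qm m1 Hb; have [_ QD QZ] := HQ; have [m0 mD mM] := Hm.
have [A [pi [pis ker]]] := ideal_quotient HQ Q1.
pose mA a := exists2 x, m x & pi x = a.
have HmA : is_ideal (fun=> True) mA.
  split.
  - by exists 0; rewrite ?rmorph0.
  - by move=> _ _ [x mx <-] [y my <-]; exists (x + y); rewrite ?rmorphD //; apply: mD.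
  - move=> a _ _ [y my <-]; have [x <-] := pis a.
    by exists (x * y); rewrite ?rmorphM //; apply: mM.
have nA : noetherian (fun _ : A => True).
  apply: (noetherian_image (pi := pi) nM (@is_subringT M)) => // a _.
  by have [x] := pis a; exists x.
have powA n c : ideal_pow m n c -> ideal_pow mA n (pi c).
  elim: n c => // n IH c /(_ (fun c => ideal_pow mA n.+1 (pi c))); apply.
    have [P0 PD PM] := ideal_pow_ideal mA n.+1.
    by split=> *; rewrite ?rmorph0 ?rmorphD ?rmorphM; [|apply: PD|apply: PM].
  move=> _ [x [d [mx Hd ->]]]; rewrite rmorphM; apply: ideal_powS; first by exists x.
  exact: IH.
have [|_ [c mc <-] E] := @krull_intersection A mA (pi b) nA HmA.
  move=> n; have [c Hc Qbc] := Hb n; have -> : pi b = pi c.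
    by apply/eqP; rewrite -subr_eq0 -rmorphB; apply/eqP/ker.
  exact: powA.
have /ker/QM[//|Q1c] : pi (b * (1 - c)) = 0.
  by rewrite rmorphM rmorphB rmorph1 mulrBr mulr1 -E subrr.
by exfalso; apply: m1; rewrite -(subrK c 1); apply: mD => //; apply: Qm.
Qed.

(** * Extension of homomorphisms *)

Definition over (A : comNzRingType) (T : A -> Prop) (p : {poly A}) := forall i, T p`_i.

Lemma min_size (A : comNzRingType) (P : {poly A} -> Prop) :
  (exists p, P p) -> exists2 p, P p & forall q, P q -> (size p <= size q)%N.
Proof.
move=> exP; have exn : exists n, `[< exists2 p, P p & size p = n >].
  by have [p Pp] := exP; exists (size p); apply/asboolP; exists p.
case: (ex_minnP exn) => n /asboolP[p Pp <-] Hmin; exists p => // q Pq.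
by apply: Hmin; apply/asboolP; exists q.
Qed.

Section Extension.
Variables (A : comNzRingType) (C : numClosedFieldType) (entA : entire A)
  (charA : forall n, n.+1%:R <> 0 :> A).
Implicit Types (T : A -> Prop) (phi psi : A -> C).

(** Coefficients stay in [T] at the price of a power of the leading coefficient. The bound on the
    size of [h] is what lets minimality of a relation be applied to a quotient in
    [specialization]. *)
Lemma pseudo_division T (q : {poly A}) : is_subring T -> over T q -> q != 0 ->
  forall p, over T p -> exists k h r, [/\ over T h, over T r,
    lead_coef q ^+ k *: p = h * q + r, (size r < size q)%N &
    (size h <= (size p - size q).+1)%N].
Proof.
move=> HT Tq q0 p; have [n] := ubnP (size p); elim: n p => // n IH p; rewrite ltnS => sp Tp.
have [spq|sqp] := ltnP (size p) (size q).
  exists 0%N, 0, p; rewrite expr0 scale1r mul0r add0r size_poly0; split=> //.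
  by move=> i; rewrite coef0; apply: subring0.
have sq0 : (0 < size q)%N by rewrite lt0n size_poly_eq0.
set d := (size p - size q)%N.
pose p1 := lead_coef q *: p - (lead_coef p *: 'X^d) * q.
have Tlq : T (lead_coef q) by apply: Tq.
have Tlp : T (lead_coef p) by apply: Tp.
have Tm : over T (lead_coef p *: 'X^d) by apply: polyover_monom.
have Tp1 : over T p1.
  apply: polyoverB => //; last exact: polyoverM.
  by move=> i; rewrite coefZ; apply: subringM.
have sp1 : (size p1 < size p)%N.
  rewrite -(ltn_predK (leq_trans sq0 sqp)) ltnS; apply/leq_sizeP => j hj.
  rewrite coefB coefZ -scalerAl coefZ coefXnM /d.
  have [jd|jd] := ltnP j (size p - size q)%N.
    have : (size p <= j)%N || (j == (size p).-1) by lia.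
    case/orP => [h|/eqP E]; last by lia.
    by rewrite nth_default // !mulr0 subrr.
  have : (size p <= j)%N || (j == (size p).-1) by lia.
  case/orP => [h|/eqP ->]; first last.
    have -> : ((size p).-1 - (size p - size q))%N = (size q).-1 by lia.
    by rewrite -!/(lead_coef _) mulrC subrr.
  have h' : (size q <= j - (size p - size q))%N by lia.
  by rewrite (nth_default _ h) (nth_default _ h') !mulr0 subrr.
have [|//|k [h [r [Th Tr E sr sh]]]] := IH p1; first exact: leq_trans sp1 sp.
exists k.+1, (h + lead_coef q ^+ k *: (lead_coef p *: 'X^d)), r; split=> //.
- move=> i; rewrite coefD; apply: subringD => //; rewrite coefZ.
  by apply: subringM => //; apply: subringX.
- rewrite exprSr -scalerA.
  have -> : lead_coef q *: p = p1 + lead_coef p *: 'X^d * q by rewrite subrK.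
  by rewrite scalerDr E mulrDl -!scalerAl; ring.
- apply: leq_trans (size_polyD _ _) _; rewrite geq_max; apply/andP; split.
    by apply: leq_trans sh _; lia.
  apply: leq_trans (size_scale_leq _ _) _; apply: leq_trans (size_scale_leq _ _) _.
  by rewrite size_polyXn.
Qed.

(** A total function whose values outside [T] carry no meaning. *)
Definition hom_on T phi := [/\ phi 1 = 1,
  (forall a b, T a -> T b -> phi (a - b) = phi a - phi b) &
  (forall a b, T a -> T b -> phi (a * b) = phi a * phi b)].

Section Hom.
Variables (T : A -> Prop) (phi : A -> C) (HT : is_subring T) (Hphi : hom_on T phi).

Lemma hom1 : phi 1 = 1. Proof. by case: Hphi. Qed.
Lemma homB a b : T a -> T b -> phi (a - b) = phi a - phi b.
Proof. by case: Hphi => _ H _; apply: H. Qed.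
Lemma homM a b : T a -> T b -> phi (a * b) = phi a * phi b.
Proof. by case: Hphi => _ _ H; apply: H. Qed.
Lemma hom0 : phi 0 = 0.
Proof. by rewrite -(subrr 1) homB ?subrr //; apply: subring1. Qed.
Lemma homD a b : T a -> T b -> phi (a + b) = phi a + phi b.
Proof.
move=> Ta Tb; rewrite -[in LHS](opprK b) homB //; last exact: subringN.
by rewrite -(sub0r b) (homB (subring0 HT)) // hom0 sub0r opprK.
Qed.
Lemma homX a n : T a -> phi (a ^+ n) = phi a ^+ n.
Proof.
move=> Ta; elim: n => [|n IH]; first by rewrite !expr0 hom1.
by rewrite !exprS homM ?IH //; apply: subringX.
Qed.
Lemma homMn a n : T a -> phi (a *+ n) = phi a *+ n.
Proof.
move=> Ta; elim: n => [|n IH]; first by rewrite !mulr0n hom0.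
rewrite !mulrS homD ?IH // -mulr_natr; apply: subringM => //.
by rewrite -[n%:R]/(1 *+ n) -[n]card_ord -sumr_const; apply: subring_sum => // i _; apply: subring1.
Qed.
Lemma hom_sum (I : Type) (r : seq I) F : (forall i, T (F i)) ->
  phi (\sum_(i <- r) F i) = \sum_(i <- r) phi (F i).
Proof.
move=> TF; elim: r => [|i r IH]; first by rewrite !big_nil hom0.
by rewrite !big_cons homD ?IH //; apply: subring_sum.
Qed.

Lemma coef_hom p i : (map_poly phi p)`_i = phi p`_i.
Proof. by rewrite coef_map_id0 // hom0. Qed.

Lemma map_homM p q : over T p -> over T q ->
  map_poly phi (p * q) = map_poly phi p * map_poly phi q.
Proof.
move=> Tp Tq; apply/polyP => i; rewrite coef_hom !coefM hom_sum => [|j]; last exact: subringM.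
by apply: eq_bigr => j _; rewrite homM // !coef_hom.
Qed.
Lemma map_homB p q : over T p -> over T q ->
  map_poly phi (p - q) = map_poly phi p - map_poly phi q.
Proof. by move=> Tp Tq; apply/polyP => i; rewrite coefB !coef_hom coefB homB. Qed.
Lemma map_homZ c p : T c -> over T p -> map_poly phi (c *: p) = phi c *: map_poly phi p.
Proof. by move=> Tc Tp; apply/polyP => i; rewrite coefZ !coef_hom coefZ homM. Qed.
Lemma map_homC c : map_poly phi c%:P = (phi c)%:P.
Proof. by apply/polyP => i; rewrite coef_hom !coefC; case: eqP => _ //; apply: hom0. Qed.
Lemma map_homX : map_poly phi 'X = 'X.
Proof. by apply/polyP => i; rewrite coef_hom !coefX; case: eqP => _ //; [apply: hom1|apply: hom0]. Qed.
Lemma map_hom_deriv p : over T p -> map_poly phi p^`() = (map_poly phi p)^`().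
Proof. by move=> Tp; apply/polyP => i; rewrite coef_hom !coef_deriv homMn // coef_hom. Qed.

Lemma hom_extend x t :
  (forall p, over T p -> p.[x] = 0 -> (map_poly phi p).[t] = 0) ->
  exists psi, [/\ hom_on (adjoin T x) psi, (forall a, T a -> psi a = phi a) &
    (forall p, over T p -> psi p.[x] = (map_poly phi p).[t])].
Proof.
move=> compat.
have HA := adjoin_subring HT x.
have ex u : exists c, forall p, over T p -> u = p.[x] -> c = (map_poly phi p).[t].
  have [[p Tp ->]|nu] := pselect (adjoin T x u); last first.
    by exists 0 => p Tp E; case: nu; exists p.
  exists (map_poly phi p).[t] => q Tq E; apply/eqP; rewrite -subr_eq0 -hornerN -hornerD.
  by rewrite -map_homB // compat //; [apply: polyoverB|rewrite hornerD hornerN E subrr].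
have [psi Hpsi] := choice ex.
have Hp p : over T p -> psi p.[x] = (map_poly phi p).[t] by move=> Tp; apply: Hpsi.
exists psi; split=> //.
- split.
  + by rewrite -[1](hornerC 1 x) Hp ?map_homC ?hornerC ?hom1 //; apply: polyoverC => //; apply: subring1.
  + move=> _ _ [p Tp ->] [q Tq ->]; rewrite !Hp // -hornerN -hornerD Hp; last exact: polyoverB.
    by rewrite map_homB // hornerD hornerN.
  + move=> _ _ [p Tp ->] [q Tq ->]; rewrite !Hp // -hornerM Hp; last exact: polyoverM.
    by rewrite map_homM // hornerM.
- by move=> a Ta; rewrite -[a](hornerC a x) Hp ?map_homC ?hornerC //; apply: polyoverC.
Qed.

End Hom.

Lemma nonroot (p : {poly C}) (s : seq C) : p != 0 -> exists2 t, p.[t] != 0 & t \notin s.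
Proof.
move=> p0; pose q := p * \prod_(a <- s) ('X - a%:P).
have q0 : q != 0 by rewrite mulf_neq0 // monic_neq0 // monic_prod_XsubC.
pose r := [seq (i%:R : C) | i <- iota 0 (size q)].
have ur : uniq r.
  rewrite map_inj_uniq ?iota_uniq // => i j /eqP; rewrite eqr_nat; exact/eqP.
have /allPn[t _ rt] : ~~ all (root q) r.
  by apply/negP => H; have := max_poly_roots q0 H ur; rewrite size_map size_iota ltnn.
move: rt; rewrite /root hornerM mulf_eq0 negb_or => /andP[pt]; rewrite -/(root _ t).
by rewrite root_prod_XsubC => ts; exists t.
Qed.

(* A nonzero element of [T[x]] may be specialised to a nonzero value along all
   homomorphisms on [T] outside a hypersurface s = 0; [spec] records the freedom
   in the choice of the value [t] of [x]. *)
Lemma specialization T x a : is_subring T -> adjoin T x a -> a <> 0 ->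
  (exists2 s, T s /\ s <> 0 & forall phi, hom_on T phi -> phi s != 0 ->
     exists2 P : {poly C}, P != 0 & forall t, P.[t] != 0 ->
       exists psi, [/\ hom_on (adjoin T x) psi, (forall b, T b -> psi b = phi b),
         psi x = t & psi a != 0]) \/
  (exists s q, [/\ T s, s <> 0, over T q, q != 0 & q.[x] = 0] /\
    [/\ (forall r, over T r -> r != 0 -> r.[x] = 0 -> (size q <= size r)%N),
        (1 < size q)%N &
     forall phi, hom_on T phi -> phi s != 0 ->
     phi (lead_coef q) != 0 /\ forall t, (map_poly phi q).[t] = 0 ->
       (exists psi, [/\ hom_on (adjoin T x) psi, (forall b, T b -> psi b = phi b),
         psi x = t & psi a != 0]) /\ (map_poly phi q)^`().[t] != 0]).
Proof.
move=> HT [p0 Tp0 ->] a0; have HA := adjoin_subring HT x.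
have nz (p : {poly A}) : p.[x] <> 0 -> p != 0 by move=> H; apply/eqP => E; rewrite E horner0 in H.
have [trans|alg] := pselect (forall p, over T p -> p.[x] = 0 -> p = 0); [left|right].
  exists (lead_coef p0); first by split; [apply: Tp0|apply/eqP; rewrite lead_coef_eq0 nz].
  move=> phi Hphi s0; exists (map_poly phi p0).
    apply/eqP => E; move: s0; rewrite /lead_coef -(coef_hom HT Hphi) E coef0 eqxx //.
  move=> t Pt; have [|psi [Hpsi psiT psix]] := @hom_extend T phi HT Hphi x t.
    by move=> p Tp /(trans _ Tp)->; rewrite -polyC0 (map_homC HT Hphi) hornerC (hom0 HT Hphi).
  exists psi; split=> //; last by rewrite psix.
  have TX := polyoverX HT; have := psix _ TX.
  by rewrite hornerX => ->; rewrite (map_homX HT Hphi) hornerX.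
have [q [Tq q0 qx] qmin] : exists2 q : {poly A}, [/\ over T q, q != 0 & q.[x] = 0] &
    forall r, over T r -> r != 0 -> r.[x] = 0 -> (size q <= size r)%N.
  have [|q Hq qmin] := @min_size A (fun q => [/\ over T q, q != 0 & q.[x] = 0]).
    apply: contrapT => H; apply: alg => p Tp px; apply/eqP/negP => /negP p_0.
    by apply: H; exists p.
  by exists q => // r Tr r0 rx; apply: qmin.
have qs : (1 < size q)%N.
  rewrite ltnNge; apply/negP => /size1_polyC E; rewrite E hornerC in qx.
  by move: q0; rewrite E qx eqxx.
have lq0 : lead_coef q <> 0 by apply/eqP; rewrite lead_coef_eq0.
have expn0 (c : A) k : c <> 0 -> c ^+ k <> 0.
  move=> c0; elim: k => [|k IH]; first by rewrite expr0; apply/eqP; rewrite oner_neq0.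
  by rewrite exprS => /entA[].
have Tlq : T (lead_coef q) by apply: Tq.
have Tq' : over T q^`().
  move=> i; rewrite coef_deriv -mulr_natr; apply: subringM => //.
  by rewrite -[_%:R]/(1 *+ i.+1) -[i.+1]card_ord -sumr_const; apply: subring_sum => // j _; apply: subring1.
have q'x : q^`().[x] <> 0.
  move=> q'x; have q'0 : q^`() != 0.
    apply/eqP => /(congr1 (fun p : {poly A} => p`_(size q).-2)).
    rewrite coef_deriv coef0 -mulr_natr; have -> : (size q).-2.+1 = (size q).-1 by lia.
    by move/entA => [|]; [exact: lq0|rewrite -(ltn_predK qs); case: (size q) qs => [|[|n]] // _; apply: charA].
  have := qmin _ Tq' q'0 q'x; rewrite leqNgt; apply/negP; rewrite negbK.
  by apply: lt_size_deriv.
(* The derivative is included in the element to be kept nonzero, so that every chosen root [t] of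
   the specialised [q] is simple; this later separates two roots. *)
have {a0} a0 : (p0 * q^`()).[x] <> 0 by rewrite hornerM => /entA[].
have Tp0' : over T (p0 * q^`()) by apply: polyoverM.
(* a nonzero multiple of [p0.[x]] lying in [T] *)
have [u [d [Tu Td d0 Eu]]] : exists u d, [/\ over T u, T d, d <> 0 & u.[x] * (p0 * q^`()).[x] = d].
  (* A nonzero multiple of least size is constant. Otherwise dividing [q] by it leaves either a
     smaller nonzero multiple or, when the remainder vanishes at [x], a quotient that is a relation
     for [x] shorter than [q]. *)
  pose Z r := [/\ over T r, r.[x] <> 0 & exists2 u, over T u & r.[x] = u.[x] * (p0 * q^`()).[x]].
  have [|r [Tr rx [u Tu Er]] rmin] := @min_size A Z.
    exists (p0 * q^`()); split=> //; exists 1; first by apply: polyoverC => //; apply: subring1.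
    by rewrite hornerC mul1r.
  have r0 := nz _ rx.
  have [sr|sr] := leqP (size r) 1.
    have E := size1_polyC sr; exists u, r`_0; split=> //; first by rewrite E hornerC in rx.
    by rewrite -Er [in LHS]E hornerC.
  have srq : (size r < size q)%N.
    rewrite ltnNge; apply/negP => sqr.
    have [k [h [r' [Th Tr' E sr' _]]]] := pseudo_division HT Tq q0 Tr.
    have Ex : r'.[x] = lead_coef q ^+ k * r.[x].
      by have := congr1 (horner^~ x) E; rewrite hornerZ hornerD hornerM qx mulr0 add0r.
    have : Z r'.
      split=> //; first by rewrite Ex => /entA[/expn0|].
      exists (lead_coef q ^+ k *: u); last by rewrite Ex Er hornerZ mulrA.
      by move=> i; rewrite coefZ; apply: subringM => //; apply: subringX.
    by move=> /rmin; rewrite leqNgt (leq_trans sr' sqr).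
  have [k [h [r' [Th Tr' E sr' sh]]]] := pseudo_division HT Tr r0 Tq.
  have lr0 : lead_coef r <> 0 by apply/eqP; rewrite lead_coef_eq0.
  have Ex : h.[x] * r.[x] + r'.[x] = 0.
    by have := congr1 (horner^~ x) E; rewrite hornerZ hornerD hornerM qx mulr0 => <-.
  have r'x : r'.[x] = 0.
    apply: contrapT => r'x; have : Z r'; last by move=> /rmin; rewrite leqNgt sr'.
    split=> //; exists (- (h * u)).
      by move=> i; rewrite coefN; apply: subringN => //; apply: polyoverM.
    rewrite hornerN hornerM mulNr -mulrA -Er; apply/eqP.
    by rewrite eq_sym -subr_eq0 -opprD oppr_eq0 Ex.
  have hx : h.[x] = 0 by move: Ex; rewrite r'x addr0 => /entA[].
  have h0 : h != 0.
    apply/eqP => h0; have : (lead_coef r ^+ k *: q)`_(size q).-1 <> 0.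
      by rewrite coefZ => /entA[] H; [exact: (expn0 _ _ lr0 H)|exact: lq0 H].
    by rewrite E h0 mul0r add0r; apply; rewrite nth_default // -ltnS (ltn_predK qs); apply: (ltn_trans sr').
  have := qmin _ Th h0 hx; lia.
have TT : T (lead_coef q * d) by apply: subringM.
(* The factor [lead_coef q] preserves the degree of [q] and makes all relations of [x] vanish at the
   roots of its image; the factor [d] keeps p0(x) q'(x) nonzero. *)
exists (lead_coef q * d), q; split; first by split=> //; move/entA; case.
split=> // phi Hphi; rewrite (homM Hphi) // mulf_eq0 negb_or => /andP[phiq phid].
split=> // t qt; have [|psi [Hpsi psiT psix]] := @hom_extend T phi HT Hphi x t.
  move=> p Tp px; have [k [h [r [Th Tr E sr _]]]] := pseudo_division HT Tq q0 Tp.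
  have r0 : r = 0.
    apply/eqP/negP => /negP r0; have := qmin r Tr r0; rewrite leqNgt sr => H; suff /H : r.[x] = 0 by [].
    have := congr1 (horner^~ x) E.
    by rewrite hornerZ hornerD hornerM px qx !mulr0 add0r.
  have := congr1 (fun p => (map_poly phi p).[t]) E; rewrite r0 addr0 (map_homM HT Hphi) //.
  rewrite hornerM qt mulr0 (map_homZ HT Hphi) //; last exact: subringX.
  rewrite hornerZ (homX HT Hphi) // => /eqP; rewrite mulf_eq0 expf_eq0 (negPf phiq) andbF /=.
  by move/eqP.
have H : psi (p0 * q^`()).[x] != 0.
  apply/eqP => p0x; move/eqP: phid; apply.
  rewrite -psiT // -Eu (homM Hpsi) ?p0x ?mulr0 //; first by exists u.
  by exists (p0 * q^`()).
have psix' : psi x = t.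
  have := psix _ (polyoverX HT); by rewrite hornerX => ->; rewrite (map_homX HT Hphi) hornerX.
have H0 : adjoin T x p0.[x] by exists p0.
have H1 : adjoin T x q^`().[x] by exists q^`().
move: H; rewrite hornerM (homM Hpsi) //.
rewrite mulf_eq0 negb_or => /andP[Ha Hb]; split; first by exists psi.
by rewrite -(map_hom_deriv HT Hphi Tq) -(psix _ Tq').
Qed.

Lemma hom_lead T phi (q : {poly A}) : is_subring T -> hom_on T phi ->
  phi (lead_coef q) != 0 -> size (map_poly phi q) = size q.
Proof. by move=> HT Hphi H; rewrite size_map_poly_id0. Qed.

Lemma hom_extension T x a : is_subring T -> adjoin T x a -> a <> 0 ->
  exists2 s, T s /\ s <> 0 & forall phi, hom_on T phi -> phi s != 0 ->
  exists psi, [/\ hom_on (adjoin T x) psi, (forall b, T b -> psi b = phi b) & psi a != 0].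
Proof.
move=> HT Ta a0; have [[s Hs H]|[s [q [[Ts s0 Tq q0 qx] [qmin qs H]]]]] := specialization HT Ta a0.
  exists s => // phi Hphi /(H _ Hphi)[P P0 HP]; have [t Pt _] := nonroot [::] P0.
  by have [psi [? ? _ ?]] := HP t Pt; exists psi.
exists s => // phi Hphi /(H _ Hphi)[lq Hroot].
have /closed_rootP[t /eqP Ht] : size (map_poly phi q) != 1%N.
  by rewrite (hom_lead HT Hphi lq); lia.
by have [[psi [? ? _ ?]] _] := Hroot t Ht; exists psi.
Qed.

(* Generic fibres of the projection from Spec T[x] to Spec T have two points. *)
Lemma two_hom_extensions T x a : is_subring T -> adjoin T x a -> a <> 0 ->
  (forall s, T s -> T (s * x) -> s = 0) ->
  exists2 s, T s /\ s <> 0 & forall phi, hom_on T phi -> phi s != 0 ->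
  exists psi1 psi2, [/\ hom_on (adjoin T x) psi1 /\ hom_on (adjoin T x) psi2,
    (forall b, T b -> psi1 b = phi b) /\ (forall b, T b -> psi2 b = phi b),
    psi1 a != 0 /\ psi2 a != 0 & psi1 x != psi2 x].
Proof.
move=> HT Ta a0 nfrac.
have [[s Hs H]|[s [q [[Ts s0 Tq q0 qx] [qmin qs H]]]]] := specialization HT Ta a0.
  exists s => // phi Hphi /(H _ Hphi)[P P0 HP]; have [t Pt _] := nonroot [::] P0.
  have [t' Pt' tt'] := nonroot [:: t] P0.
  have [psi1 [H1 e1 x1 a1]] := HP t Pt; have [psi2 [H2 e2 x2 a2]] := HP t' Pt'.
  by exists psi1, psi2; rewrite x1 x2; split=> //; move: tt'; rewrite inE eq_sym.
(* A minimal relation of degree one would exhibit [x] as a fraction over [T]. *)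
have qs2 : (2 < size q)%N.
  rewrite ltn_neqAle qs andbT; apply/eqP => E.
  have lq0 : lead_coef q != 0 by rewrite lead_coef_eq0.
  have Tlq : T (lead_coef q) by apply: Tq.
  move/eqP: lq0; apply; apply: nfrac => //.
  have : q.[x] = lead_coef q * x + q`_0.
    by rewrite horner_coef -E big_ord_recl big_ord1 /= expr0 mulr1 addrC /lead_coef -E expr1.
  rewrite qx => /esym/eqP; rewrite addr_eq0 => /eqP ->; exact: subringN.
exists s => // phi Hphi /(H _ Hphi)[lq Hroot].
have sm := hom_lead HT Hphi lq.
have /closed_rootP[t Ht] : size (map_poly phi q) != 1%N by rewrite sm; lia.
have [[psi1 [H1 e1 x1 a1]] dt] := Hroot t (eqP Ht).
have [r Er] := factor_theorem _ _ Ht.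
have r0 : r != 0 by apply/eqP => r0; move: sm; rewrite Er r0 mul0r size_poly0; lia.
have /closed_rootP[t' Ht'] : size r != 1%N.
  apply/eqP => r1; move: sm; rewrite Er size_Mmonic ?monicXsubC // size_XsubC r1 => E.
  by rewrite -E in qs2.
have [|[psi2 [H2 e2 x2 a2]] _] := Hroot t'; first by rewrite Er hornerM (eqP Ht') mul0r.
exists psi1, psi2; rewrite x1 x2; split=> //; apply/eqP => tt'; move/eqP: dt; apply.
by rewrite Er derivM derivXsubC mulr1 hornerD hornerM tt' (eqP Ht') hornerXsubC subrr mulr0 addr0.
Qed.

End Extension.

(** * The Nullstellensatz *)

(** Generators are treated from the last to the first: the obstruction found for one extension is
    the element to be kept nonzero by the preceding one. *)
Lemma hom_extension_seq (A : comNzRingType) (C : numClosedFieldType) (entA : entire A)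
    (charA : forall n, n.+1%:R <> 0 :> A) (s : seq A) (T : A -> Prop) a :
  is_subring T -> adjoins T s a -> a <> 0 ->
  exists2 c, T c /\ c <> 0 & forall phi : A -> C, hom_on T phi -> phi c != 0 ->
  exists psi : A -> C, [/\ hom_on (adjoins T s) psi, (forall b, T b -> psi b = phi b) & psi a != 0].
Proof.
elim: s T a => [|x s IH] T a HT Ta a0.
  by exists a => // phi Hphi phia; exists phi.
have HT' := adjoin_subring HT x.
have [d [Td d0] Hd] := IH _ a HT' Ta a0.
have [c Hc Hcc] := hom_extension C entA charA HT Td d0.
exists c => // phi Hphi /(Hcc _ Hphi)[psi [Hpsi psiT /(Hd _ Hpsi)[psi' [H1 H2 H3]]]].
exists psi'; split=> // b Tb; rewrite H2 ?psiT //; exact: adjoin_sub.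
Qed.

Section MPoly.
Variable n : nat.

Lemma mpoly_gen_ind (R : comNzRingType) (P : {mpoly R[n]} -> Prop) :
  (forall c, P c%:MP) -> (forall i, P 'X_i) -> (forall p q, P p -> P q -> P (p + q)) ->
  (forall p q, P p -> P q -> P (p * q)) -> forall p, P p.
Proof.
move=> PC PX PD PM; elim/mpolyind => [|c m p _ _ Pp]; first by rewrite -mpolyC0.
apply: PD => //; rewrite -mul_mpolyC; apply: (PM) => //; rewrite mpolyXE_id.
apply: (big_ind P) => [||i _]; [by rewrite -mpolyC1|exact: PM|].
elim: (fun_of_multinom m i) => [|k IH]; rewrite ?expr0 ?exprS; last exact: PM.
by rewrite -mpolyC1.
Qed.

Variable C : numClosedFieldType.
Notation M := {mpoly C[n]}.

Definition mpoly_vars : seq M := [seq 'X_i | i <- enum 'I_n].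

Definition mpoly_const (p : M) := exists c : C, p = c%:MP.

Lemma mpoly_const_subring : is_subring mpoly_const.
Proof.
split; first by exists 1.
- by move=> _ _ [a ->] [c ->]; exists (a - c); rewrite mpolyCB.
- by move=> _ _ [a ->] [c ->]; exists (a * c); rewrite mpolyCM.
Qed.

Lemma adjoins_vars p : adjoins mpoly_const mpoly_vars p.
Proof.
have HT := adjoins_subring mpoly_vars mpoly_const_subring.
elim/mpoly_gen_ind: p => [c|i|p q Hp Hq|p q Hp Hq].
- by apply: adjoins_sub; [apply: mpoly_const_subring|exists c].
- apply: adjoins_gen; first exact: mpoly_const_subring.
  by apply: map_f; rewrite mem_enum.
- exact: subringD.
- exact: subringM.
Qed.

Lemma noetherian_field (F : fieldType) : noetherian (fun _ : F => True).
Proof.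
move=> I [I0 ID IM] _; have [[a Ia a0]|H] := pselect (exists2 a, I a & a != 0); last first.
  exists [::]; split=> // a Ia J [J0 _ _] _; suff -> : a = 0 by [].
  by apply/eqP/negP => /negP a0; apply: H; exists a.
exists [:: a]; split=> [b|b _ J [_ _ JM] /(_ a)]; first by rewrite inE => /eqP->.
by rewrite inE eqxx => /(_ isT) Ja; rewrite -[b](mulfVK a0); apply: JM.
Qed.

Lemma noetherian_mpoly : noetherian (fun _ : M => True).
Proof.
have nC : noetherian mpoly_const.
  apply: (noetherian_image (pi := @mpolyC n C) (@noetherian_field C) (@is_subringT C)).
    by move=> c _; exists c.
  by move=> _ [c ->]; exists c.
have := noetherian_adjoins (s := mpoly_vars) mpoly_const_subring nC.
move=> H I [I0 ID IM] _; have [||s [sI Is]] := H I.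
- by split=> // t a _; apply: IM.
- by move=> p _; apply: adjoins_vars.
exists s; split=> // a Ia J [J0 JD JM]; apply: Is => //.
by split=> // t b _; apply: JM.
Qed.

Lemma adjoins_morph (A : comNzRingType) (pi : {rmorphism M -> A}) (T0 : A -> Prop) p :
  is_subring T0 -> (forall c, T0 (pi c%:MP)) -> adjoins T0 (map pi mpoly_vars) (pi p).
Proof.
move=> HT0 T0C; have HT := adjoins_subring (map pi mpoly_vars) HT0.
elim/mpoly_gen_ind: p => [c|i|p q Hp Hq|p q Hp Hq].
- exact: adjoins_sub.
- by apply: adjoins_gen => //; do 2 apply: map_f; rewrite mem_enum.
- by rewrite rmorphD; apply: subringD.
- by rewrite rmorphM; apply: subringM.
Qed.

Lemma hom_meval (A : comNzRingType) (pi : {rmorphism M -> A}) (T : A -> Prop) (psi : A -> C) :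
  is_subring T -> hom_on T psi -> (forall p, T (pi p)) -> (forall c, psi (pi c%:MP) = c) ->
  forall p, psi (pi p) = p.@[fun i => psi (pi 'X_i)].
Proof.
move=> HT Hpsi Tp psiC; elim/mpoly_gen_ind => [c|i|p q Hp Hq|p q Hp Hq].
- by rewrite mevalC psiC.
- by rewrite mevalXU.
- by rewrite rmorphD mevalD (homD HT Hpsi) // Hp Hq.
- by rewrite rmorphM mevalM (homM Hpsi) // Hp Hq.
Qed.

Lemma char_mpoly_quotient (A : comNzRingType) (pi : {rmorphism M -> A}) k : k.+1%:R <> 0 :> A.
Proof.
move=> E; have /eqP := oner_neq0 A; apply; apply/eqP.
have : pi ((k.+1%:R : C)^-1)%:MP * pi (k.+1%:R)%:MP = 1.
  by rewrite -rmorphM -mpolyCM mulVf ?pnatr_eq0 // mpolyC1 rmorph1.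
by rewrite !rmorph_nat E mulr0 => <-.
Qed.

Lemma prime_of_proper (R : comNzRingType) (I : R -> Prop) :
  noetherian (fun _ : R => True) -> is_ideal (fun=> True) I -> ~ I 1 ->
  exists2 Q, is_prime Q & forall p, I p -> Q p.
Proof.
move=> nR HI I1.
pose P (J : R -> Prop) := [/\ is_ideal (fun=> True) J, ~ J 1 & forall p, I p -> J p].
have [||Q [HQ Q1 IQ] Qmax] := noetherian_max nR (P := P); first by move=> J [].
  by exists I.
exists Q => //; split=> // a b Qab; apply: contrapT => /not_orP[Qa Qb].
have [Q0 QD QM] := HQ.
pose J p := exists q c, Q q /\ p = q + c * a.
have HJ : is_ideal (fun=> True) J.
  split; first by exists 0, 0; rewrite mul0r addr0.
  - move=> _ _ [q [c [Qq ->]]] [q' [c' [Qq' ->]]]; exists (q + q'), (c + c').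
    by split; [apply: QD|ring].
  - move=> t _ _ [q [c [Qq ->]]]; exists (t * q), (t * c).
    by split; [apply: QM|ring].
have QJ p : Q p -> J p by move=> Qp; exists p, 0; rewrite mul0r addr0.
have [[q [c [Qq E]]]|J1] := pselect (J 1).
  apply: Qb; rewrite -[b]mul1r E mulrDl -mulrA; apply: QD; last exact: QM.
  by rewrite mulrC; apply: QM.
apply: Qa; apply: (Qmax J) => //; first by split=> // p /IQ/QJ.
by exists 0, 1; rewrite add0r mul1r.
Qed.

(** In the quotient by a prime ideal above [I], the identification of the constants with C extends
    to all of the ring; the images of the variables are the coordinates of the zero. *)
Lemma nullstellensatz (I : M -> Prop) : is_ideal (fun=> True) I -> ~ I 1 ->
  exists v : 'I_n -> C, forall p, I p -> p.@[v] = 0.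
Proof.
move=> HI I1; have [Q HQ IQ] := prime_of_proper noetherian_mpoly HI I1.
have [HQi Q1 QM] := HQ.
have [A [pi [pis ker]]] := ideal_quotient HQi Q1.
have entA : entire A.
  move=> a b; have [x <-] := pis a; have [y <-] := pis b.
  by rewrite -rmorphM => /ker/QM[] /ker; [left|right].
pose T0 a := exists c : C, a = pi c%:MP.
have HT0 : is_subring T0.
  split; first by exists 1; rewrite mpolyC1 rmorph1.
  - by move=> _ _ [a ->] [c ->]; exists (a - c); rewrite mpolyCB rmorphB.
  - by move=> _ _ [a ->] [c ->]; exists (a * c); rewrite mpolyCM rmorphM.
have inj (a b : C) : pi a%:MP = pi b%:MP -> a = b.
  move=> E; apply/eqP; rewrite -subr_eq0; apply/negP => /negP ab; apply: Q1; apply/ker.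
  have E0 : pi (a - b)%:MP = 0 by rewrite mpolyCB rmorphB E subrr.
  rewrite rmorph1 -(rmorph1 pi) -mpolyC1 -(mulVf ab) mpolyCM rmorphM E0 mulr0 //.
have [phi Hphi] : exists phi : A -> C, forall c : C, phi (pi c%:MP) = c.
  have : forall a : A, exists c : C, T0 a -> a = pi c%:MP.
    move=> a; have [[c ->]|na] := pselect (T0 a); first by exists c.
    by exists 0 => /na.
  move=> /choice[phi Hphi]; exists phi => c; apply: inj; rewrite -Hphi //; by exists c.
have homphi : hom_on T0 phi.
  split; first by rewrite -(rmorph1 pi) -mpolyC1 Hphi.
  - by move=> _ _ [a ->] [c ->]; rewrite -rmorphB -mpolyCB !Hphi.
  - by move=> _ _ [a ->] [c ->]; rewrite -rmorphM -mpolyCM !Hphi.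
have Tall p : adjoins T0 (map pi mpoly_vars) (pi p).
  by apply: adjoins_morph => // c; exists c.
(* The base ring consists of constants, so the obstruction is a nonzero constant and [phi] avoids it
   automatically. *)
have [|c [[c0 ->] nz] H] := hom_extension_seq C entA (char_mpoly_quotient pi) HT0 (Tall 1).
  by rewrite rmorph1; apply/eqP; rewrite oner_neq0.
have [|psi [Hpsi psiT _]] := H phi homphi.
  by rewrite Hphi; apply/eqP => c00; apply: nz; rewrite c00 mpolyC0 rmorph0.
exists (fun i => psi (pi 'X_i)) => p /IQ/ker E.
have HT := adjoins_subring (map pi mpoly_vars) HT0.
rewrite -(hom_meval HT Hpsi Tall) ?E ?(hom0 HT Hpsi) // => d.
by rewrite psiT //; exists d.
Qed.

End MPoly.

(** * Polynomial functions on GL(N) *)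

(* Coordinates on GL(N): the entries of the matrix, then 1 / det. *)
Definition assign (S : Type) (N : nat) (h : 'M[S]_N) (t : S) (k : 'I_(N * N + 1)) : S :=
  match split k with inl k => mxvec h 0 k | inr _ => t end.

Definition pt (C : numClosedFieldType) (N : nat) (x : 'M[C]_N) : 'I_(N * N + 1) -> C :=
  assign x (\det x)^-1.

(* Locked, so that unification does not unfold it into a sum over monomials. *)
HB.lock Definition ev (C : numClosedFieldType) (N : nat) (x : 'M[C]_N)
  (p : {mpoly C[N * N + 1]}) : C := p.@[pt x].

Section Points.
Variables (C : numClosedFieldType) (N : nat).
Notation M := {mpoly C[N * N + 1]}.
Notation mat := 'M[C]_N.

Implicit Types (x y z : mat) (p q : M).

Lemma evE x : ev x = meval (@pt C N x) :> (M -> C).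
Proof. by apply/funext => p; rewrite unlock. Qed.

Lemma ev_is_zmod_morphism x : zmod_morphism (ev x : M -> C).
Proof. by rewrite evE; apply: raddfB. Qed.
Lemma ev_is_monoid_morphism x : monoid_morphism (ev x : M -> C).
Proof. by rewrite evE; split; [apply: rmorph1|apply: rmorphM]. Qed.
HB.instance Definition _ x := GRing.isZmodMorphism.Build M C (ev x) (ev_is_zmod_morphism x).
HB.instance Definition _ x := GRing.isMonoidMorphism.Build M C (ev x) (ev_is_monoid_morphism x).

(** The generic matrix; with [Tvar] for the inverse of its determinant, regular matrix maps are
    matrices over [M] and are evaluated by [map_mx (ev x)]. *)
Definition Xvar : 'M[M]_N := \matrix_(i, j) 'X_(lshift 1 (mxvec_index i j)).
Definition Tvar : M := 'X_(rshift (N * N) ord0).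

Lemma assign_index (S : Type) (h : 'M[S]_N) t i j : assign h t (lshift 1 (mxvec_index i j)) = h i j.
Proof. by rewrite /assign (unsplitK (inl _ : 'I_(N * N) + 'I_1)) mxvecE. Qed.

Lemma assign_last (S : Type) (h : 'M[S]_N) t k : assign h t (rshift (N * N) k) = t.
Proof. by rewrite /assign (unsplitK (inr _ : 'I_(N * N) + 'I_1)). Qed.

Lemma var_ind (P : 'I_(N * N + 1) -> Prop) :
  (forall i j, P (lshift 1 (mxvec_index i j))) -> P (rshift (N * N) ord0) -> forall k, P k.
Proof.
move=> P1 P2 k; rewrite -[k]splitK; case: (split k) => [k'|k'] /=; last by rewrite (ord1 k').
by case/mxvec_indexP: k' => i j; apply: P1.
Qed.

Lemma evD x p q : ev x (p + q) = ev x p + ev x q.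
Proof. exact: rmorphD. Qed.
Lemma evM x p q : ev x (p * q) = ev x p * ev x q.
Proof. exact: rmorphM. Qed.
Lemma evC x c : ev x c%:MP = c. Proof. by rewrite evE mevalC. Qed.

Lemma ev_Xvar x i j : ev x (Xvar i j) = x i j.
Proof. by rewrite evE mxE mevalXU /pt assign_index. Qed.

Lemma map_Xvar x : map_mx (ev x) Xvar = x.
Proof. by apply/matrixP => i j; rewrite mxE ev_Xvar. Qed.

Lemma ev_Tvar x : ev x Tvar = (\det x)^-1.
Proof. by rewrite evE mevalXU /pt assign_last. Qed.

Lemma matC_ev x (a : mat) : map_mx (ev x) (map_mx (@mpolyC _ C) a) = a.
Proof. by apply/matrixP => i j; rewrite !mxE evC. Qed.

(** Comorphism of the matrix map [h]. The inverse of [\det h] need not be a polynomial, so it is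
    supplied as [t], correct only at the points where it is used. *)
Definition subst (h : 'M[M]_N) (t : M) : M -> M := mmap (@mpolyC _ C) (assign h t).
HB.instance Definition _ h t := GRing.RMorphism.on (subst h t).

Lemma substC h t c : subst h t c%:MP = c%:MP.
Proof. exact: mmapC. Qed.

Lemma subst_Xvar h t i j : subst h t (Xvar i j) = h i j.
Proof. by rewrite /subst mxE mmapX mmap1U assign_index. Qed.

Lemma map_subst_Xvar h t : map_mx (subst h t) Xvar = h.
Proof. by apply/matrixP => i j; rewrite [LHS]mxE subst_Xvar. Qed.

Lemma subst_Tvar h t : subst h t Tvar = t.
Proof. by rewrite /subst mmapX mmap1U assign_last. Qed.

Lemma mpoly_var_ind (P : M -> Prop) :
  (forall c, P c%:MP) -> (forall i j, P (Xvar i j)) -> P Tvar ->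
  (forall p q, P p -> P q -> P (p + q)) -> (forall p q, P p -> P q -> P (p * q)) -> forall p, P p.
Proof.
move=> PC PX PT PD PM; apply: mpoly_gen_ind => //.
by apply: var_ind => // i j; have := PX i j; rewrite mxE.
Qed.

Lemma ev_subst h t x y p : map_mx (ev x) h = y -> ev x t = (\det y)^-1 ->
  ev x (subst h t p) = ev y p.
Proof.
move=> hy ty; elim/mpoly_var_ind: p => [c|i j||p q Hp Hq|p q Hp Hq].
- by rewrite substC !evC.
- by rewrite subst_Xvar ev_Xvar -hy mxE.
- by rewrite subst_Tvar ev_Tvar.
- by rewrite !rmorphD /= Hp Hq.
- by rewrite !rmorphM /= Hp Hq.
Qed.

Definition vanish (Z : mat -> Prop) (p : M) := forall x, Z x -> ev x p = 0.

Lemma vanish_ideal Z : is_ideal (fun=> True) (vanish Z).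
Proof.
split=> [x _|p q Hp Hq x Zx|t p _ Hp x Zx]; first exact: rmorph0.
  by rewrite rmorphD /= Hp // Hq // addr0.
by rewrite rmorphM /= Hp // mulr0.
Qed.

Definition zclosed (Z : mat -> Prop) := exists I : M -> Prop,
  forall x, Z x <-> x \in unitmx /\ forall p, I p -> ev x p = 0.

Lemma zclosed_unit Z x : zclosed Z -> Z x -> x \in unitmx.
Proof. by move=> [I HI] /HI[]. Qed.

Lemma unitmx_det (x : mat) : (x \in unitmx) = (\det x != 0).
Proof. by rewrite unitmxE unitfE. Qed.

(** The relation det(X) T = 1 holds on [Z]. At the zero [v] it forces the matrix part to be
    invertible and determines the last coordinate. *)
Lemma vanish_point Z (v : 'I_(N * N + 1) -> C) : zclosed Z ->
  (forall p, vanish Z p -> p.@[v] = 0) ->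
  exists2 z, Z z & forall p, p.@[v] = ev z p.
Proof.
move=> [I HI] Hv; pose z : mat := \matrix_(i, j) v (lshift 1 (mxvec_index i j)).
have Ez : map_mx (meval v) Xvar = z by apply/matrixP => i j; rewrite !mxE mevalXU.
have dz : \det z * Tvar.@[v] = 1.
  apply/eqP; rewrite -subr_eq0 -Ez det_map_mx -mevalM -(meval1 v) -mevalB; apply/eqP.
  apply: Hv => x /HI[ux _]; rewrite rmorphB rmorphM rmorph1 /= ev_Tvar -det_map_mx map_Xvar.
  by rewrite mulfV ?subrr // -unitmx_det.
have z0 : \det z != 0.
  by apply/eqP => z0; move: dz; rewrite z0 mul0r => /esym/eqP; rewrite oner_eq0.
have E p : p.@[v] = ev z p.
  rewrite evE; apply: meval_eq; apply: var_ind => [i j|].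
    by rewrite /pt assign_index mxE.
  rewrite /pt assign_last; apply: (mulfI z0); rewrite mulfV // -dz /Tvar mevalXU //.
exists z => //; apply/HI; rewrite unitmx_det; split=> // p Ip; rewrite -E; apply: Hv.
by move=> x /HI[_ /(_ _ Ip)].
Qed.

Definition evker x (p : M) := ev x p = 0.

Lemma evker_ideal x : is_ideal (fun=> True) (evker x).
Proof.
split=> [|p q Hp Hq|t p _ Hp]; first exact: rmorph0.
  by rewrite /evker rmorphD /= Hp Hq addr0.
by rewrite /evker rmorphM /= Hp mulr0.
Qed.

Lemma vanish_krull Z z b : is_prime (vanish Z) -> (forall p, vanish Z p -> ev z p = 0) ->
  (forall n, exists2 c, ideal_pow (evker z) n c & vanish Z (b - c)) -> vanish Z b.
Proof.
move=> HZ Zz; apply: krull_prime => //; first exact: noetherian_mpoly.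
  exact: evker_ideal.
by rewrite /evker rmorph1; apply/eqP; rewrite oner_eq0.
Qed.

(* Precomposition with w |-> w z^-1 w, the reflection of z in w; it fixes z. *)
Definition geod (z : mat) : M -> M :=
  subst (Xvar *m map_mx (@mpolyC _ C) (invmx z) *m Xvar) (Tvar ^+ 2 * (\det z)%:MP).
HB.instance Definition _ z := GRing.RMorphism.on (geod z).

Lemma ev_geod z x p : z \in unitmx -> x \in unitmx ->
  ev x (geod z p) = ev (x *m invmx z *m x) p.
Proof.
move=> uz ux; apply: ev_subst.
  by rewrite !map_mxM map_Xvar matC_ev.
rewrite rmorphM rmorphXn /= ev_Tvar evC !det_mulmx det_inv.
by move: uz ux; rewrite !unitmx_det => uz ux; field; rewrite uz ux.
Qed.

Lemma ideal_powM1 (m : M -> Prop) n (x c : M) : ideal_pow m n c -> ideal_pow m n (x * c).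
Proof. by have [_ _ PM] := ideal_pow_ideal m n; apply: PM. Qed.

(* [geod z] acts on the cotangent space at z as multiplication by 2. *)
Lemma geod_linear z p : z \in unitmx ->
  ideal_pow (evker z) 2 (geod z p - 2 * p + (ev z p)%:MP).
Proof.
move=> uz; set m := evker z; have [m0 mD mM] := evker_ideal z.
have [P0 PD PM] := ideal_pow_ideal m 2.
have sub q : m (q - (ev z q)%:MP) by rewrite /m /evker rmorphB /= evC subrr.
have m2 (x y : M) : m x -> m y -> ideal_pow m 2 (x * y).
  by move=> mx my; rewrite -[y]mulr1; apply: ideal_powS => //; apply: ideal_powS.
elim/mpoly_var_ind: p => [c|i j||p q Hp Hq|p q Hp Hq].
- by rewrite /geod substC evC; have -> : c%:MP - 2 * c%:MP + c%:MP = 0 :> M by ring.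
- pose Zm : 'M[M]_N := map_mx (@mpolyC _ C) z; pose Zi : 'M[M]_N := map_mx (@mpolyC _ C) (invmx z).
  pose D : 'M[M]_N := Xvar - Zm.
  have E1 : Zi *m Zm = 1%:M by rewrite -map_mxM mulVmx // map_mx1.
  have E2 : Zm *m Zi = 1%:M by rewrite -map_mxM mulmxV // map_mx1.
  have E : Xvar *m Zi *m Xvar = D *m Zi *m D + (D + D + Zm).
    have EX : Xvar = D + Zm by rewrite subrK.
    rewrite EX mulmxDl E2 mulmxDl mul1mx mulmxDr -[D *m Zi *m Zm]mulmxA E1 mulmx1.
    by rewrite -!addrA.
  have addE (U V : 'M[M]_N) k l : (U + V) k l = U k l + V k l by rewrite mxE.
  have ED k l : D k l = Xvar k l - (z k l)%:MP.
    by rewrite addE [(- Zm) k l]mxE [Zm k l]mxE.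
  have mDij k l : m (D k l) by rewrite ED -(ev_Xvar z); apply: sub.
  rewrite /geod subst_Xvar E ev_Xvar.
  have -> : (D *m Zi *m D + (D + D + Zm)) i j - 2 * Xvar i j + (z i j)%:MP = (D *m Zi *m D) i j.
    by rewrite !addE [(- Zm) i j]mxE [Zm i j]mxE; ring.
  rewrite mxE; elim/big_ind: _ => // k _; apply: m2 => //.
  rewrite mxE; elim/big_ind: _ => // l _; by rewrite mulrC; apply: mM => //; apply: mDij.
- rewrite /geod subst_Tvar ev_Tvar; set d := \det z.
  have d0 : d != 0 by rewrite -unitmx_det.
  have -> : Tvar ^+ 2 * d%:MP - 2 * Tvar + (d^-1)%:MP =
      d%:MP * ((Tvar - (d^-1)%:MP) * (Tvar - (d^-1)%:MP)).
    have E : d%:MP * (d^-1)%:MP = 1 :> M by rewrite -mpolyCM mulfV // mpolyC1.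
    rewrite mulrBr !mulrBl; have -> : d%:MP * (Tvar * Tvar - (d^-1)%:MP * Tvar -
      (Tvar * (d^-1)%:MP - (d^-1)%:MP * (d^-1)%:MP)) = Tvar ^+ 2 * d%:MP
      - 2 * (d%:MP * (d^-1)%:MP) * Tvar + (d%:MP * (d^-1)%:MP) * (d^-1)%:MP by ring.
    by rewrite E; ring.
  by apply: PM => //; apply: m2; have := sub Tvar; rewrite ev_Tvar.
- rewrite !rmorphD /=.
  have -> : geod z p + geod z q - 2 * (p + q) + ((ev z p)%:MP + (ev z q)%:MP) =
     (geod z p - 2 * p + (ev z p)%:MP) + (geod z q - 2 * q + (ev z q)%:MP) by ring.
  exact: PD.
- rewrite !rmorphM /=; set a := (ev z p)%:MP in Hp *; set b := (ev z q)%:MP in Hq *.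
  set sp := geod z p in Hp *; set sq := geod z q in Hq *.
  have -> : sp * sq - 2 * (p * q) + a * b = sq * (sp - 2 * p + a) +
      (2 * p - a) * (sq - 2 * q + b) + 2 * ((p - a) * (q - b)) by ring.
  apply: (PD); last by apply: (PM) => //; apply: m2; apply: sub.
  by apply: (PD); apply: (PM).
Qed.

Lemma ideal_powM (m : M -> Prop) n k a b :
  ideal_pow m n a -> ideal_pow m k b -> ideal_pow m (n + k) (a * b).
Proof.
elim: n a => [|n IH] a Ha Hb; first exact: ideal_powM1.
have [P0 PD PM] := ideal_pow_ideal m (n.+1 + k).
have := Ha (fun a => ideal_pow m (n.+1 + k) (a * b)); apply.
  split=> [|c d Hc Hd|t c _ Hc]; first by rewrite mul0r.
    by rewrite mulrDl; apply: PD.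
  by rewrite -mulrA; apply: PM.
move=> _ [x [c [mx Hc ->]]]; rewrite -mulrA addSn; apply: ideal_powS => //; exact: IH.
Qed.

(** Multiplicativity turns the factor 2 on m / m^2 into 2^n on m^n / m^(n+1). The second conjunct,
    stability of the powers of m, is carried along for the induction. *)
Lemma geod_pow z n p : z \in unitmx -> ideal_pow (evker z) n p ->
  ideal_pow (evker z) n.+1 (geod z p - 2 ^+ n * p) /\ ideal_pow (evker z) n (geod z p).
Proof.
move=> uz; set m := evker z; have [m0 mD mM] := evker_ideal z.
have lin q : m q -> ideal_pow m 2 (geod z q - 2 * q).
  by have := geod_linear q uz; rewrite /m /evker => + E; rewrite E mpolyC0 addr0.
have m1 q : m q -> ideal_pow m 1 q by move=> mq; rewrite -[q]mulr1; apply: ideal_powS.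
have geodm q : m q -> m (geod z q).
  move=> mq; rewrite /m /evker ev_geod // mulmxV // mul1mx; exact: mq.
elim: n p => [|n IH] p Hp.
  split=> //; apply: m1; rewrite expr0 mul1r /m /evker rmorphB /=.
  by rewrite ev_geod // mulmxV // mul1mx subrr.
have [P0 PD PM] := ideal_pow_ideal m n.+2.
have [Q0 QD QM] := ideal_pow_ideal m n.+1.
have := Hp (fun p => ideal_pow m n.+2 (geod z p - 2 ^+ n.+1 * p) /\ ideal_pow m n.+1 (geod z p)).
apply.
  split=> [|a b [Ha Ha'] [Hb Hb']|t a _ [Ha Ha']].
  - by rewrite rmorph0 mulr0 subrr.
  - rewrite rmorphD /=; split; last exact: QD.
    have -> : geod z a + geod z b - 2 ^+ n.+1 * (a + b) =
       (geod z a - 2 ^+ n.+1 * a) + (geod z b - 2 ^+ n.+1 * b) by ring.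
    exact: PD.
  - rewrite rmorphM /=; split; last exact: QM.
    have -> : geod z t * geod z a - 2 ^+ n.+1 * (t * a) =
        t * (geod z a - 2 ^+ n.+1 * a) + (geod z t - t) * geod z a by ring.
    apply: (PD); first exact: PM.
    apply: ideal_powS => //; rewrite /m /evker rmorphB /=.
    by rewrite ev_geod // mulmxV // mul1mx subrr.
move=> _ [x [c [mx Hc ->]]]; have [Hc1 Hc2] := IH c Hc.
rewrite rmorphM /=; split; last by apply: ideal_powS => //; apply: geodm.
have -> : geod z x * geod z c - 2 ^+ n.+1 * (x * c) =
   (geod z x - 2 * x) * geod z c + 2 * (x * (geod z c - 2 ^+ n * c)) by rewrite exprS; ring.
apply: (PD); last by apply: (PM) => //; apply: ideal_powS.
by have := ideal_powM (lin x mx) Hc2.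
Qed.

(** If b = c modulo the ideal of [Z] with c in m^n, then [geod z c] is in that ideal and equals 2^n
    c modulo m^(n+1). Dividing by 2^n moves b into m^(n+1) modulo the ideal, and Krull's theorem
    concludes. *)
Lemma vanish_geod Z z b : is_prime (vanish Z) -> z \in unitmx ->
  (forall p, vanish Z p -> ev z p = 0) -> (forall p, vanish Z p -> vanish Z (geod z p)) ->
  vanish Z (geod z b) -> vanish Z b.
Proof.
move=> HZ uz Zz Zg Hb; apply: (vanish_krull HZ Zz) => n.
have [_ VD VM] := vanish_ideal Z.
elim: n => [|n [c Hc bc]]; first by exists b => //; rewrite subrr; case: (vanish_ideal Z).
have [Hc1 _] := geod_pow uz Hc; have [P0 PD PM] := ideal_pow_ideal (evker z) n.+1.
have V1 : vanish Z (geod z c).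
  have -> : geod z c = geod z b + (-1) * geod z (b - c) by rewrite rmorphB /=; ring.
  by apply: (VD) => //; apply: (VM) => //; apply: Zg.
have two : ((2 : C) ^- n)%:MP * 2 ^+ n = 1 :> M.
  have -> : (2 : M) ^+ n = ((2 : C) ^+ n)%:MP by rewrite rmorphXn rmorph_nat.
  by rewrite -mpolyCM mulVf ?mpolyC1 // expf_neq0 // pnatr_eq0.
exists ((- (2 : C) ^- n)%:MP * (geod z c - 2 ^+ n * c)); first exact: PM.
have -> : b - (- (2 : C) ^- n)%:MP * (geod z c - 2 ^+ n * c) =
    (b - c) + (1 - ((2 : C) ^- n)%:MP * 2 ^+ n) * c + ((2 : C) ^- n)%:MP * geod z c.
  by rewrite mpolyCN; ring.
by rewrite two subrr mul0r addr0; apply: VD => //; apply: VM.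
Qed.

End Points.

(** * Irreducibility of connected groups *)

Section Groups.
Variables (C : numClosedFieldType) (N : nat).
Notation M := {mpoly C[N * N + 1]}.
Notation mat := 'M[C]_N.
Implicit Types (G : mat -> Prop).

Definition zconnected (Z : mat -> Prop) := forall A B : mat -> Prop,
  zclosed A -> zclosed B -> (forall x, A x \/ B x <-> Z x) -> (forall x, ~ (A x /\ B x)) ->
  (forall x, ~ A x) \/ (forall x, ~ B x).

Definition zgroup G := [/\ zclosed G, G 1%:M, (forall x y, G x -> G y -> G (x *m y)) &
  (forall x, G x -> G (invmx x))].

Lemma zclosedI G (I : M -> Prop) : zclosed G ->
  zclosed (fun x => G x /\ forall p, I p -> ev x p = 0).
Proof.
move=> [J HJ]; exists (fun p => J p \/ I p) => x; split.
  by move=> [/HJ[ux Jx] Ix]; split=> // p [/Jx|/Ix].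
by move=> [ux H]; split=> [|p Ip]; [apply/HJ; split=> // p Jp|]; apply: H; [left|right].
Qed.

(* p |-> p(h x k) *)
Definition transl (h k : mat) : M -> M :=
  subst (map_mx (@mpolyC _ C) h *m @Xvar C N *m map_mx (@mpolyC _ C) k)
    (((\det h)^-1 * (\det k)^-1)%:MP * @Tvar C N).
HB.instance Definition _ h k := GRing.RMorphism.on (transl h k).

Lemma ev_transl h k x p : ev x (transl h k p) = ev (h *m x *m k) p.
Proof.
apply: ev_subst; first by rewrite !map_mxM !matC_ev map_Xvar.
by rewrite rmorphM /= evC ev_Tvar !det_mulmx !invfM mulrAC.
Qed.

Section Group.
Variables (G : mat -> Prop) (HG : zgroup G).

Lemma zgroup_unit x : G x -> x \in unitmx.
Proof. by case: HG => cG _ _ _; apply: zclosed_unit. Qed.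

Definition colon (a : M) : M -> Prop := fun p => vanish G (p * a).

Lemma colon_ideal a : is_ideal (fun=> True) (colon a).
Proof.
have [V0 VD VM] := vanish_ideal G; split=> [|p q Hp Hq|t p _ Hp]; rewrite /colon.
- by rewrite mul0r.
- by rewrite mulrDl; apply: VD.
- by rewrite -mulrA; apply: VM.
Qed.

(* The zero set X of a maximal annihilator is an irreducible component; it is
   disjoint from or equal to each of its translates, hence open and a subgroup. *)
Lemma vanish_prime : zconnected G -> is_prime (vanish G).
Proof.
move=> Gc; have [cG G1 GM GV] := HG.
have [V0 VD VM] := vanish_ideal G.
have vanish1 : ~ vanish G 1.
  by move=> /(_ _ G1); rewrite rmorph1 => /eqP; rewrite oner_eq0.
pose P J := exists2 a, ~ vanish G a & J = colon a.
have [||_ [a0 a0G ->] a0max] := noetherian_max (@noetherian_mpoly _ C) (P := P).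
- by move=> _ [a _ ->]; apply: colon_ideal.
- by exists (colon 1), 1.
have [g0 [Gg0 ag0]] : exists g, G g /\ ev g a0 <> 0.
  by apply: contrapT => H; apply: a0G => g Gg; apply: contrapT => H'; apply: H; exists g.
(* Left translations permute the annihilators, so translates of a maximal one are maximal. *)
have max_transl h b : G h -> ~ vanish G b ->
    (forall p, colon (transl h 1%:M a0) p -> colon b p) ->
    forall p, colon b p -> colon (transl h 1%:M a0) p.
  move=> Gh bG Hab p pb g Gg.
  have uh := zgroup_unit Gh.
  have bG' : ~ vanish G (transl (invmx h) 1%:M b).
    move=> Hb; apply: bG => x Gx; have := Hb _ (GM _ _ Gh Gx).
    by rewrite ev_transl mulmx1 mulmxA mulVmx // mul1mx.
  have : colon a0 (transl (invmx h) 1%:M p).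
    apply: (a0max (colon (transl (invmx h) 1%:M b))).
    - by exists (transl (invmx h) 1%:M b).
    - move=> q qa x Gx; have Gx' := GM _ _ (GV _ Gh) Gx.
      have H : colon (transl h 1%:M a0) (transl h 1%:M q).
        by move=> y Gy; rewrite -rmorphM ev_transl mulmx1; apply: qa; apply: GM.
      have := Hab _ H _ Gx'.
      by rewrite !rmorphM /= !ev_transl !mulmx1 mulmxA mulmxV // mul1mx.
    - move=> x Gx; rewrite -rmorphM ev_transl mulmx1; apply: pb.
      by apply: GM => //; apply: GV.
  move=> /(_ (h *m g)); rewrite !rmorphM /= !ev_transl !mulmx1 mulmxA mulVmx // mul1mx.
  by apply; apply: GM.
(* Translated so that a(1) is nonzero: the component to be studied passes through the identity. *)
pose a := transl g0 1%:M a0.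
have a1 : ev 1%:M a <> 0 by rewrite ev_transl !mulmx1.
have aG : ~ vanish G a by move=> /(_ _ G1).
have amax b : ~ vanish G b -> (forall p, colon a p -> colon b p) ->
    forall p, colon b p -> colon a p by apply: max_transl.
have aprime p q : colon a (p * q) -> colon a p \/ colon a q.
  move=> Hpq; have [Hq|Hq] := pselect (vanish G (q * a)); [by right|left].
  apply: (amax (q * a)) => // [r Hr|]; rewrite /colon.
    by rewrite mulrCA; apply: VM.
  by rewrite mulrA.
pose X g := G g /\ forall p, colon a p -> ev g p = 0.
have cX : zclosed X by apply: zclosedI.
have aX g : G g -> ev g a <> 0 -> X g.
  move=> Gg ag; split=> // p /(_ _ Gg); rewrite rmorphM /= => /eqP; rewrite mulf_eq0.
  by case/orP => /eqP.
have X1 : X 1%:M by apply: aX.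
have colon_vanish p : vanish G p -> colon a p by move=> Vp; rewrite /colon mulrC; apply: VM.
(* The translate of [a] by [k] takes the value a(1) at [k], so it is not in [colon a]; primality
   then moves the other factor into [colon a]. *)
have Xtrans k p : X k -> (colon a p <-> colon a (transl (invmx k) 1%:M p)).
  move=> [Gk kX]; have uk := zgroup_unit Gk; have GVk := GV _ Gk.
  have step q : colon a q -> colon a (transl (invmx k) 1%:M q).
    move=> Hq; have /aprime[//|/kX] : colon a (transl (invmx k) 1%:M q * transl (invmx k) 1%:M a).
      by apply: colon_vanish => x Gx; rewrite -rmorphM ev_transl mulmx1; apply: Hq; apply: GM.
    by rewrite ev_transl mulmx1 mulVmx.
  split; first exact: step.
  move=> Hp; apply: (amax (transl k 1%:M a)).
  - by move=> /(_ _ GVk); rewrite ev_transl mulmx1 mulmxV.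
  - move=> q /step Hq x Gx; have := Hq (k *m x) (GM _ _ Gk Gx).
    by rewrite !rmorphM /= !ev_transl !mulmx1 mulmxA mulVmx // mul1mx.
  - move=> x Gx; have := Hp (k *m x) (GM _ _ Gk Gx).
    by rewrite !rmorphM /= !ev_transl !mulmx1 mulmxA mulVmx // mul1mx.
have XV k x : X k -> X x -> X (invmx k *m x).
  move=> Xk [Gx xX]; have [Gk _] := Xk; split=> [|p Hp]; first by apply: GM => //; apply: GV.
  by have := xX _ ((Xtrans _ _ Xk).1 Hp); rewrite ev_transl mulmx1.
have XM k x : X k -> X x -> X (k *m x).
  move=> Xk Xx; have [Gk _] := Xk; have uk := zgroup_unit Gk.
  have XVk : X (invmx k) by rewrite -[invmx k]mulmx1; apply: XV.
  by rewrite -[k]invmxK; apply: XV.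
(* [Y] is the complement of [X]: a point of [G] where some translate of [a] by an element of [X] is
   nonzero lies in [X]. As [Y] is closed, connectedness applies. *)
pose Y g := G g /\ forall p, (exists2 x, X x & p = transl (invmx x) 1%:M a) -> ev g p = 0.
have cY : zclosed Y by apply: zclosedI.
have XY g : X g \/ Y g <-> G g.
  split; first by case=> [] [].
  move=> Gg; have [Xg|nX] := pselect (X g); [by left|right].
  split=> // _ [x Xx ->]; rewrite ev_transl mulmx1; apply: contrapT => H; apply: nX.
  have [Gx _] := Xx; have ux := zgroup_unit Gx.
  have -> : g = x *m (invmx x *m g) by rewrite mulmxA mulmxV // mul1mx.
  by apply: XM => //; apply: aX => //; apply: GM => //; apply: GV.
have XYd g : ~ (X g /\ Y g).
  move=> [Xg [Gg Yg]]; have : ev g (transl (invmx g) 1%:M a) = 0 by apply: Yg; exists g.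
  by rewrite ev_transl mulmx1 mulVmx ?zgroup_unit.
have [nX|nY] := Gc X Y cX cY XY XYd; first by have := nX _ X1.
have GX g : G g -> X g by move/XY => [|/nY].
have colonE p : colon a p -> vanish G p by move=> Hp g /GX[_]; apply.
split=> // p q /colon_vanish/aprime[]/colonE; [by left|by right].
Qed.

End Group.
End Groups.

(** * Regular functions on the image of the Cartan embedding *)

Lemma In_nth (T : Type) (t0 : T) (s : seq T) i : (i < size s)%N -> List.In (nth t0 s i) s.
Proof. by elim: s i => // t s IH [_|i]; [left|rewrite ltnS => /IH; right]. Qed.

(** * Finite-dimensional spans of translates *)

Section Translates.
Variables (C : numClosedFieldType) (N : nat).
Notation M := {mpoly C[N * N + 1]}.
Notation mat := 'M[C]_N.

(** The comultiplication of C[GL_N]; it confines all translates of [p] to the span of the finitely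
    many [b]. *)
Lemma ev_mul_separated (p : M) : exists (I : finType) (a b : mat -> I -> C),
  forall h x, ev (h *m x) p = \sum_k a h k * b x k.
Proof.
elim/mpoly_var_ind: p => [c|i j||p q|p q].
- exists 'I_1, (fun _ _ => c), (fun _ _ => 1) => h x.
  by rewrite big_ord1 evC mulr1.
- exists 'I_N, (fun h k => h i k), (fun x k => x k j) => h x.
  by rewrite ev_Xvar mxE.
- exists 'I_1, (fun h _ => (\det h)^-1), (fun x _ => (\det x)^-1) => h x.
  by rewrite big_ord1 ev_Tvar det_mulmx invfM.
- move=> [I [a [b Hp]]] [J [c [d Hq]]].
  exists (I + J)%type, (fun h k => match k with inl i => a h i | inr j => c h j end),
    (fun h k => match k with inl i => b h i | inr j => d h j end) => h x.
  by rewrite rmorphD /= Hp Hq big_sumType.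
- move=> [I [a [b Hp]]] [J [c [d Hq]]].
  exists (I * J)%type, (fun h k => a h k.1 * c h k.2), (fun h k => b h k.1 * d h k.2) => h x.
  rewrite rmorphM /= Hp Hq big_distrlr /= pair_big /=.
  by apply: eq_bigr => k _; ring.
Qed.

(** A finite list in [P] whose coefficient vectors span a space of largest dimension already spans
    the vectors of all of [P]. [List.In] is used because [T] is a bare type. *)
Lemma finite_span (T : Type) (P : T -> Prop) (I : finType) (a : T -> I -> C) (t0 : T) :
  exists2 s : seq T, (forall t, List.In t s -> P t) & forall t, P t ->
    exists c : nat -> C, forall k, a t k = \sum_(i < size s) c i * a (nth t0 s i) k.
Proof.
pose v t : {ffun I -> C^o} := [ffun k => a t k].
pose Q d := exists2 s : seq T, (forall t, List.In t s -> P t) & (\dim <<map v s>> = d)%VS.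
have exQ : exists d, `[< Q d >] by exists (\dim <<map v [::]>>)%VS; apply/asboolP; exists [::].
have bQ d : `[< Q d >] -> (d <= \dim {:{ffun I -> C^o}})%N.
  by move=> /asboolP[s _ <-]; apply: dimvS; apply: subvf.
case: (ex_maxnP exQ bQ) => d /asboolP[s sP sd] dmax.
exists s => // t Pt.
have vt : v t \in <<map v s>>%VS.
  have le : (<<map v s>> <= <<map v (t :: s)>>)%VS.
    by apply: sub_span => x xs; rewrite inE xs orbT.
  have /eqP -> : (<<map v s>> == <<map v (t :: s)>>)%VS.
    rewrite -(geq_leqif (dimv_leqif_eq le)) sd; apply: dmax; apply/asboolP.
    by exists (t :: s) => // t' [<-|/sP].
  by apply: memv_span; rewrite inE eqxx.
pose X : (size s).-tuple {ffun I -> C^o} := map_tuple v (in_tuple s).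
have E : v t = \sum_(i < size s) coord X i (v t) *: X`_i by apply: coord_span.
exists (fun i => if insub i is Some j then coord X j (v t) else 0) => k.
have -> : a t k = v t k by rewrite ffunE.
rewrite {1}E sum_ffunE; apply: eq_bigr => i _.
rewrite ffunE insubT //= => ?; rewrite (nth_map t0) ?ltn_ord // [v _ k]ffunE.
by congr (coord X _ _ * _); apply: val_inj.
Qed.

End Translates.

Lemma invmxM (F : fieldType) n (A B : 'M[F]_n) : A \in unitmx -> B \in unitmx ->
  invmx (A *m B) = invmx B *m invmx A.
Proof.
move=> uA uB; have uAB : A *m B \in unitmx by rewrite unitmx_mul uA.
by rewrite -[RHS](mulmxK uAB) mulmxA mulmxKV // mulVmx // mul1mx.
Qed.

(** * The geometry of P and descent of invariant functions along j *)

Section Cartan.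
Variables (C : numClosedFieldType) (N : nat).
Notation M := {mpoly C[N * N + 1]}.
Notation mat := 'M[C]_N.
Variables (G : mat -> Prop) (theta : mat -> mat) (Th : 'M[M]_N).
Hypothesis HG : zgroup G.
Hypothesis primeG : is_prime (vanish G).
Hypothesis ThE : forall x, G x -> map_mx (ev x) Th = theta x.
Hypothesis thetaG : forall x, G x -> G (theta x).
Hypothesis thetaM : forall x y, G x -> G y -> theta (x *m y) = theta x *m theta y.
Hypothesis thetaK : forall x, G x -> theta (theta x) = x.

Let G1 : G 1%:M. Proof. by case: HG. Qed.
Let GM x y : G x -> G y -> G (x *m y). Proof. by case: HG => _ _ H _; apply: H. Qed.
Let GV x : G x -> G (invmx x). Proof. by case: HG => _ _ _; apply. Qed.
Let GU x : G x -> x \in unitmx. Proof. exact: zgroup_unit. Qed.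

Definition jmap (g : mat) := g *m invmx (theta g).
Definition Pset y := exists2 g, G g & y = jmap g.

Lemma theta1 : theta 1%:M = 1%:M.
Proof.
have u := GU (thetaG G1); have := thetaM G1 G1; rewrite mulmx1 => E.
by rewrite -[theta 1%:M](mulKmx u) -E mulVmx.
Qed.

Lemma thetaV x : G x -> theta (invmx x) = invmx (theta x).
Proof.
move=> Gx; have u := GU (thetaG Gx); have uV := GU Gx.
by rewrite -[theta (invmx x)](mulKmx u) -thetaM ?mulmxV ?theta1 ?mulmx1 //; apply: GV.
Qed.

Lemma jmapG g : G g -> G (jmap g).
Proof. by move=> Gg; apply: GM => //; apply: GV; apply: thetaG. Qed.

Lemma PsetG y : Pset y -> G y.
Proof. by move=> [g Gg ->]; apply: jmapG. Qed.

Lemma theta_jmap g : G g -> theta (jmap g) = invmx (jmap g).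
Proof.
move=> Gg; have Gt := thetaG Gg; rewrite /jmap thetaM ?thetaV ?thetaK //; last exact: GV.
rewrite invmxM ?invmxK //; [exact: GU|by rewrite unitmx_inv; apply: GU].
Qed.

Lemma theta_Pset y : Pset y -> theta y = invmx y.
Proof. by move=> [g Gg ->]; apply: theta_jmap. Qed.

(** Makes P the orbit of 1 under the twisted conjugation y |-> h y theta(h)^-1. *)
Lemma jmap_twist h g : G h -> G g -> jmap (h *m g) = h *m jmap g *m invmx (theta h).
Proof.
move=> Gh Gg; rewrite /jmap thetaM // invmxM ?mulmxA //; apply: GU; exact: thetaG.
Qed.

Lemma jmap_Pset y : Pset y -> jmap y = y *m y.
Proof. by move=> Py; rewrite /jmap theta_Pset // invmxK. Qed.

Lemma jmap1 : jmap 1%:M = 1%:M.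
Proof. by rewrite /jmap theta1 invmx1 mulmx1. Qed.

Lemma Pset1 : Pset 1%:M.
Proof. by exists 1%:M => //; rewrite jmap1. Qed.

(** The fibres of j are the cosets g K. *)
Lemma jmap_eq g1 g2 : G g1 -> G g2 -> jmap g1 = jmap g2 ->
  theta (invmx g1 *m g2) = invmx g1 *m g2.
Proof.
move=> G1' G2 E; rewrite thetaM ?thetaV //; last exact: GV.
have u1 := GU G1'; have u2 := GU (thetaG G2).
have Eg : jmap g2 *m theta g2 = g2 by rewrite /jmap mulmxKV.
by rewrite -[in RHS]Eg -E /jmap !mulmxA mulVmx // mul1mx.
Qed.

Definition invsubst : M -> M := subst (@Tvar C N *: \adj (@Xvar C N)) (\det (@Xvar C N)).

Lemma ev_invsubst x p : x \in unitmx -> ev x (invsubst p) = ev (invmx x) p.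
Proof.
move=> ux; apply: ev_subst; last by rewrite -det_map_mx map_Xvar det_inv invrK.
by rewrite map_mxZ /= ev_Tvar map_mx_adj map_Xvar /invmx ux.
Qed.

Definition Jmat : 'M[M]_N := @Xvar C N *m map_mx invsubst Th.
Definition jsubst : M -> M := subst Jmat (@Tvar C N * \det Th).
HB.instance Definition _ := GRing.RMorphism.on jsubst.

Lemma map_Jmat g : G g -> map_mx (ev g) Jmat = jmap g.
Proof.
move=> Gg; rewrite map_mxM map_Xvar; congr (_ *m _).
rewrite -thetaV // -ThE; last exact: GV.
by apply/matrixP => i j; rewrite !mxE /= ev_invsubst // GU.
Qed.

Lemma ev_jsubst g p : G g -> ev g (jsubst p) = ev (jmap g) p.
Proof.
move=> Gg; apply: ev_subst; first exact: map_Jmat.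
rewrite rmorphM /= ev_Tvar -det_map_mx ThE // /jmap det_mulmx det_inv invfM invrK //.
Qed.

Lemma vanishP p : vanish Pset p <-> vanish G (jsubst p).
Proof.
split=> [H g Gg|H _ [g Gg ->]]; last by rewrite -ev_jsubst // H.
by rewrite ev_jsubst //; apply: H; exists g.
Qed.

Lemma vanish_sub p : vanish G p -> vanish Pset p.
Proof. by move=> H y /PsetG/H. Qed.

Lemma primeP : is_prime (vanish Pset).
Proof.
have [_ _ GQ] := primeG; split; first exact: vanish_ideal.
  by move=> /(_ _ Pset1); rewrite rmorph1 => /eqP; rewrite oner_eq0.
by move=> p q /vanishP; rewrite rmorphM => /GQ[] /vanishP; [left|right].
Qed.

Definition polyfun (Z : mat -> Prop) (f : mat -> C) := exists p : M, forall x, Z x -> f x = ev x p.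

Definition right_invariant (f : mat -> C) :=
  forall g k, G g -> G k -> theta k = k -> f (g *m k) = f g.

(** Here [A] is C[G] and [S] is the image of C[P] under j^*. If [f] were not a fraction over [S],
    two homomorphisms S[f] -> C with different values on [f] would agree on [S]; extended to C[G]
    they are two points in one fibre of j, where an invariant function cannot differ. *)
Lemma fraction_descent f : polyfun G f -> right_invariant f ->
  exists s q : M, ~ vanish Pset s /\ forall g, G g -> ev (jmap g) s * f g = ev (jmap g) q.
Proof.
move=> [F fF] finv; have [cG _ _ _] := HG.
have [HQ Q1 QM] := primeG.
have [A [pi [pis ker]]] := ideal_quotient HQ Q1.
have entA : entire A.
  move=> a b; have [x <-] := pis a; have [y <-] := pis b.
  by rewrite -rmorphM => /ker/QM[] /ker; [left|right].
have charA := char_mpoly_quotient pi.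
pose S a := exists p, a = pi (jsubst p).
have HS : is_subring S.
  split; first by exists 1; rewrite !rmorph1.
  - by move=> _ _ [p ->] [q ->]; exists (p - q); rewrite !rmorphB.
  - by move=> _ _ [p ->] [q ->]; exists (p * q); rewrite !rmorphM.
have [[s [p sp] [[q Eq] s0]]|nfrac] := pselect (exists2 s, S s & S (s * pi F) /\ s <> 0).
  exists p, q; split=> [/vanishP/ker E|g Gg]; first by apply: s0; rewrite sp E.
  have /ker/(_ _ Gg) : pi (jsubst p * F - jsubst q) = 0.
    by rewrite rmorphB rmorphM -sp Eq subrr.
  by rewrite rmorphB rmorphM /= !ev_jsubst // fF // => /subr0_eq.
exfalso.
have nfrac' s : S s -> S (s * pi F) -> s = 0.
  by move=> Ss SsF; apply: contrapT => s0; apply: nfrac; exists s.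
have SC c : S (pi c%:MP) by exists c%:MP; rewrite /jsubst substC.
have HSF := adjoin_subring HS (pi F).
have SFC c : adjoin S (pi F) (pi c%:MP) by apply: adjoin_sub.
have Tall p := adjoins_morph p HSF SFC.
have HT := adjoins_subring (map pi (mpoly_vars _ C)) HSF.
have one0 : pi 1 <> 0 by rewrite rmorph1; apply/eqP; rewrite oner_neq0.
(* Homomorphisms on S[f] that are nonzero at [c] extend to C[G]; [c] is therefore the element to
   keep nonzero when the two of them are constructed. *)
have [c [Sc c0] Hc] := hom_extension_seq C entA charA HSF (Tall 1) one0.
have [_ [[p0 ->] nz] Hs] := two_hom_extensions C entA charA HS Sc c0 nfrac'.
have [g0 [Gg0 pg0]] : exists g, G g /\ ev g (jsubst p0) != 0.
  apply: contrapT => H; apply: nz; apply/ker => g Gg; apply: contrapT => /eqP H'.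
  by apply: H; exists g.
have [phi Hphi] : exists phi : A -> C, forall p, phi (pi p) = ev g0 p.
  have [lift Hlift] := choice pis; exists (fun a => ev g0 (lift a)) => p.
  have /ker/(_ _ Gg0) : pi (lift (pi p) - p) = 0 by rewrite rmorphB Hlift subrr.
  by rewrite rmorphB => /subr0_eq.
have homphi : hom_on S phi.
  split; first by rewrite -(rmorph1 pi) Hphi rmorph1.
  - by move=> _ _ [p ->] [q ->]; rewrite -!rmorphB !Hphi -!rmorphB.
  - by move=> _ _ [p ->] [q ->]; rewrite -!rmorphM !Hphi -!rmorphM.
have [|psi1 [psi2 [[H1 H2] [e1 e2] [c1 c2] neq]]] := Hs phi homphi; first by rewrite Hphi.
have points psi : hom_on (adjoin S (pi F)) psi -> (forall b, S b -> psi b = phi b) ->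
    psi c != 0 -> exists g, [/\ G g, jmap g = jmap g0 & f g = psi (pi F)].
  move=> Hpsi psiS /(Hc _ Hpsi)[chi [Hchi chiS _]].
  have chiP p : chi (pi p) = p.@[fun i => chi (pi 'X_i)].
    apply: (hom_meval HT Hchi Tall) => d.
    by rewrite chiS // psiS // Hphi evC.
  have [|g Gg Hg] := @vanish_point C N G (fun i => chi (pi 'X_i)) cG.
    by move=> p /ker E; rewrite -chiP E (hom0 HT Hchi).
  exists g; split=> //; last by rewrite fF // -Hg -chiP chiS //; apply: adjoin_gen.
  rewrite -[jmap g]map_Xvar -[RHS]map_Xvar; apply/matrixP => i j.
  rewrite !mxE /= -!ev_jsubst //.
  have Sj : S (pi (jsubst 'X_(lshift 1 (mxvec_index i j)))) by eexists.
  by rewrite -Hg -chiP chiS ?psiS ?Hphi //; apply: adjoin_sub.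
have [g1 [Gg1 j1 f1]] := points _ H1 e1 c1.
have [g2 [Gg2 j2 f2]] := points _ H2 e2 c2.
move/eqP: neq; apply; rewrite -f1 -f2.
have -> : g2 = g1 *m (invmx g1 *m g2) by rewrite mulmxA mulmxV ?mul1mx ?GU.
rewrite finv //; first by apply: GM => //; apply: GV.
by apply: jmap_eq => //; rewrite j1 j2.
Qed.

(* The conductor of f is stable under G; at a common zero z of it the
   map w |-> w z^-1 w sends P into the orbit of z, so the conductor vanishes to
   infinite order at z. *)
Lemma cartan_descent f : polyfun G f -> right_invariant f ->
  exists p : M, forall g, G g -> f g = ev (jmap g) p.
Proof.
move=> [F fF] finv; have [cG _ _ _] := HG.
have translate_poly h : G h -> polyfun G (fun g => f (h *m g)).
  move=> Gh; exists (transl h 1%:M F) => g Gg.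
  by rewrite ev_transl mulmx1 fF //; apply: GM.
have translate_inv h : G h -> right_invariant (fun g => f (h *m g)).
  by move=> Gh g k Gg Gk Hk; rewrite mulmxA finv //; apply: GM.
have [I [a [b Hab]]] := ev_mul_separated F.
have [s sG span] := @finite_span C mat G I a 1%:M.
have [V0 VD VM] := vanish_ideal Pset.
have [_ _ primePM] := primeP.
have [s0 [s0P Hs0]] : exists s0 : M, ~ vanish Pset s0 /\ forall h, List.In h s ->
    exists q, forall g, G g -> ev (jmap g) s0 * f (h *m g) = ev (jmap g) q.
  elim: s sG {span} => [|h s IH] sG.
    by exists 1; split=> // /(_ _ Pset1); rewrite rmorph1 => /eqP; rewrite oner_eq0.
  have [|s0 [s0P Hs0]] := IH; first by move=> h' sh'; apply: sG; right.
  have Gh : G h by apply: sG; left.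
  have [s1 [q1 [s1P H1]]] := fraction_descent (translate_poly h Gh) (translate_inv h Gh).
  exists (s0 * s1); split=> [/primePM[]//|h' [<-|sh']].
    by exists (s0 * q1) => g Gg; rewrite !rmorphM /= -mulrA H1.
  have [q Hq] := Hs0 _ sh'; exists (s1 * q) => g Gg.
  by rewrite !rmorphM /= -Hq // mulrA [ev _ s0 * _]mulrC.
(* The conductor of all translates of [f] at once, hence stable under twisted translation by
   construction. *)
pose cond p := forall h, G h ->
  exists q, forall g, G g -> ev (jmap g) p * f (h *m g) = ev (jmap g) q.
have cond_ideal : is_ideal (fun=> True) cond.
  split=> [h Gh|p q Hp Hq h Gh|t p _ Hp h Gh].
  - by exists 0 => g Gg; rewrite !rmorph0 mul0r.
  - have [p' Hp'] := Hp h Gh; have [q' Hq'] := Hq h Gh; exists (p' + q') => g Gg.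
    by rewrite !rmorphD /= mulrDl Hp' // Hq'.
  - have [p' Hp'] := Hp h Gh; exists (t * p') => g Gg.
    by rewrite !rmorphM /= -mulrA Hp'.
(* Every translate of [f] is a linear combination of the finitely many translates cleared by
   [s0]. *)
have cond_s0 : cond s0.
  move=> h Gh; have [c Hc] := span h Gh.
  have [q Hq] : exists q : nat -> M, forall i, (i < size s)%N ->
      forall g, G g -> ev (jmap g) s0 * f (nth 1%:M s i *m g) = ev (jmap g) (q i).
    have : forall i, exists q, (i < size s)%N ->
      forall g, G g -> ev (jmap g) s0 * f (nth 1%:M s i *m g) = ev (jmap g) q.
      move=> i; have [si|si] := ltnP i (size s); last by exists 0.
      by have [|q Hq] := Hs0 (nth 1%:M s i); [apply: In_nth|exists q].
    by move=> /choice[q Hq]; exists q.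
  exists (\sum_(i < size s) (c i)%:MP * q i) => g Gg.
  rewrite rmorph_sum fF; last exact: GM.
  rewrite Hab mulr_sumr.
  have -> : \sum_i ev (jmap g) s0 * (a h i * b g i) =
     \sum_(k < size s) c k * (ev (jmap g) s0 * f (nth 1%:M s k *m g)).
    transitivity (\sum_i \sum_(k < size s) c k * (ev (jmap g) s0 * (a (nth 1%:M s k) i * b g i))).
      apply: eq_bigr => i _; move: (ev (jmap g) s0) => e.
      by rewrite Hc mulr_suml mulr_sumr; apply: eq_bigr => k _; ring.
    rewrite exchange_big; apply: eq_bigr => k _ /=.
    have sk : G (nth 1%:M s k) by apply: sG; apply: In_nth.
    rewrite fF; last exact: GM.
    by rewrite Hab !mulr_sumr; apply: eq_bigr => i _; ring.
  by apply: eq_bigr => k _; rewrite Hq // rmorphM /= evC.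
have [/(_ _ G1)[q Hq]|cond1] := pselect (cond 1).
  by exists q => g Gg; rewrite -Hq // rmorph1 mul1r mul1mx.
exfalso; apply: s0P.
have cond_vanish p : vanish Pset p -> cond p.
  move=> Hp h Gh; exists 0 => g Gg; rewrite Hp ?mul0r ?rmorph0 //; by exists g.
have [v Hv] := nullstellensatz cond_ideal cond1.
have [|z Gz Ez] := @vanish_point C N G v cG.
  by move=> p /vanish_sub/cond_vanish/Hv.
have condz p : cond p -> ev z p = 0 by move=> /Hv; rewrite Ez.
have uz := GU Gz.
(* [z] is a zero of the ideal of P without being known to lie in P; the equation theta(y) y = 1
   holds on P and so passes to [z]. *)
have thz : theta z = invmx z.
  have E : theta z *m z = 1%:M.
    rewrite -ThE // -{2}[z]map_Xvar -map_mxM -(map_mx1 (ev z)).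
    apply/matrixP => i j; rewrite mxE [RHS]mxE; apply/eqP; rewrite -subr_eq0 -rmorphB; apply/eqP.
    apply: condz; apply: cond_vanish => y Py.
    have Gy := PsetG Py; rewrite rmorphB /=.
    have := congr1 (fun A : mat => A i j) (mulVmx (GU Gy)).
    rewrite -theta_Pset // -ThE // -{2}[y]map_Xvar -map_mxM -(map_mx1 (ev y)) mxE [RHS]mxE => ->.
    by rewrite subrr.
  by rewrite -[theta z](mulmxK uz) E mul1mx.
have cond_twist h p : G h -> cond p -> cond (transl h (invmx (theta h)) p).
  move=> Gh Hp h' Gh'; have [|q Hq] := Hp (h' *m invmx h); first by apply: GM => //; apply: GV.
  exists (transl h (invmx (theta h)) q) => g Gg.
  rewrite !ev_transl -jmap_twist // -Hq; last exact: GM.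
  by rewrite mulmxA mulmxKV // GU.
(* With h = w z^-1 one has w z^-1 w = h z theta(h)^-1, so the value at this point is that of a
   twisted translate at [z], where the whole conductor vanishes. *)
have cond_geod p : cond p -> vanish Pset (geod z p).
  move=> Hp w Pw; have Gw := PsetG Pw; have uw := GU Gw.
  rewrite ev_geod //; have GVz := GV Gz.
  have Gh : G (w *m invmx z) by apply: GM.
  have := condz _ (cond_twist _ _ Gh Hp); rewrite ev_transl.
  rewrite thetaM // theta_Pset // thetaV // thz invmxK invmxM ?unitmx_inv // invmxK.
  by rewrite mulmxKV // mulmxA.
apply: (vanish_geod (z := z) primeP uz).
- by move=> p /cond_vanish/condz.
- by move=> p /cond_vanish/cond_geod.
- exact: cond_geod.
Qed.

Lemma squares_dense p : (forall y, Pset y -> ev (y *m y) p = 0) -> vanish Pset p.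
Proof.
move=> Hp; have geod1 q y : Pset y -> ev y (geod 1%:M q) = ev (y *m y) q.
  by move=> /PsetG/GU uy; rewrite ev_geod ?unitmx1 // invmx1 mulmx1.
apply: (vanish_geod (z := 1%:M) primeP); first exact: unitmx1.
- by move=> q; apply; apply: Pset1.
- move=> q Hq y Py; rewrite geod1 // -jmap_Pset //; apply: Hq.
  by exists y => //; apply: PsetG.
- by move=> y Py; rewrite geod1 // Hp.
Qed.

(* Writing y = 1 + x with x in the maximal ideal at 1, the hypothesis reads
   2 u = - (x u + u x), so u vanishes to infinite order at 1. *)
Lemma anticommuting_vanish (U : 'M[M]_N) :
  (forall y, Pset y -> y *m map_mx (ev y) U + map_mx (ev y) U *m y = 0) ->
  forall y, Pset y -> map_mx (ev y) U = 0.
Proof.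
move=> HU; pose X : 'M[M]_N := @Xvar C N; pose D := X - 1%:M.
have [_ VD VM] := vanish_ideal Pset.
have ED i j : D i j = X i j - (i == j)%:R.
  have -> : (i == j)%:R = (1%:M : 'M[M]_N) i j by rewrite mxE.
  by rewrite /D [LHS]mxE [(- (1%:M : 'M[M]_N)) i j]mxE.
have mD i j : evker 1%:M (D i j).
  by rewrite /evker ED rmorphB /= ev_Xvar rmorph_nat mxE subrr.
suff H n i j : exists2 c, ideal_pow (evker 1%:M) n c & vanish Pset (U i j - c).
  move=> y Py; apply/matrixP => i j; rewrite !mxE.
  apply: (vanish_krull (z := 1%:M) primeP) Py => [p|n]; last exact: H.
  by apply; apply: Pset1.
elim: n i j => [|n IH] i j; first by exists (U i j) => //; rewrite subrr; case: (vanish_ideal Pset).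
have /choice[c Hc] : forall k : 'I_N * 'I_N, exists c,
    ideal_pow (evker 1%:M) n c /\ vanish Pset (U k.1 k.2 - c).
  by move=> k; have [c] := IH k.1 k.2; exists c.
have [P0 PD PM] := ideal_pow_ideal (evker (1%:M : mat)) n.+1.
(* The approximations [c] of order n are put in place of u in -(x u + u x) / 2; the factors [D], the
   entries of x, gain one order. *)
exists ((- (2 : C)^-1)%:MP * \sum_k (D i k * c (k, j) + D k j * c (i, k))).
  apply: PM => //; elim/big_ind: _ => // k _.
  by apply: (PD); apply: ideal_powS => //; [case: (Hc (k, j))|case: (Hc (i, k))].
have cE k l y : Pset y -> ev y (c (k, l)) = ev y (U k l).
  by case: (Hc (k, l)) => _ /[apply]; rewrite rmorphB => /subr0_eq.
move=> y Py; rewrite rmorphB rmorphM /= evC rmorph_sum /=.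
under eq_bigr => k _ do rewrite rmorphD !rmorphM /= !cE // !ED !rmorphB /= !ev_Xvar !rmorph_nat !mulrBl.
have E : \sum_k y i k * ev y (U k j) + \sum_k y k j * ev y (U i k) = 0.
  have := congr1 (fun A : mat => A i j) (HU y Py).
  rewrite mxE [X in X + _]mxE [X in _ + X]mxE [RHS]mxE => H; rewrite -[RHS]H.
  by congr (_ + _); apply: eq_bigr => k _; rewrite mxE // mulrC.
rewrite big_split /= !sumrB.
have delta (F : 'I_N -> C) (l : 'I_N) : \sum_k (k == l)%:R * F k = F l.
  rewrite (bigD1 l) //= eqxx mul1r big1 ?addr0 // => k /negPf ->; exact: mul0r.
have -> : \sum_k (i == k)%:R * ev y (U k j) = ev y (U i j).
  by rewrite -(delta (fun k => ev y (U k j)) i); apply: eq_bigr => k _; rewrite eq_sym.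
rewrite (delta (fun k => ev y (U i k))).
move: E; set s1 := \sum_k _; set s2 := \sum_k _ => /eqP; rewrite addr_eq0 => /eqP ->.
by field.
Qed.

End Cartan.

Import numFieldNormedType.Exports.
Local Open Scope classical_set_scope.
Local Open Scope ring_scope.

(** * Tangent vectors and the chain rule *)

Section Calculus.
Variables (C : numClosedFieldType).

Definition der (f : C -> C) := derivable (f : C^o -> C^o) 0 1.
Definition dif (f : C -> C) : C := derive1 (V := C^o) f 0.

Lemma difE f : dif f = 'D_1 (f : C^o -> C^o) 0.
Proof. by rewrite /dif derive1E. Qed.

Lemma der_cst c : der (fun=> c).
Proof. exact: derivable_cst. Qed.

Lemma dif_cst c : dif (fun=> c) = 0.
Proof. by rewrite difE derive_cst. Qed.

Lemma derD f g : der f -> der g -> der (fun t => f t + g t).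
Proof. exact: derivableD. Qed.

Lemma difD f g : der f -> der g -> dif (fun t => f t + g t) = dif f + dif g.
Proof. by move=> df dg; rewrite !difE (deriveD df dg). Qed.

Lemma derM f g : der f -> der g -> der (fun t => f t * g t).
Proof. exact: derivableM. Qed.

Lemma difM f g : der f -> der g -> dif (fun t => f t * g t) = f 0 * dif g + g 0 * dif f.
Proof. by move=> df dg; rewrite !difE (deriveM df dg). Qed.

Lemma derV f : der f -> f 0 != 0 -> der (fun t => (f t)^-1).
Proof. by move=> df f0; apply: derivableV. Qed.

Lemma der_lin a b : der (fun t => a + t * b) /\ dif (fun t => a + t * b) = b.
Proof.
have did : der id by apply: derivable_id.
have db : der (fun=> b) by apply: der_cst.
have da : der (fun=> a) by apply: der_cst.
have dm : der (fun t => t * b) by apply: derM.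
split; first exact: derD.
rewrite difD // difM // !dif_cst mulr0 !add0r difE derive_id mulr1 //.
Qed.

Lemma der_sum (I : Type) (r : seq I) (P : pred I) (F : I -> C -> C) : (forall i, der (F i)) ->
  der (fun t => \sum_(i <- r | P i) F i t).
Proof.
move=> dF; elim: r => [|i r IH].
  by under eq_fun do rewrite big_nil; apply: der_cst.
under eq_fun do rewrite big_cons.
by case: (P i); [exact: (derD (dF i) IH)|exact: IH].
Qed.

Lemma der_prod (I : Type) (r : seq I) (P : pred I) (F : I -> C -> C) : (forall i, der (F i)) ->
  der (fun t => \prod_(i <- r | P i) F i t).
Proof.
move=> dF; elim: r => [|i r IH].
  by under eq_fun do rewrite big_nil; apply: der_cst.
under eq_fun do rewrite big_cons.
by case: (P i); [exact: (derM (dF i) IH)|exact: IH].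
Qed.

Variable N : nat.
Notation mat := 'M[C]_N.
Notation M := {mpoly C[N * N + 1]}.

Lemma der_ev (x v : mat) p : x \in unitmx -> der (fun t => ev (x + t *: v) p).
Proof.
move=> ux; elim/mpoly_var_ind: p => [c|i j||p q Hp Hq|p q Hp Hq].
- by under eq_fun do rewrite evC; apply: der_cst.
- under eq_fun do rewrite ev_Xvar !mxE.
  by case: (der_lin (x i j) (v i j)).
- under eq_fun do rewrite ev_Tvar; apply: derV.
    apply: der_sum => s; apply: derM; first exact: der_cst.
    by apply: der_prod => i; under eq_fun do rewrite !mxE; case: (der_lin (x i (perm.fun_of_perm s i)) (v i (perm.fun_of_perm s i))).
  by rewrite scale0r addr0 -unitmx_det.
- by under eq_fun do rewrite evD; exact: (derD Hp Hq).
- by under eq_fun do rewrite evM; exact: (derM Hp Hq).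
Qed.

(** A regular function is prescribed on invertible matrices only; this lets it be replaced by its
    polynomial when differentiating along a line. *)
Lemma near_unit (x v : mat) : x \in unitmx ->
  \forall t \near (0 : C^o), x + t *: v \in unitmx.
Proof.
move=> ux.
have dd : der (fun t => \det (x + t *: v)).
  have := @der_ev x v (\det (@Xvar C N)) ux.
  by under eq_fun do rewrite -det_map_mx map_Xvar.
have cc : {for (0 : C^o), continuous (fun t : C^o => \det (x + t *: v) : C^o)}.
  exact/differentiable_continuous/derivable1_diffP.
have d0 : \det (x + 0 *: v) != 0 by rewrite scale0r addr0 -unitmx_det.
by apply: filterS (cvgr_neq0 _ cc d0) => t; rewrite unitmx_det.
Qed.

End Calculus.

HB.lock Definition diffp (C : numClosedFieldType) (N : nat) (x v : 'M[C]_N)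
  (p : {mpoly C[N * N + 1]}) : C := dif (fun t => ev (x + t *: v) p).

Section Derivations.
Variables (C : numClosedFieldType) (N : nat).
Notation mat := 'M[C]_N.
Notation M := {mpoly C[N * N + 1]}.
Implicit Types (x y v w : mat) (p q : M) (A B : 'M[M]_N) (Z : mat -> Prop).

Lemma diffpE x v p : diffp x v p = dif (fun t => ev (x + t *: v) p).
Proof. by rewrite unlock. Qed.

Section Point.
Variables (x v : mat) (ux : x \in unitmx).

Lemma diffpC c : diffp x v c%:MP = 0.
Proof. by rewrite diffpE; under eq_fun do rewrite evC; apply: dif_cst. Qed.

Lemma diffpX i j : diffp x v (@Xvar C N i j) = v i j.
Proof.
rewrite diffpE; under eq_fun do rewrite ev_Xvar !mxE.
by case: (der_lin (x i j) (v i j)).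
Qed.

Lemma diffpD p q : diffp x v (p + q) = diffp x v p + diffp x v q.
Proof.
by rewrite !diffpE; under eq_fun do rewrite evD; apply: difD; apply: der_ev.
Qed.

Lemma diffpM p q : diffp x v (p * q) = ev x p * diffp x v q + ev x q * diffp x v p.
Proof.
rewrite !diffpE; under eq_fun do rewrite evM.
by rewrite difM ?scale0r ?addr0 //; apply: der_ev.
Qed.

End Point.

Lemma diffp_transl h k x v p :
  diffp (h *m x *m k) (h *m v *m k) p = diffp x v (transl h k p).
Proof.
rewrite !diffpE; congr dif; apply/funext => t; rewrite ev_transl.
by rewrite mulmxDr mulmxDl -scalemxAr -scalemxAl.
Qed.

Lemma dif_near F x v p : x \in unitmx -> (forall y, y \in unitmx -> F y = ev y p) ->
  dif (fun t => F (x + t *: v)) = diffp x v p.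
Proof.
move=> ux Fp; rewrite diffpE !difE; apply: (@near_eq_derive _ C^o C^o).
by apply: filterS (near_unit v ux) => t /Fp.
Qed.

(** The ring [M] does not impose T det(X) = 1; the last clause makes [D] factor through C[GL_N]. *)
Definition derivation_at (y : mat) (D : M -> C) :=
  [/\ (forall c, D c%:MP = 0), (forall p q, D (p + q) = D p + D q),
      (forall p q, D (p * q) = ev y p * D q + ev y q * D p) &
      D (@Tvar C N * \det (@Xvar C N)) = 0].

Lemma diffp_unit x v : x \in unitmx -> diffp x v (@Tvar C N * \det (@Xvar C N)) = 0.
Proof.
move=> ux; rewrite -(@dif_near (fun=> 1)) ?dif_cst // => y uy.
rewrite evM ev_Tvar -det_map_mx map_Xvar mulVf // -unitmx_det //.
Qed.

Lemma diffp_derivation x v : x \in unitmx -> derivation_at x (diffp x v).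
Proof.
move=> ux; split=> [c|p q|p q|]; [exact: diffpC|exact: diffpD|exact: diffpM|].
exact: diffp_unit.
Qed.

(** The last clause of [derivation_at] determines the value on [Tvar], since det is nonzero at [y].
    Linearity in the vector and the chain rule are then checked on matrix entries alone. *)
Lemma derivation_unique y D1 D2 : y \in unitmx -> derivation_at y D1 -> derivation_at y D2 ->
  (forall i j, D1 (@Xvar C N i j) = D2 (@Xvar C N i j)) -> forall p, D1 p = D2 p.
Proof.
move=> uy [C1 A1 M1 T1] [C2 A2 M2 T2] EX.
pose S p := D1 p = D2 p.
have SC c : S c%:MP by rewrite /S C1 C2.
have SD p q : S p -> S q -> S (p + q) by rewrite /S A1 A2 => -> ->.
have SM p q : S p -> S q -> S (p * q) by rewrite /S M1 M2 => -> ->.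
have Sdet : S (\det (@Xvar C N)).
  rewrite /determinant; elim/big_ind: _ => //; first exact: SC.
  move=> s _; apply: (SM).
    by case: (perm.odd_perm s); rewrite ?expr0 ?expr1 -?mpolyC1 // -mpolyCN.
  by apply: (big_ind S) => [||i _]; [rewrite -mpolyC1; apply: SC|exact: SM|apply: EX].
have ST : S (@Tvar C N).
  move: T1; rewrite -T2 M1 M2 Sdet => /addrI.
  by apply: mulfI; rewrite -det_map_mx map_Xvar -unitmx_det.
by elim/mpoly_var_ind.
Qed.

Lemma diffp_linear x (a : C) v w p : x \in unitmx ->
  diffp x (a *: v + w) p = a * diffp x v p + diffp x w p.
Proof.
move=> ux; have [C1 A1 M1 T1] := diffp_derivation v ux.
have [C2 A2 M2 T2] := diffp_derivation w ux.
apply: (derivation_unique ux (diffp_derivation _ ux)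
  (D2 := fun p => a * diffp x v p + diffp x w p)) => [|i j]; last by rewrite !diffpX !mxE.
split=> [c|q r|q r|]; first by rewrite C1 C2 mulr0 addr0.
- by rewrite A1 A2 mulrDr addrACA.
- by rewrite M1 M2 !mulrDr ![_ * (a * _)]mulrCA addrACA.
- by rewrite T1 T2 mulr0 addr0.
Qed.

Definition tan (Z : mat -> Prop) (x v : mat) := forall p, vanish Z p -> diffp x v p = 0.

Definition diffm (x v : mat) (A : 'M[M]_N) : mat := map_mx (diffp x v) A.

Lemma diffmE x v A i j : diffm x v A i j = diffp x v (A i j).
Proof. by rewrite mxE. Qed.

Lemma map_evE x (A : 'M[M]_N) i j : map_mx (ev x) A i j = ev x (A i j).
Proof. by rewrite mxE. Qed.

Lemma diffmX x v : diffm x v (@Xvar C N) = v.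
Proof. by apply/matrixP => i j; rewrite mxE diffpX. Qed.

Lemma diffmC x v (a : mat) : diffm x v (map_mx (@mpolyC _ C) a) = 0.
Proof. by apply/matrixP => i j; rewrite !mxE diffpC. Qed.

Lemma diffmM x v A B : x \in unitmx ->
  diffm x v (A *m B) = diffm x v A *m map_mx (ev x) B + map_mx (ev x) A *m diffm x v B.
Proof.
move=> ux; apply/matrixP => i j; rewrite !mxE.
have -> (F : 'I_N -> M) : diffp x v (\sum_k F k) = \sum_k diffp x v (F k).
  apply: (big_morph (diffp x v)); first exact: diffpD.
  by rewrite -mpolyC0 diffpC.
rewrite -big_split /=; apply: eq_bigr => k _; rewrite diffpM // addrC.
congr (_ + _); [|rewrite mulrC]; congr (_ * _); symmetry; by [apply: diffmE|apply: map_evE].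
Qed.

Lemma tan_eq Z x v p q : x \in unitmx -> tan Z x v -> (forall y, Z y -> ev y p = ev y q) ->
  diffp x v p = diffp x v q.
Proof.
move=> ux Zv Epq; have E : diffp x v (p + (-1)%:MP * q) = 0.
  by apply: Zv => y Zy; rewrite evD evM evC Epq // mulN1r subrr.
by move: E; rewrite diffpD // diffpM // evC diffpC mulr0 addr0 mulN1r; apply: subr0_eq.
Qed.

Lemma tan_eqm Z x v A B : x \in unitmx -> tan Z x v ->
  (forall y, Z y -> map_mx (ev y) A = map_mx (ev y) B) -> diffm x v A = diffm x v B.
Proof.
move=> ux Zv EAB; apply/matrixP => i j; rewrite !mxE; apply: (tan_eq ux Zv) => y /EAB.
by move=> /(congr1 (fun A : mat => A i j)); rewrite !mxE.
Qed.

(** The identity t det(h) = 1 is available on [Z] only; tangency of [v] to [Z] is what allows it to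
    be differentiated. *)
Lemma chain_rule Z x y v (h : 'M[M]_N) (t : M) p : x \in unitmx -> y \in unitmx -> Z x ->
  tan Z x v -> map_mx (ev x) h = y ->
  (forall z, Z z -> ev z t * \det (map_mx (ev z) h) = 1) ->
  diffp x v (subst h t p) = diffp y (diffm x v h) p.
Proof.
move=> ux uy Zx Zv Ey Et.
have Etx : ev x t = (\det y)^-1.
  have := Et _ Zx; rewrite Ey => E.
  have d0 : \det y != 0 by rewrite -unitmx_det.
  by apply: (mulIf d0); rewrite E mulVf.
have Eq q : ev x (subst h t q) = ev y q by apply: ev_subst.
apply: (derivation_unique uy (D1 := fun p => diffp x v (subst h t p)) _ (diffp_derivation _ uy)).
  split=> [c|q r|q r|].
  - by rewrite substC diffpC.
  - by rewrite rmorphD diffpD.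
  - by rewrite rmorphM (diffpM _ ux) 2!Eq.
  - rewrite -(diffpC x v 1) mpolyC1; apply: (tan_eq ux Zv) => z Zz.
    rewrite rmorphM /= subst_Tvar evM rmorph1 -(Et z Zz); congr (_ * _).
    by rewrite -!det_map_mx /= map_subst_Xvar.
by move=> i j; rewrite subst_Xvar diffpX diffmE.
Qed.

End Derivations.

(** * The infinitesimal involution *)

Section Lie.
Variables (C : numClosedFieldType) (N : nat).
Notation M := {mpoly C[N * N + 1]}.
Notation mat := 'M[C]_N.
Variables (G : mat -> Prop) (theta : mat -> mat) (Th : 'M[M]_N).
Hypothesis HG : zgroup G.
Hypothesis primeG : is_prime (vanish G).
Hypothesis ThE : forall x, G x -> map_mx (ev x) Th = theta x.
Hypothesis thetaG : forall x, G x -> G (theta x).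
Hypothesis thetaM : forall x y, G x -> G y -> theta (x *m y) = theta x *m theta y.
Hypothesis thetaK : forall x, G x -> theta (theta x) = x.
Implicit Types (x y g v xi eta : mat) (p q : M) (A B : 'M[M]_N).

Let G1 : G 1%:M. Proof. by case: HG. Qed.
Let GM x y : G x -> G y -> G (x *m y). Proof. by case: HG => _ _ H _; apply: H. Qed.
Let GV x : G x -> G (invmx x). Proof. by case: HG => _ _ _; apply. Qed.
Let GU x : G x -> x \in unitmx. Proof. exact: zgroup_unit. Qed.
Let U1 : (1%:M : mat) \in unitmx. Proof. exact: unitmx1. Qed.

Notation P := (Pset G theta).
Notation j := (jmap theta).

Definition lie xi := tan G 1%:M xi.
Definition dth xi := diffm 1%:M xi Th.
Definition psp xi := lie xi /\ dth xi = - xi.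

Let cM (a : mat) : 'M[M]_N := map_mx (@mpolyC _ C) a.

Lemma tan_left g xi : G g -> lie xi -> tan G g (g *m xi).
Proof.
move=> Gg Lxi p Hp.
have -> : diffp g (g *m xi) p = diffp (g *m 1%:M *m 1%:M) (g *m xi *m 1%:M) p.
  by rewrite !mulmx1.
rewrite diffp_transl; apply: Lxi => x Gx; rewrite ev_transl mulmx1; apply: Hp; exact: GM.
Qed.

Lemma lie_Ad g xi : G g -> lie xi -> lie (g *m xi *m invmx g).
Proof.
move=> Gg Lxi p Hp.
have -> : 1%:M = g *m 1%:M *m invmx g by rewrite mulmx1 mulmxV ?GU.
rewrite diffp_transl; apply: Lxi => x Gx; rewrite ev_transl; apply: Hp.
by apply: GM; [apply: GM|apply: GV].
Qed.

Lemma tan_lin Z x v a : x \in unitmx -> tan Z x v -> tan Z x (a *: v).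
Proof.
move=> ux Zv p Hp; have Z0 : tan Z x 0.
  move=> q _; rewrite diffpE; under eq_fun do rewrite scaler0 addr0; exact: dif_cst.
by rewrite -[a *: v]addr0 diffp_linear // Zv // Z0 // mulr0 addr0.
Qed.

Lemma diffm_linear x a v w A : x \in unitmx ->
  diffm x (a *: v + w) A = a *: diffm x v A + diffm x w A.
Proof.
move=> ux; apply/matrixP => k l; rewrite [RHS]mxE [X in _ = X + _]mxE !diffmE.
exact: diffp_linear.
Qed.

Lemma dth_linear a xi eta : dth (a *: xi + eta) = a *: dth xi + dth eta.
Proof. exact: diffm_linear. Qed.

Lemma dth0 : dth 0 = 0.
Proof. by have := dth_linear 1 0 0; rewrite !scale1r addr0 => /eqP; rewrite -subr_eq0 opprD addrA subrr sub0r oppr_eq0 => /eqP. Qed.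

Lemma dthZ a xi : dth (a *: xi) = a *: dth xi.
Proof. by have := dth_linear a xi 0; rewrite dth0 !addr0. Qed.

Lemma map_transl h k A x : map_mx (ev x) (map_mx (transl h k) A) = map_mx (ev (h *m x *m k)) A.
Proof. by apply/matrixP => r c; rewrite !mxE /= ev_transl. Qed.

Lemma diffm_transl h k x v A :
  diffm (h *m x *m k) (h *m v *m k) A = diffm x v (map_mx (transl h k) A).
Proof. by apply/matrixP => r c; rewrite !mxE diffp_transl. Qed.

Lemma diffm_Th g xi : G g -> lie xi -> diffm g (g *m xi) Th = theta g *m dth xi.
Proof.
move=> Gg Lxi.
have -> : diffm g (g *m xi) Th = diffm (g *m 1%:M *m 1%:M) (g *m xi *m 1%:M) Th.
  by rewrite !mulmx1.
rewrite diffm_transl (@tan_eqm _ _ G _ _ _ (cM (theta g) *m Th)) //.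
  by rewrite diffmM // diffmC mul0mx add0r matC_ev.
move=> x Gx; rewrite map_transl mulmx1 map_mxM matC_ev !ThE ?thetaM //; exact: GM.
Qed.

Lemma dth_Ad g xi : G g -> lie xi ->
  dth (g *m xi *m invmx g) = theta g *m dth xi *m invmx (theta g).
Proof.
move=> Gg Lxi; rewrite /dth.
have -> : diffm 1%:M (g *m xi *m invmx g) Th =
    diffm (g *m 1%:M *m invmx g) (g *m xi *m invmx g) Th.
  by rewrite mulmx1 mulmxV ?GU.
rewrite diffm_transl (@tan_eqm _ _ G _ _ _ (cM (theta g) *m Th *m cM (invmx (theta g)))) //.
  by rewrite !diffmM // !diffmC mul0mx add0r mulmx0 addr0 !matC_ev.
have GVg := GV Gg.
move=> x Gx; rewrite map_transl !map_mxM !matC_ev !ThE //; last by do 2 apply: GM => //.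
by rewrite thetaM ?thetaM // ?(thetaV HG thetaG thetaM) //; apply: GM.
Qed.

(** [dth] carries Ad(theta g) xi to -Ad(g) xi, so the assumed equality of the two conjugates puts
    the vector in the -1-eigenspace. *)
Lemma psp_Ad_theta g xi : G g -> psp xi ->
  g *m xi *m invmx g = theta g *m xi *m invmx (theta g) -> psp (theta g *m xi *m invmx (theta g)).
Proof.
move=> Gg [Lxi Dxi] E; split; first by apply: lie_Ad => //; apply: thetaG.
by rewrite (dth_Ad (thetaG Gg) Lxi) thetaK // Dxi mulmxN mulNmx E.
Qed.

Let ThV : 'M[M]_N := map_mx (@invsubst C N) Th.

Lemma map_ThV x : G x -> map_mx (ev x) ThV = invmx (theta x).
Proof.
move=> Gx; rewrite -(thetaV HG thetaG thetaM) // -ThE; last exact: GV.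
by apply/matrixP => r c; rewrite !mxE /= ev_invsubst // GU.
Qed.

Lemma diffm_ThV g xi : G g -> lie xi -> diffm g (g *m xi) ThV = - (dth xi *m invmx (theta g)).
Proof.
move=> Gg Lxi; have ug := GU Gg; have ut := GU (thetaG Gg).
have : diffm g (g *m xi) (Th *m ThV) = diffm g (g *m xi) (cM 1%:M).
  apply: (tan_eqm (Z := G) ug (tan_left Gg Lxi)) => x Gx.
  by rewrite map_mxM ThE // map_ThV // matC_ev mulmxV // GU //; apply: thetaG.
rewrite diffmM // diffmC diffm_Th // ThE // map_ThV // => /eqP.
rewrite addrC addr_eq0 => /eqP E.
by rewrite -[LHS](mulKmx ut) E mulmxN -!mulmxA mulKmx.
Qed.

Lemma diffm_J g xi : G g -> lie xi ->
  diffm g (g *m xi) (Jmat Th) = g *m (xi - dth xi) *m invmx (theta g).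
Proof.
move=> Gg Lxi; have ug := GU Gg.
rewrite /Jmat -/ThV diffmM // diffmX map_ThV // map_Xvar diffm_ThV //.
by rewrite mulmxN mulmxBr mulmxBl !mulmxA.
Qed.

Lemma diffp_j g xi p : G g -> lie xi ->
  diffp g (g *m xi) (jsubst Th p) = diffp (j g) (g *m (xi - dth xi) *m invmx (theta g)) p.
Proof.
move=> Gg Lxi; rewrite -diffm_J //; apply: (chain_rule (Z := G)) => //.
- exact: GU.
- by apply: GU; apply: (jmapG HG thetaG).
- exact: tan_left.
- exact: (map_Jmat HG ThE thetaG thetaM).
- move=> x Gx; rewrite evM ev_Tvar -det_map_mx ThE // (map_Jmat HG ThE thetaG thetaM) //.
  have := GU Gx; have := GU (thetaG Gx); rewrite /jmap det_mulmx det_inv !unitmx_det => dt dx.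
  by field; rewrite dt dx.
Qed.

(** Differentiating theta(y) y = 1, valid on P, along y eta gives y^-1 (y eta - eta y) = 0. *)
Lemma tanP_commute y eta : P y -> psp eta -> tan P y (y *m eta) -> y *m eta = eta *m y.
Proof.
move=> Py [Leta Deta] Ht; have Gy := PsetG HG thetaG Py; have uy := GU Gy.
have thy : theta y = invmx y by apply: (theta_Pset HG thetaG thetaM thetaK).
have : diffm y (y *m eta) (Th *m @Xvar C N) = diffm y (y *m eta) (cM 1%:M).
  apply: (tan_eqm uy Ht) => x Px; have Gx := PsetG HG thetaG Px.
  rewrite map_mxM ThE // map_Xvar matC_ev (theta_Pset HG thetaG thetaM thetaK) // mulVmx //.
  exact: GU.
rewrite diffmM // diffmC diffm_Th // Deta diffmX map_Xvar ThE // thy => /eqP.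
rewrite -mulmxA -mulmxDr mulNmx => /eqP E.
have := congr1 (mulmx y) E; rewrite mulmx0 mulKVmx // => /eqP.
by rewrite addrC subr_eq0 => /eqP.
Qed.

(* The orbit map g |-> g y theta(g)^-1 sends eta to eta y + y eta. *)
Lemma commute_tanP y eta : P y -> psp eta -> y *m eta = eta *m y -> tan P y (y *m eta).
Proof.
move=> Py [Leta Deta] E p Hp; have Gy := PsetG HG thetaG Py; have uy := GU Gy.
have th1 := theta1 HG thetaG thetaM.
pose h : 'M[M]_N := @Xvar C N *m cM y *m ThV.
pose t : M := @Tvar C N * ((\det y)^-1)%:MP * \det Th.
have Eh x : G x -> map_mx (ev x) h = x *m y *m invmx (theta x).
  by move=> Gx; rewrite !map_mxM map_Xvar matC_ev map_ThV.
have Et x : G x -> ev x t * \det (map_mx (ev x) h) = 1.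
  move=> Gx; rewrite Eh // !evM ev_Tvar evC -det_map_mx ThE // !det_mulmx det_inv.
  have := GU Gx; have := GU (thetaG Gx); rewrite !unitmx_det => dt dx.
  by move: uy; rewrite unitmx_det => dy; field; rewrite dt dx dy.
have E1 : map_mx (ev 1%:M) h = y by rewrite Eh // th1 invmx1 mulmx1 mul1mx.
have := chain_rule p U1 uy G1 Leta E1 Et.
rewrite Leta; last first.
  move=> x Gx; rewrite (@ev_subst _ _ _ _ _ (x *m y *m invmx (theta x))) ?Eh //.
    apply: Hp; have [g Gg ->] := Py; exists (x *m g); first exact: GM.
    by rewrite (jmap_twist HG thetaG thetaM).
  have := Et _ Gx; rewrite Eh // => E2.
  have d0 : \det (x *m y *m invmx (theta x)) != 0.
    by apply/eqP => d0; move: E2; rewrite d0 mulr0 => /esym/eqP; rewrite oner_eq0.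
  by apply: (mulIf d0); rewrite E2 mulVf.
have -> : diffm 1%:M eta h = 2 *: (y *m eta).
  have D1 : diffm 1%:M eta ThV = eta.
    have := diffm_ThV G1 Leta; rewrite mul1mx => ->.
    by rewrite Deta mulNmx opprK th1 invmx1 mulmx1.
  rewrite /h !diffmM // diffmX diffmC mulmx0 addr0 D1 map_mxM map_Xvar matC_ev map_ThV // th1.
  by rewrite invmx1 mulmx1 mul1mx -E scaler_nat mulr2n.
move=> E3; have -> : y *m eta = 2^-1 *: (2 *: (y *m eta)) + 0.
  by rewrite addr0 scalerA mulVf ?scale1r // pnatr_eq0.
rewrite diffp_linear // -E3 mulr0 add0r.
rewrite diffpE; under eq_fun do rewrite scaler0 addr0; exact: dif_cst.
Qed.

Definition polymx (Z : mat -> Prop) (f : mat -> mat) :=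
  exists A, forall x, Z x -> map_mx (ev x) A = f x.

Lemma polymx_descent f : polymx G f ->
  (forall g k, G g -> G k -> theta k = k -> f (g *m k) = f g) ->
  exists A, forall g, G g -> f g = map_mx (ev (j g)) A.
Proof.
move=> [F HF] finv.
have : forall rc : 'I_N * 'I_N, exists p, forall g, G g -> f g rc.1 rc.2 = ev (j g) p.
  move=> [r c]; apply: (cartan_descent HG primeG ThE thetaG thetaM thetaK).
    by exists (F r c) => x Gx; rewrite -HF // mxE.
  by move=> g k Gg Gk Hk; rewrite finv.
move=> /choice[A HA]; exists (\matrix_(r, c) A (r, c)) => g Gg.
by apply/matrixP => r c; rewrite [RHS]mxE [X in ev _ X]mxE (HA (r, c)).
Qed.

(** * From a horizontally flat Phi to Psi *)

Section FlatToPsi.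
Variable Phi : mat -> mat.
Hypothesis Phi_reg : polymx G Phi.
Hypothesis Phi_p : forall g, G g -> psp (Phi g).
Hypothesis Phi_eq : forall g k k', G g -> G k /\ theta k = k -> G k' /\ theta k' = k' ->
  Phi (k *m g *m k') = invmx k' *m Phi g *m k'.
Hypothesis Phi_flat : forall y, P y -> tan P y (y *m Phi y).

Let Phi_right g k : G g -> G k -> theta k = k -> Phi (g *m k) = invmx k *m Phi g *m k.
Proof.
move=> Gg Gk Hk; rewrite -[in LHS](mul1mx g); apply: Phi_eq => //.
by split=> //; apply: (theta1 HG thetaG thetaM).
Qed.

Let conj_id (k D B Bi : mat) (u : k \in unitmx) :
  B *m k *m (invmx k *m D *m k) *m (invmx k *m Bi) = B *m D *m Bi.
Proof. by rewrite !mulmxA mulmxK // mulmxK. Qed.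

Lemma flat_Ad g : G g -> g *m Phi g *m invmx g = theta g *m Phi g *m invmx (theta g).
Proof.
pose f x := x *m Phi x *m invmx x - theta x *m Phi x *m invmx (theta x).
have fpoly : polymx G f.
  have [F HF] := Phi_reg.
  exists (@Xvar C N *m F *m (@Tvar C N *: \adj (@Xvar C N)) - Th *m F *m ThV) => x Gx.
  rewrite map_mxB !map_mxM map_mxZ map_mx_adj map_Xvar /= ev_Tvar HF // ThE // map_ThV //.
  by rewrite /f [in RHS](_ : invmx x = (\det x)^-1 *: \adj x) // {1}/invmx GU.
have finv g0 k : G g0 -> G k -> theta k = k -> f (g0 *m k) = f g0.
  move=> Gg Gk Hk; have u := GU Gk; have ug := GU Gg; have ut := GU (thetaG Gg).
  by rewrite /f thetaM // Hk Phi_right // !invmxM // !conj_id.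
have [A HA] := polymx_descent fpoly finv.
have A0 y : P y -> map_mx (ev y) A = 0.
  move=> Py; apply/matrixP => r c; rewrite mxE [RHS]mxE; move: y Py.
  apply: (squares_dense HG primeG ThE thetaG thetaM thetaK) => y Py.
  have Gy := PsetG HG thetaG Py; have uy := GU Gy.
  rewrite -(jmap_Pset HG thetaG thetaM thetaK) //.
  have := congr1 (fun B : mat => B r c) (HA y Gy); rewrite [RHS]mxE => <-.
  have E := tanP_commute Py (Phi_p Gy) (Phi_flat Py).
  rewrite /f (theta_Pset HG thetaG thetaM thetaK) // invmxK.
  by rewrite E mulmxK // -mulmxA -E mulKmx // subrr mxE.
move=> Gg; apply/eqP; rewrite -subr_eq0; apply/eqP; rewrite -/(f g) HA // A0 //.
by exists g.
Qed.

Lemma flat_Psi : exists A, forall g, G g ->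
  map_mx (ev (j g)) A = 2 *: (theta g *m Phi g *m invmx (theta g)).
Proof.
have [F HF] := Phi_reg.
have [||A HA] := @polymx_descent (fun g => 2 *: (theta g *m Phi g *m invmx (theta g))).
- exists (2%:MP *: (Th *m F *m ThV)) => x Gx.
  by rewrite map_mxZ !map_mxM /= evC ThE // HF // map_ThV.
- move=> g k Gg Gk Hk; have u := GU Gk; have ut := GU (thetaG Gg).
  by rewrite thetaM // Hk Phi_right // invmxM // conj_id.
by exists A => g Gg; rewrite HA.
Qed.

End FlatToPsi.

(** * From a flat Psi back to Phi *)

Section PsiToFlat.
Variable Psi : mat -> mat.
Hypothesis Psi_reg : polymx P Psi.
Hypothesis Psi_p : forall y, P y -> psp (Psi y).
Hypothesis Psi_eq : forall k y, G k /\ theta k = k -> P y ->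
  Psi (k *m y *m invmx k) = k *m Psi y *m invmx k.
Hypothesis Psi_fix : forall y, P y -> y *m Psi y *m invmx y = Psi y.

(** Obtained by solving Psi(j g) = 2 Ad(theta g) Phi(g) for Phi. *)
Definition Phi_of g := 2^-1 *: (invmx (theta g) *m Psi (j g) *m theta g).

Let Pj g : G g -> P (j g). Proof. by exists g. Qed.

Lemma Phi_of_reg : polymx G Phi_of.
Proof.
have [F HF] := Psi_reg; exists ((2^-1)%:MP *: (ThV *m map_mx (jsubst Th) F *m Th)) => x Gx.
rewrite map_mxZ !map_mxM /= evC ThE // map_ThV // /Phi_of -HF; last exact: Pj.
congr (_ *: (_ *m _ *m _)); apply/matrixP => r c; rewrite !mxE /=.
exact: (ev_jsubst HG ThE thetaG thetaM).
Qed.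

Lemma Phi_of_twist g : G g -> invmx (theta g) *m Psi (j g) *m theta g = invmx g *m Psi (j g) *m g.
Proof.
move=> Gg; have ug := GU Gg; have ut := GU (thetaG Gg).
have := Psi_fix (Pj Gg); move: (Psi (j g)) => W.
rewrite /jmap invmxM ?unitmx_inv // invmxK => E.
by rewrite -[in RHS]E !mulmxA mulVmx // mul1mx mulmxKV.
Qed.

Lemma Phi_of_p g : G g -> psp (Phi_of g).
Proof.
move=> Gg; have Gt := thetaG Gg; have GVt := GV Gt; have [LW DW] := Psi_p (Pj Gg).
split; first by apply: tan_lin => //; have := lie_Ad GVt LW; rewrite invmxK.
rewrite dthZ -scalerN; congr (_ *: _).
have := dth_Ad GVt LW; rewrite (thetaV HG thetaG thetaM) // thetaK // !invmxK => ->.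
by rewrite DW Phi_of_twist // mulmxN mulNmx.
Qed.

Lemma Phi_of_eq g k k' : G g -> G k /\ theta k = k -> G k' /\ theta k' = k' ->
  Phi_of (k *m g *m k') = invmx k' *m Phi_of g *m k'.
Proof.
move=> Gg [Gk Hk] [Gk' Hk']; have uk := GU Gk; have uk' := GU Gk'.
have ut := GU (thetaG Gg); have ug := GU Gg.
have Gkg : G (k *m g) by apply: GM.
have Ej : j (k *m g *m k') = k *m j g *m invmx k.
  rewrite /jmap !thetaM // Hk Hk' !invmxM ?unitmx_mul ?uk //.
  by rewrite !mulmxA mulmxK.
rewrite /Phi_of Ej Psi_eq //; last exact: Pj.
rewrite !thetaM // Hk Hk' !invmxM ?unitmx_mul ?uk // -scalemxAr -scalemxAl; congr (_ *: _).
by rewrite !mulmxA mulmxKV // mulmxKV.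
Qed.

Lemma Phi_of_flat y : P y -> tan P y (y *m Phi_of y).
Proof.
move=> Py; have Gy := PsetG HG thetaG Py; have uy := GU Gy.
have thP z : P z -> theta z = invmx z by apply: (theta_Pset HG thetaG thetaM thetaK).
have jP z : P z -> j z = z *m z by apply: (jmap_Pset HG thetaG thetaM thetaK).
have [F HF] := Psi_reg.
(* Represents y |-> Psi(y^2) on P, because j squares the points of P. *)
pose W : 'M[M]_N := map_mx (jsubst Th) F.
have HW z : P z -> map_mx (ev z) W = Psi (z *m z).
  move=> Pz; have Gz := PsetG HG thetaG Pz; rewrite -jP // -HF; last exact: Pj.
  by apply/matrixP => r c; rewrite !mxE /=; apply: (ev_jsubst HG ThE thetaG thetaM).
have comm : y *m Psi (y *m y) = Psi (y *m y) *m y.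
  apply/eqP; rewrite -subr_eq0; apply/eqP.
  have EU z : P z -> map_mx (ev z) (@Xvar C N *m W - W *m @Xvar C N) =
      z *m Psi (z *m z) - Psi (z *m z) *m z.
    by move=> Pz; rewrite map_mxB !map_mxM map_Xvar HW.
  rewrite -EU //; apply: (anticommuting_vanish HG primeG ThE thetaG thetaM) Py => z Pz.
  rewrite EU //; have Gz := PsetG HG thetaG Pz; have uz := GU Gz.
  have := Psi_fix (Pj Gz); rewrite jP // => E.
  have {}E : z *m z *m Psi (z *m z) = Psi (z *m z) *m (z *m z).
    by rewrite -[in RHS]E mulmxKV // unitmx_mul uz.
  by rewrite mulmxBr mulmxBl !mulmxA E -!mulmxA addrA subrK subrr.
have PW : Phi_of y = 2^-1 *: Psi (y *m y).
  by rewrite /Phi_of jP // thP // invmxK comm mulmxK.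
apply: commute_tanP => //; first exact: Phi_of_p.
by rewrite PW -scalemxAr comm scalemxAl.
Qed.

Lemma Phi_of_diff g : G g ->
  g *m (Phi_of g - dth (Phi_of g)) *m invmx (theta g) = j g *m Psi (j g).
Proof.
move=> Gg; have ut := GU (thetaG Gg); have [_ ->] := Phi_of_p Gg.
rewrite opprK -mulr2n -scaler_nat /Phi_of scalerA mulfV ?pnatr_eq0 // scale1r.
by rewrite !mulmxA mulmxK.
Qed.

End PsiToFlat.
End Lie.

Local Open Scope complex_scope.

(** * Regular functions as polynomials *)

Section RegularFunctions.
Variables (C : numClosedFieldType) (N : nat).
Notation M := {mpoly C[N * N + 1]}.
Notation mat := 'M[C]_N.

Definition lift_poly (p : {mpoly C[N * N]}) : M :=
  mmap (@mpolyC _ C) (fun k => 'X_(lshift 1 k)) p.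

Lemma ev_lift (x : mat) p : ev x (lift_poly p) = p.@[mxvec x 0].
Proof.
rewrite evE /lift_poly; elim/mpoly_gen_ind: p => [c|k|p q Hp Hq|p q Hp Hq].
- by rewrite mmapC !mevalC.
- rewrite mmapX mmap1U !mevalXU; case/mxvec_indexP: k => r s.
  by rewrite /pt assign_index mxvecE.
- by rewrite mmapD !mevalD Hp Hq.
- by rewrite rmorphM !mevalM Hp Hq.
Qed.

Lemma fraction_of_poly (p : M) : exists (q : {mpoly C[N * N]}) (m : nat),
  forall x : mat, x \in unitmx -> ev x p = q.@[mxvec x 0] / (\det x) ^+ m.
Proof.
have [d Hd] : exists d : {mpoly C[N * N]}, forall x : mat, d.@[mxvec x 0] = \det x.
  exists (\det (\matrix_(r, s) 'X_(mxvec_index r s))) => x; rewrite -det_map_mx /=.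
  by congr (\det _); apply/matrixP => r s; rewrite !mxE mevalXU mxvecE.
elim/mpoly_var_ind: p => [c|r s||p q [p' [m Hp]] [q' [n Hq]]|p q [p' [m Hp]] [q' [n Hq]]].
- by exists c%:MP, 0%N => x _; rewrite evC mevalC expr0 divr1.
- exists 'X_(mxvec_index r s), 0%N => x _.
  by rewrite ev_Xvar mevalXU mxvecE expr0 divr1.
- by exists 1, 1%N => x _; rewrite ev_Tvar meval1 expr1 div1r.
- exists (p' * d ^+ n + q' * d ^+ m), (m + n)%N => x ux; rewrite evD Hp // Hq //.
  rewrite mevalD !mevalM !rmorphXn /= !Hd exprD.
  have d0 : \det x != 0 by rewrite -unitmx_det.
  by field; rewrite !expf_neq0.
- exists (p' * q'), (m + n)%N => x ux; rewrite evM Hp // Hq // mevalM exprD.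
  by rewrite invfM mulrACA.
Qed.

(** [regular_GL] over an arbitrary closed field; at [R[i]] the two are convertible. *)
Definition regularC (F : mat -> C) := exists (p : {mpoly C[N * N]}) (m : nat),
  forall x, x \in unitmx -> F x = p.@[mxvec x 0] / (\det x) ^+ m.

Lemma regularCP F : regularC F <-> exists p : M, forall x, x \in unitmx -> F x = ev x p.
Proof.
split=> [[p [m Hp]]|[p Hp]].
  exists (lift_poly p * @Tvar C N ^+ m) => x ux.
  by rewrite evM rmorphXn /= ev_Tvar ev_lift Hp // exprVn.
have [q [m Hq]] := fraction_of_poly p.
by exists q, m => x ux; rewrite Hp // Hq.
Qed.

Definition closedC (Z : mat -> Prop) := exists I : {mpoly C[N * N]} -> Prop,
  forall x, Z x <-> x \in unitmx /\ forall p, I p -> p.@[mxvec x 0] = 0.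

Lemma closedCP Z : closedC Z <-> zclosed Z.
Proof.
split=> [[I HI]|[I HI]].
  exists (fun p => exists2 q, I q & p = lift_poly q) => x; rewrite HI; split.
    by move=> [ux H]; split=> // _ [q Iq ->]; rewrite ev_lift H.
  by move=> [ux H]; split=> // q Iq; rewrite -ev_lift; apply: H; exists q.
(* The equations are the numerators of the elements of [I], once powers of the determinant are
   cleared. *)
exists (fun q => exists p m, I p /\ forall x, x \in unitmx -> ev x p = q.@[mxvec x 0] / (\det x) ^+ m).
move=> x; rewrite HI; split=> [[ux H]|[ux H]]; split=> //.
  move=> q [p [m [Ip Hq]]]; have := H p Ip; rewrite Hq // => /eqP.
  rewrite mulf_eq0 invr_eq0 expf_eq0 -[\det x == 0]negbK -unitmx_det ux andbF orbF.
  by move/eqP.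
move=> p Ip; have [q [m Hq]] := fraction_of_poly p.
by rewrite Hq // H ?mul0r //; exists p, m.
Qed.

End RegularFunctions.

Section Bridge.
Variables (R : realType) (N : nat).
Notation C := R[i].
Notation CC := (R[i] : numClosedFieldType).
Notation mat := 'M[C]_N.
Notation M := {mpoly CC[N * N + 1]}.

Lemma regular_GLP (F : mat -> C) :
  regular_GL F <-> exists p : M, forall x : mat, x \in unitmx -> F x = ev x p.
Proof. exact: (@regularCP CC N F). Qed.

Lemma zariski_closedP (Z : set mat) : zariski_closed Z <-> zclosed (Z : 'M[CC]_N -> Prop).
Proof.
rewrite -(@closedCP CC N Z); split=> [[I ->]|[I HI]]; first by exists I.
by exists I; apply/seteqP; split=> x; rewrite /= HI.
Qed.

Lemma zconnectedP (Z : set mat) : zariski_connected Z -> zconnected (Z : 'M[CC]_N -> Prop).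
Proof.
move=> [_ HZ] A B cA cB AB dAB.
have /zariski_closedP cA' : zclosed (A : set mat) by [].
have /zariski_closedP cB' : zclosed (B : set mat) by [].
have [||H|H] := HZ A B cA' cB'.
- by apply/seteqP; split=> x; apply AB.
- by apply/seteqP; split=> x //=; apply: dAB.
- by left=> x; rewrite H; apply.
- by right=> x; rewrite H; apply.
Qed.

Lemma closed_subgroupP (G : set mat) : closed_subgroup G -> zgroup (G : 'M[CC]_N -> Prop).
Proof. by move=> [/zariski_closedP ? ? ? ?]; split. Qed.

Section On.
Variables (S : set mat) (SU : forall x, S x -> x \in unitmx).

Lemma regular_onP f : regular_on S f <-> exists p : M, forall x, S x -> f x = ev x p.
Proof.
split=> [[F /regular_GLP[p Hp] fF]|[p Hp]].
  by exists p => x Sx; rewrite fF ?inE // Hp // SU.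
exists (fun x => ev x p); first by apply/regular_GLP; exists p.
by move=> x; rewrite inE => /Hp.
Qed.

Lemma regular_mapP Phi : regular_map S Phi <-> polymx (S : 'M[CC]_N -> Prop) Phi.
Proof.
split=> [H|[A HA] r s]; last first.
  by apply/regular_onP; exists (A r s) => x Sx; rewrite -HA // mxE.
have : forall rs : 'I_N * 'I_N, exists p : M, forall x, S x -> Phi x rs.1 rs.2 = ev x p.
  by move=> rs; apply/regular_onP; apply: H.
move=> /choice[A HA]; exists (\matrix_(r, s) A (r, s)) => x Sx.
by apply/matrixP => r s; rewrite mxE [X in ev _ X]mxE -HA.
Qed.

Lemma ddt0P F (x v : mat) (p : M) : x \in unitmx ->
  (forall y : mat, y \in unitmx -> F y = ev y p) -> ddt0 F x v = diffp x v p.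
Proof. exact: (@dif_near CC N F x v p). Qed.

Lemma tangentP (x v : mat) : S x -> (tangent S x v <-> tan (S : 'M[CC]_N -> Prop) x v).
Proof.
move=> Sx; split=> H.
  move=> p Hp; rewrite -(@ddt0P (fun y => ev y p)) ?SU //; apply: H => //.
  by apply/regular_GLP; exists p.
move=> F /regular_GLP[p Hp] F0; rewrite (ddt0P _ _ Hp) ?SU //; apply: H => y Sy.
by rewrite -Hp ?SU // F0.
Qed.

Lemma ddt0_onP f (x v : mat) (p : M) : S x -> tan (S : 'M[CC]_N -> Prop) x v ->
  (forall y, S y -> f y = ev y p) -> ddt0_on S f x v = diffp x v p.
Proof.
move=> Sx tv Hp; rewrite /ddt0_on /extension; case: xgetP => [F _ [/regular_GLP[q Hq] fF]|/(_ (fun y => ev y p))].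
  rewrite (ddt0P _ _ Hq) ?SU //; apply: (tan_eq (SU Sx) tv) => y Sy.
  by rewrite -Hq ?SU // -fF ?inE // Hp.
case; split; first by apply/regular_GLP; exists p.
by move=> y; rewrite inE => /Hp.
Qed.

End On.

End Bridge.

(** * Horizontal flatness *)

Lemma half_double (F : numFieldType) n (A : 'M[F]_n) : 2^-1 *: (A + A) = A.
Proof. by rewrite -mulr2n -[A *+ 2]scaler_nat scalerA mulVf ?scale1r // pnatr_eq0. Qed.

Lemma addmx_self (F : numFieldType) n (A : 'M[F]_n) : A + A = 2 *: A.
Proof. by rewrite -mulr2n scaler_nat. Qed.

Section Main.
Variables (R : realType) (N : nat).
Notation CC := (R[i] : numClosedFieldType).
Notation mat := 'M[CC]_N.
Notation M := {mpoly CC[N * N + 1]}.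
Variables (G : set 'M[R[i]]_N) (theta : 'M[R[i]]_N -> 'M[R[i]]_N).
Variable (X : ('M[R[i]]_N -> R[i]) -> 'M[R[i]]_N -> R[i]).
Hypothesis X_inv : invariant_field G theta X.
Variable Th : 'M[M]_N.
Let Gp : mat -> Prop := G.
Hypothesis HG : zgroup Gp.
Hypothesis primeG : is_prime (vanish Gp).
Hypothesis ThE : forall x : mat, Gp x -> map_mx (ev x) Th = theta x.
Hypothesis thetaG : forall x : mat, Gp x -> Gp (theta x).
Hypothesis thetaM : forall x y : mat, Gp x -> Gp y -> theta (x *m y) = theta x *m theta y.
Hypothesis thetaK : forall x : mat, Gp x -> theta (theta x) = x.

Notation P := (cartanP G theta).
Notation j := (cartan theta).

Let G1 : Gp 1%:M. Proof. by case: HG. Qed.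
Let GU x : Gp x -> x \in unitmx. Proof. exact: zgroup_unit. Qed.

Lemma cartanPE : (P : mat -> Prop) = Pset Gp theta.
Proof.
apply/funext => y; apply/propext; split; first by move=> [g Gg <-]; exists g.
by move=> [g Gg ->]; exists g.
Qed.

Lemma cartanP_unit y : P y -> y \in unitmx.
Proof.
have : P y = Pset Gp theta y by rewrite -cartanPE.
by move=> -> /(PsetG HG thetaG)/GU.
Qed.

Lemma pspaceP (xi : mat) : pspace G theta xi <-> psp Gp Th xi.
Proof.
have E : lie Gp xi -> dtheta G theta xi = dth Th xi.
  move=> Lxi; apply/matrixP => r c; rewrite mxE [RHS]mxE.
  by apply: (ddt0_onP (S := G) GU G1 Lxi) => x Gx; rewrite -ThE // mxE.
have L : liealg G xi <-> lie Gp xi by apply: (tangentP GU).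
split=> [[/L Lxi Dxi]|[Lxi Dxi]]; split=> //.
- by rewrite -E.
- exact/L.
- by rewrite E.
Qed.

Lemma PsetP (y : mat) : Pset Gp theta y -> P y.
Proof. by rewrite -cartanPE. Qed.

Lemma jP (g : mat) : Gp g -> P (j g).
Proof. by exists g. Qed.

Lemma regular_GK_descent f : regular_GK G theta f ->
  exists p : M, forall g : mat, Gp g -> f g = ev (jmap theta g) p.
Proof.
move=> [/(regular_onP GU) fp finv].
apply: (cartan_descent HG primeG ThE thetaG thetaM thetaK) => //.
by move=> g k Gg Gk Hk; apply: finv.
Qed.

Lemma regular_GK_comp f : regular_on P f -> regular_GK G theta (f \o j).
Proof.
move=> /(regular_onP cartanP_unit)[p Hp]; split.
  apply/(regular_onP GU); exists (jsubst Th p) => g Gg /=.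
  by rewrite (ev_jsubst HG ThE thetaG thetaM) // Hp //; apply: jP.
move=> g k Gg [Gk Hk] /=; congr f.
have uk := GU Gk; have ut := GU (thetaG Gg).
rewrite /cartan thetaM // Hk (_ : invmx (theta g *m k) = invmx k *m invmx (theta g)).
  by rewrite mulmxA mulmxK.
exact: (@invmxM CC).
Qed.

(** X (f \o j) descends to P by [cartan_descent], so the [xget] behind [cartan_push] returns a
    genuine preimage and not its default. *)
Lemma cartan_pushE f g : regular_on P f -> Gp g -> cartan_push G theta X f (j g) = X (f \o j) g.
Proof.
move=> /regular_GK_comp/(field_regular X_inv)/regular_GK_descent[p Hp] Gg.
rewrite /cartan_push /cartan_pullback_inv.
case: xgetP => [F _ [_ FX]|/(_ (fun y => ev (y : mat) p))].
  by have := FX g; rewrite inE => /(_ Gg).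
case; split.
  by apply/(regular_onP cartanP_unit); exists p.
by move=> h; rewrite inE => Gh; rewrite /= Hp.
Qed.

(** For such [xi], theta_y xi = -Ad(y^-1) xi = -xi: the vector already lies in p_y. *)
Lemma pi_at_fix y xi : y \in unitmx -> pspace G theta xi -> Ad y xi = xi -> pi_at G theta y xi = xi.
Proof.
move=> uy [_ Dxi] E; rewrite /pi_at /theta_at Dxi /Ad invmxK.
have -> : invmx y *m - xi *m y = - xi.
  by rewrite mulmxN mulNmx -{1}E /Ad !mulmxA mulVmx // mul1mx mulmxKV.
by rewrite opprK; apply: (@half_double CC).
Qed.

Lemma tan_push (g xi : mat) : Gp g -> lie Gp xi ->
  tan (P : mat -> Prop) (jmap theta g) (g *m (xi - dth Th xi) *m invmx (theta g)).
Proof.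
move=> Gg Lxi p Hp; rewrite -(diffp_j HG ThE thetaG thetaM) //.
apply: (tan_left HG Gg Lxi) => h Gh; rewrite (ev_jsubst HG ThE thetaG thetaM) //.
by apply: Hp; apply: jP.
Qed.

Lemma ddt0_on_push f (g xi v : mat) : regular_on P f -> Gp g -> lie Gp xi ->
  g *m (xi - dth Th xi) *m invmx (theta g) = v ->
  ddt0_on G (f \o j) g (g *m xi) = ddt0_on P f (j g) v.
Proof.
move=> /(regular_onP cartanP_unit)[p Hp] Gg Lxi <-.
rewrite (ddt0_onP (S := P) cartanP_unit (jP Gg) (tan_push Gg Lxi) Hp).
rewrite -(diffp_j HG ThE thetaG thetaM) //.
apply: (ddt0_onP (S := G) GU Gg (tan_left HG Gg Lxi)) => h Gh /=.
by rewrite (ev_jsubst HG ThE thetaG thetaM) // Hp //; apply: jP.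
Qed.

Lemma flat_of_horizontally_flat : horizontally_flat G theta X ->
  flat_fields G theta (cartan_push G theta X).
Proof.
move=> [Phi [Preg Pp Peq Pd] Pflat].
have Preg' : polymx Gp Phi by apply/(regular_mapP GU).
have Pp' g : Gp g -> psp Gp Th (Phi g) by move=> Gg; apply/pspaceP; apply: Pp.
have Peq' g k k' : Gp g -> Gp k /\ theta k = k -> Gp k' /\ theta k' = k' ->
    Phi (k *m g *m k') = invmx k' *m Phi g *m k'.
  by move=> Gg Hk Hk'; rewrite Peq // /Ad invmxK.
have Pflat' y : Pset Gp theta y -> tan (Pset Gp theta) y (y *m Phi y).
  move=> /PsetP Py; rewrite -cartanPE; apply/(tangentP cartanP_unit) => //; exact: Pflat.
have [A HA] := flat_Psi HG primeG ThE thetaG thetaM thetaK Preg' Peq'.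
have AdE g (Gg : Gp g) := flat_Ad HG primeG ThE thetaG thetaM thetaK Preg' Pp' Peq' Pflat' Gg.
pose Psi (y : mat) : mat := map_mx (ev y) A.
have Psi_j g : Gp g -> Psi (j g) = 2 *: (theta g *m Phi g *m invmx (theta g)) by apply: HA.
have Psi_p y : P y -> pspace G theta (Psi y).
  move=> [g Gg <-]; apply/pspaceP; rewrite Psi_j //.
  have [L D] := psp_Ad_theta HG ThE thetaG thetaM thetaK Gg (Pp' g Gg) (AdE g Gg).
  by split; [apply: tan_lin => //; apply: unitmx1|rewrite dthZ D scalerN].
have Psi_fix y : P y -> Ad y (Psi y) = Psi y.
  move=> [g Gg <-]; have ug := GU Gg; have ut := GU (thetaG Gg); rewrite Psi_j //.
  rewrite /Ad -scalemxAr -scalemxAl; congr (_ *: _).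
  rewrite /cartan (_ : invmx (g *m invmx (theta g)) = theta g *m invmx g).
    by rewrite !mulmxA mulmxKV // mulmxKV // AdE.
  by rewrite (@invmxM CC) ?invmxK // unitmx_inv.
exists Psi; split=> //.
- by apply/(regular_mapP cartanP_unit); exists A.
- move=> k _ [Gk Hk] [g Gg <-]; have uk := GU Gk; have ut := GU (thetaG Gg).
  have E : Ad k (j g) = j (k *m g).
    rewrite /Ad /cartan thetaM // Hk (_ : invmx (k *m theta g) = invmx (theta g) *m invmx k) ?mulmxA //.
    exact: (@invmxM CC).
  have Gkg : Gp (k *m g) by case: HG => _ _ H _; apply: H.
  rewrite E !Psi_j // thetaM // Hk /Ad -scalemxAr -scalemxAl; congr (_ *: _).
  have -> : Phi (k *m g) = Phi g.
    have := Peq' g k 1%:M Gg (conj Gk Hk) (conj G1 (theta1 HG thetaG thetaM)).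
    by rewrite mulmx1 invmx1 mul1mx mulmx1.
  rewrite (_ : invmx (k *m theta g) = invmx (theta g) *m invmx k) ?mulmxA //.
  exact: (@invmxM CC).
- move=> f fP y; rewrite inE => -[g Gg <-].
  have gG : g \in G by rewrite inE.
  rewrite (cartan_pushE fP Gg) (Pd _ (regular_GK_comp fP) g gG).
  have Pj := jP Gg; rewrite /tilde_field (pi_at_fix (cartanP_unit Pj) (Psi_p _ Pj) (Psi_fix _ Pj)).
  have [L D] := Pp' g Gg; have ut := GU (thetaG Gg).
  apply: (ddt0_on_push fP Gg L).
  rewrite D opprK Psi_j // addmx_self -!scalemxAr -scalemxAl.
  by congr (_ *: _); rewrite /cartan !mulmxA mulmxKV.
Qed.

Lemma horizontally_flat_of_flat : flat_fields G theta (cartan_push G theta X) ->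
  horizontally_flat G theta X.
Proof.
move=> [Psi [Preg Pp Peq Pfix Pd]].
have Preg' : polymx (Pset Gp theta) Psi by rewrite -cartanPE; apply/(regular_mapP cartanP_unit).
have Pp' y : Pset Gp theta y -> psp Gp Th (Psi y) by move=> /PsetP Py; apply/pspaceP; apply: Pp.
have Peq' k y : Gp k /\ theta k = k -> Pset Gp theta y ->
    Psi (k *m y *m invmx k) = k *m Psi y *m invmx k.
  by move=> Hk /PsetP Py; apply: Peq.
have Pfix' y : Pset Gp theta y -> y *m Psi y *m invmx y = Psi y by move=> /PsetP; apply: Pfix.
have Phi_p := Phi_of_p HG ThE thetaG thetaM thetaK Pp' Pfix'.
exists (Phi_of theta Psi); last first.
  move=> y Py; apply/(tangentP cartanP_unit) => //; rewrite cartanPE.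
  have Py' : Pset Gp theta y by rewrite -cartanPE.
  exact: (Phi_of_flat HG primeG ThE thetaG thetaM thetaK Preg' Pp' Pfix' Py').
split.
- by apply/(regular_mapP GU); apply: (Phi_of_reg HG ThE thetaG thetaM Preg').
- by move=> g Gg; apply/pspaceP; apply: Phi_p.
- move=> g k k' Gg Hk Hk'; rewrite /Ad invmxK.
  exact: (Phi_of_eq HG thetaG thetaM Peq' Gg Hk Hk').
(* The hypothesis describes [X] only on pullbacks from P; [f] is first written as h \o j on [G], and
   [field_ext] transports the formula. *)
move=> f fGK g /[!inE] Gg; have [p Hp] := regular_GK_descent fGK.
pose h (y : mat) := ev y p.
have hP : regular_on P h by apply/(regular_onP cartanP_unit); exists p.
have fh : {in G, f =1 h \o j} by move=> x /[!inE] Gx; rewrite Hp.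
have hGK := regular_GK_comp hP.
have Pj := jP Gg; have [L D] := Phi_p g Gg.
have gG : g \in G by rewrite inE.
have jgP : j g \in P by rewrite inE.
rewrite (field_ext X_inv fGK hGK fh gG) -(cartan_pushE hP Gg) (Pd _ hP _ jgP) /tilde_field.
rewrite (pi_at_fix (cartanP_unit Pj) (Pp _ Pj) (Pfix _ Pj)).
rewrite -(ddt0_on_push (v := j g *m Psi (j g)) hP Gg L); last first.
  exact: (Phi_of_diff HG ThE thetaG thetaM thetaK Pp' Pfix' Gg).
have [q Hq] : exists q : M, forall x : mat, Gp x -> f x = ev x q.
  by case: fGK => /(regular_onP GU).
have Lt := tan_left HG Gg L.
rewrite (ddt0_onP (S := G) GU Gg Lt Hq); apply: (ddt0_onP (S := G) GU Gg Lt) => x Gx.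
by rewrite -Hq // fh ?inE.
Qed.

End Main.

Theorem lemma3p3 (R : realType) (N : nat) (G : set 'M[R[i]]_N)
    (theta : 'M[R[i]]_N -> 'M[R[i]]_N)
    (G_conn : zariski_connected G) (G_red : reductive G)
    (theta_inv : involutive_automorphism G theta)
    (X : ('M[R[i]]_N -> R[i]) -> 'M[R[i]]_N -> R[i])
    (X_inv : invariant_field G theta X) :
  horizontally_flat G theta X <->
  flat_fields G theta (cartan_push G theta X).
Proof.
have HG : zgroup (G : 'M[(R[i] : numClosedFieldType)]_N -> Prop).
  by case: G_red => /closed_subgroupP.
have primeG := vanish_prime HG (zconnectedP G_conn).
have [/(regular_mapP (fun x => zgroup_unit HG (x := x)))[Th ThE] thetaG thetaM thetaK] := theta_inv.
split.
  exact: (flat_of_horizontally_flat X_inv HG primeG ThE thetaG thetaM thetaK).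
exact: (horizontally_flat_of_flat X_inv HG primeG ThE thetaG thetaM thetaK).
Qed.
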